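(* Let $R>0$ and let $B_R$ be the ball of radius $R$ around the origin of $\mathbb{R}^n$. Let $f\ge 0$ be in $C^{0,\alpha}(B_R)\cap C(\overline{B_R})$ and let $g$ be a continuous function on $\overline{B_R}$. Assume in addition that $$f(x)=O\big((R^2-|x|^2)^3|x|^2\big),$$ i.e. there is a constant $C$ with $0\le f(x)\le C(R^2-|x|^2)^3|x|^2$ for all $x\in\overline{B_R}$. Then the boundary value problem $$\begin{cases}(\Delta v)^3|D(\Delta v)|^2=f(x) & \text{in } B_R,\\ v=g & \text{on }\partial B_R,\\ \Delta v=0 & \text{on }\partial B_R\end{cases}$$ has a viscosity solution $v\in C^{2,\beta}(B_R)\cap C(\overline{B_R})$ for some $\beta$ with $0<\beta\le\alpha$.
   Context: Here $0<\alpha<1$, $D$ denotes the gradient, and $C^{k,\alpha}(B_R)$ denotes functions whose derivatives of order $k$ are locally $\alpha$-Hölder continuous in the open ball $B_R$. The third-order problem is understood in factored form: $v$ is a viscosity solution of the boundary value problem if there is a function $w\in C(\overline{B_R})$ that is a viscosity solution (in the usual sense for first-order equations) of $w^3|Dw|^2=f(x)$ in $B_R$ with $w=0$ on $\partial B_R$, and $\Delta v=w$ in $B_R$, $v=g$ on $\partial B_R$. The usual sense: $w$ is a subsolution (supersolution) of $G(x,w,Dw)=0$ if, whenever $\varphi$ is smooth and $w-\varphi$ has a local maximum (minimum) at $x\in B_R$, one has $G(x,w(x),D\varphi(x))\le 0$ ($\ge 0$); a viscosity solution is both. Here $G(x,s,p)=s^3|p|^2-f(x)$. *)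

(* Defs.v *)
From HB Require Import structures.
From mathcomp Require Import all_boot all_order all_algebra.
From mathcomp Require Import all_classical all_reals all_analysis.

Set Implicit Arguments.
Unset Strict Implicit.
Unset Printing Implicit Defensive.

Import Order.TTheory GRing.Theory Num.Theory.
Import numFieldNormedType.Exports.

Local Open Scope classical_set_scope.
Local Open Scope ring_scope.

Section Euclidean.
Context {R : realType} {n : nat}.
Implicit Types (x p : 'rV[R]_n) (f : 'rV[R]_n -> R) (U : set 'rV[R]_n).

(* The library norm on 'rV[R]_n is the max norm; it induces the same topology
   but its balls are cubes, hence the explicit Euclidean norm and balls. *)
Definition enorm x : R := Num.sqrt (\sum_(i < n) x 0 i ^+ 2).

Definition eball (r : R) : set 'rV[R]_n := [set x | enorm x < r].
Definition ceball (r : R) : set 'rV[R]_n := [set x | enorm x <= r].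
Definition esphere (r : R) : set 'rV[R]_n := [set x | enorm x = r].

Definition partial (i : 'I_n) f : 'rV[R]_n -> R :=
  fun x => 'D_(delta_mx 0 i) f x.

Definition gradient f x : 'rV[R]_n := \row_i partial i f x.

Definition laplacian f x : R := \sum_(i < n) partial i (partial i f) x.

(* [:: i1; ...; ik] stands for the operator d_i1 ... d_ik. *)
Definition partials (s : seq 'I_n) f : 'rV[R]_n -> R := foldr partial f s.

(* U is meant to be open. 'D_v f x is a total operator, so the existence of
   the partial derivatives has to be required explicitly. *)
Definition Ck (k : nat) U f : Prop :=
  (forall s i x, (size s < k)%N -> U x ->
     derivable (partials s f) x (delta_mx 0 i)) /\
  (forall s x, (size s <= k)%N -> U x -> {for x, continuous (partials s f)}).

Definition smooth U f : Prop := forall k, Ck k U f.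

Definition locally_hoelder (a : R) U f : Prop :=
  forall K : set 'rV[R]_n, compact K -> K `<=` U ->
  exists C : R, forall x y, K x -> K y ->
    `|f x - f y| <= C * enorm (x - y) `^ a.

Definition Ckhoelder (k : nat) (a : R) U f : Prop :=
  Ck k U f /\ (forall s, size s = k -> locally_hoelder a U (partials s f)).

Definition local_max f x : Prop := \forall y \near x, f y <= f x.
Definition local_min f x : Prop := \forall y \near x, f x <= f y.

Definition viscosity_subsolution (G : 'rV[R]_n -> R -> 'rV[R]_n -> R) U
    (w : 'rV[R]_n -> R) : Prop :=
  forall (phi : 'rV[R]_n -> R) x, smooth U phi -> U x ->
    local_max (fun y => w y - phi y) x -> G x (w x) (gradient phi x) <= 0.

Definition viscosity_supersolution (G : 'rV[R]_n -> R -> 'rV[R]_n -> R) U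
    (w : 'rV[R]_n -> R) : Prop :=
  forall (phi : 'rV[R]_n -> R) x, smooth U phi -> U x ->
    local_min (fun y => w y - phi y) x -> 0 <= G x (w x) (gradient phi x).

Definition viscosity_solution (G : 'rV[R]_n -> R -> 'rV[R]_n -> R) U
    (w : 'rV[R]_n -> R) : Prop :=
  viscosity_subsolution G U w /\ viscosity_supersolution G U w.

Definition operatorG f x (s : R) p : R := s ^+ 3 * enorm p ^+ 2 - f x.

(* (Delta v)^3 |D (Delta v)|^2 = f in the ball of radius r, with v = g and
   Delta v = 0 on the sphere, in factored form: w is the continuous extension
   of Delta v to the closed ball. *)
Definition viscosity_solution_bvp (r : R) f (g v : 'rV[R]_n -> R) : Prop :=
  exists w : 'rV[R]_n -> R,
    [/\ {within ceball r, continuous w},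
        viscosity_solution (operatorG f) (eball r) w
      & forall x, esphere r x -> w x = 0] /\
    [/\ Ck 2 (eball r) v,
        forall x, eball r x -> laplacian v x = w x
      & forall x, esphere r x -> v x = g x].

End Euclidean.

(* Main.v *)
Require Import Defs.
From HB Require Import structures.
From mathcomp Require Import all_boot all_order all_algebra.
From mathcomp Require Import all_classical all_reals all_analysis.
From mathcomp Require Import ring lra.

Set Implicit Arguments.
Unset Strict Implicit.
Unset Printing Implicit Defensive.

Import Order.TTheory GRing.Theory Num.Theory.
Import numFieldNormedType.Exports.

Local Open Scope classical_set_scope.
Local Open Scope ring_scope.

(** The substitution [u = (2/5) w ^ (5/2)] turns [w ^ 3 |Dw| ^ 2 = f] into the
    eikonal equation [|Du| ^ 2 = f]. Its largest subsolution vanishing on the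
    sphere is defined here without derivatives: [u] is a subsolution when
    [u x - u y <= m |x - y|] as soon as [sqrt f <= m] on the segment from [x] to [y].
    The supremum [eikonal_sol] of these functions is again one of them, hence
    Lipschitz; it solves the equation in the viscosity sense by Perron's argument
    (lemmas [eikonal_superdifferential] and [eikonal_subdifferential]). Where
    [w > 0] the map [s |-> (2/5) s ^ (5/2)] is differentiable and increasing and
    carries test functions of [w] to test functions of [u]; where [w = 0] the
    solution [u] is at its minimum, so that [f] vanishes there. Being the power [2/5]
    of a Lipschitz function, [w] is Hoelder continuous with exponent [2/5].

    It remains to solve [Delta v = w], [v = g] on the sphere, with [w] Hoelder
    continuous and [g] continuous (theorem [poisson_hoelder]). The proof uses no
    integral representation: everything rests on polynomials and on the maximum
    principle.

    - For polynomial data the problem has a polynomial solution, because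
      [q |-> Delta ((rho ^ 2 - |x - x0| ^ 2) q)] preserves the degree and is injective
      by the maximum principle ([poisson_polynomial]). By the theorem of Weierstrass
      and the maximum principle again, polynomial solutions converge uniformly to
      some continuous [v] ([poisson_limit_exists]).
    - The partial derivatives of a harmonic polynomial in the interior of a ball are
      bounded by its supremum, by comparison of its odd part with an explicit barrier
      ([gradient_upper]). Consequently it is approximated by its second-order Taylor
      polynomial up to a cubic error ([harmonic_taylor]).
    - In a small ball [v] is close to a polynomial [h] with [Delta h = w x0]. Replacing
      [h] by its Taylor polynomial and iterating on shrinking balls produces a
      quadratic polynomial that approximates [v] at [x0] to the order [2 + bt]
      ([second_order_expansion]); this is Campanato's form of the Schauder estimate.
    - A function with such expansions at all points, uniformly, has Hoelder continuous
      second derivatives, the coefficients of the expansions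
      ([compare_expansions], [second_derivative]). The trace of the quadratic part is
      [w x0], so [Delta v = w]. *)

(** * The Euclidean norm and its topology *)

Section EuclideanNorm.
Context {R : realType} {n : nat}.
Implicit Types (x y z : 'rV[R]_n) (a : R).

Definition dot x y : R := \sum_(i < n) x 0 i * y 0 i.

Lemma enorm_ge0 x : 0 <= enorm x.
Proof. exact: sqrtr_ge0. Qed.

Lemma enorm_sqr x : enorm x ^+ 2 = dot x x.
Proof.
rewrite /enorm sqr_sqrtr; first by apply: eq_bigr => i _; rewrite expr2.
by apply: sumr_ge0 => i _; exact: sqr_ge0.
Qed.

Lemma dotC x y : dot x y = dot y x.
Proof. by apply: eq_bigr => i _; rewrite mulrC. Qed.

Lemma dotDl x y z : dot (x + y) z = dot x z + dot y z.
Proof. by rewrite /dot -big_split /=; apply: eq_bigr => i _; rewrite mxE mulrDl. Qed.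

Lemma dotZl a x z : dot (a *: x) z = a * dot x z.
Proof. by rewrite /dot mulr_sumr; apply: eq_bigr => i _; rewrite mxE mulrA. Qed.

Lemma dotDr x y z : dot z (x + y) = dot z x + dot z y.
Proof. by rewrite dotC dotDl !(dotC z). Qed.

Lemma dotZr a x z : dot z (a *: x) = a * dot z x.
Proof. by rewrite dotC dotZl dotC. Qed.

Lemma dotNl x z : dot (- x) z = - dot x z.
Proof. by rewrite -scaleN1r dotZl mulN1r. Qed.

Lemma dotNr x z : dot z (- x) = - dot z x.
Proof. by rewrite -scaleN1r dotZr mulN1r. Qed.

Lemma dot0l x : dot 0 x = 0.
Proof. by rewrite /dot big1 // => i _; rewrite mxE mul0r. Qed.

Lemma dot_delta x i : dot x (delta_mx 0 i) = x 0 i.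
Proof.
rewrite /dot (bigD1 i) //= big1 ?addr0; first by rewrite mxE !eqxx mulr1.
by move=> j /negPf ji; rewrite mxE ji andbF mulr0.
Qed.

Lemma dot_ge0 x : 0 <= dot x x.
Proof. by rewrite -enorm_sqr sqr_ge0. Qed.

Lemma enorm_eq0 x : enorm x = 0 -> x = 0.
Proof.
move=> h; have: dot x x = 0 by rewrite -enorm_sqr h expr0n.
move/eqP; rewrite /dot psumr_eq0 => [/allP h0|i _]; last by rewrite -expr2 sqr_ge0.
apply/rowP => i; rewrite mxE; have := h0 i (mem_index_enum _).
by rewrite mulf_eq0 orbb => /eqP.
Qed.

Lemma enorm0 : enorm (0 : 'rV[R]_n) = 0.
Proof. by apply/eqP; rewrite -sqrf_eq0 enorm_sqr dot0l. Qed.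

Lemma enormZ a x : enorm (a *: x) = `|a| * enorm x.
Proof.
apply/eqP; rewrite -(eqrXn2 (_ : 0 < 2)%N) ?enorm_ge0 ?mulr_ge0 ?enorm_ge0 //.
by rewrite exprMn !enorm_sqr dotZl dotZr real_normK ?num_real // mulrA expr2.
Qed.

Lemma enormN x : enorm (- x) = enorm x.
Proof. by rewrite -scaleN1r enormZ normrN1 mul1r. Qed.

Lemma enormB x y : enorm (x - y) = enorm (y - x).
Proof. by rewrite -opprB enormN. Qed.

(** The quadratic polynomial [a |-> dot (x - a y) (x - a y)] is nonnegative at its
    minimiser. *)
Lemma cauchy_schwarz x y : `|dot x y| <= enorm x * enorm y.
Proof.
have [y0|yn0] := eqVneq (enorm y) 0.
  by rewrite (enorm_eq0 y0) dotC dot0l normr0 enorm0 mulr0.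
rewrite -(@ler_pXn2r _ 2) // ?nnegrE ?mulr_ge0 ?enorm_ge0 //.
rewrite exprMn real_normK ?num_real // !enorm_sqr.
have yy : 0 < dot y y by rewrite lt_def dot_ge0 -enorm_sqr sqrf_eq0 yn0.
have := dot_ge0 (x - (dot x y / dot y y) *: y).
rewrite !(dotDl, dotDr, dotNl, dotNr, dotZl, dotZr) (dotC y x).
set c := dot x y / dot y y.
have cyy : c * dot y y = dot x y by rewrite /c divfK // gt_eqF.
move=> h; have {}h : c * dot x y <= dot x x by move: h; rewrite cyy; lra.
have : c * dot x y * dot y y <= dot x x * dot y y by rewrite ler_pM2r.
suff -> : c * dot x y * dot y y = dot x y ^+ 2 by [].
by rewrite mulrAC cyy expr2.
Qed.

Lemma enorm_triangle x y : enorm (x + y) <= enorm x + enorm y.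
Proof.
rewrite -(@ler_pXn2r _ 2) // ?nnegrE ?addr_ge0 ?enorm_ge0 //.
rewrite enorm_sqr dotDl !dotDr (dotC y x) sqrrD !enorm_sqr.
have := cauchy_schwarz x y; have := ler_norm (dot x y); lra.
Qed.

Lemma enorm_distD z x y : enorm (x - y) <= enorm (x - z) + enorm (z - y).
Proof. by rewrite -(subrKA z) enorm_triangle. Qed.

Lemma coord_le_enorm x i : `|x 0 i| <= enorm x.
Proof.
rewrite -(@ler_pXn2r _ 2) // ?nnegrE ?enorm_ge0 // real_normK ?num_real //.
rewrite enorm_sqr /dot (bigD1 i) //= -expr2 lerDl.
by apply: sumr_ge0 => j _; rewrite -expr2 sqr_ge0.
Qed.

Lemma norm_le_enorm x : `|x| <= enorm x.
Proof.
rewrite /Num.norm /= mx_normrE; apply/bigmax_leP; split=> [|[i j] _ /=].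
  exact: enorm_ge0.
by rewrite ord1 coord_le_enorm.
Qed.

Lemma coord_le_norm x i : `|x 0 i| <= `|x|.
Proof.
rewrite [leRHS]/Num.norm /= mx_normrE.
by apply/bigmax_geP; right => /=; exists (0, i).
Qed.

Lemma enorm_le_norm x : enorm x <= n%:R * `|x|.
Proof.
rewrite -(@ler_pXn2r _ 2) // ?nnegrE ?mulr_ge0 ?enorm_ge0 // enorm_sqr /dot.
apply: (@le_trans _ _ (\sum_(i < n) `|x| ^+ 2)).
  apply: ler_sum => i _; rewrite -expr2 -(real_normK (num_real _)).
  by rewrite lerXn2r ?nnegrE ?coord_le_norm.
rewrite sumr_const card_ord -[leLHS]mulr_natl exprMn; apply: ler_wpM2r; first exact: sqr_ge0.
by rewrite -natrX ler_nat; case: (n) => // k; rewrite leq_pmulr.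
Qed.

(** The Euclidean and the maximum norm are comparable, so Euclidean balls form a
    basis of neighbourhoods. *)
Lemma nbhs_enormP x (P : set 'rV[R]_n) :
  (\forall y \near x, P y) <->
  exists2 d : R, 0 < d & forall y, enorm (y - x) < d -> P y.
Proof.
split.
- move=> /nbhs_ballP[d /= d0 hd]; exists d => // y hy; apply: hd.
  by rewrite -ball_normE /= distrC (le_lt_trans (norm_le_enorm _)).
- move=> [d d0 hd]; apply/nbhs_ballP; exists (d / n.+1%:R) => /=; first by rewrite divr_gt0.
  move=> y; rewrite -ball_normE /= distrC => hy; apply: hd.
  apply: (le_lt_trans (enorm_le_norm _)).
  apply: (@le_lt_trans _ _ (n.+1%:R * `|y - x|)).
    by rewrite ler_wpM2r // ler_nat.
  by rewrite mulrC -ltr_pdivlMr.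
Qed.

Lemma enorm_continuous x0 : continuous (fun x => enorm (x - x0)).
Proof.
move=> x; apply/(@cvgrPdist_lt _ _ _ _ (fmap_filter _ (nbhs_filter x))) => e e0.
apply/nbhs_enormP; exists e => // y hy.
rewrite /= ltr_norml; apply/andP; split.
- by have := enorm_distD x y x0; lra.
- by have := enorm_distD y x x0; rewrite (enormB x y); lra.
Qed.

Definition cball x0 (rho : R) : set 'rV[R]_n := [set x | enorm (x - x0) <= rho].

Lemma closed_cball x0 rho : closed (cball x0 rho).
Proof.
have -> : cball x0 rho = (fun x => enorm (x - x0)) @^-1` [set a | a <= rho] by [].
by apply: closed_comp; [move=> x _; exact: enorm_continuous|exact: closed_le].
Qed.

Lemma compact_cball x0 rho : compact (cball x0 rho).
Proof.
apply: bounded_closed_compact; last exact: closed_cball.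
exists (enorm x0 + rho); split; first exact: num_real.
move=> M hM x /= hx; apply: (le_trans (norm_le_enorm _)); apply: (le_trans _ (ltW hM)).
have := enorm_triangle (x - x0) x0; rewrite subrK => /le_trans; apply.
by rewrite addrC lerD2l.
Qed.

Lemma ceballE rho : ceball rho = cball 0 rho.
Proof. by apply/seteqP; split => x /=; rewrite /cball /ceball /= subr0. Qed.

Lemma within_continuousE (A : set 'rV[R]_n) (f : 'rV[R]_n -> R) :
  {within A, continuous f} <->
  forall x, A x -> forall e, 0 < e -> exists2 d, 0 < d &
    forall y, A y -> enorm (y - x) < d -> `|f y - f x| < e.
Proof.
have FF x : Filter (f @ within A (nbhs x)).
  exact: fmap_filter _ (within_filter _ (nbhs_filter x)).
split.
- move=> /subspace_continuousP h x Ax e e0.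
  have /(@cvgrPdist_lt _ _ _ _ (FF x))/(_ e e0) := h x Ax.
  move=> /(@nbhs_enormP x _)[d d0 hd].
  by exists d => // y Ay xy; rewrite distrC; apply: hd.
- move=> h; apply/subspace_continuousP => x Ax.
  apply/(@cvgrPdist_lt _ _ _ _ (FF x)) => e e0; apply/(@nbhs_enormP x _).
  have [d d0 hd] := h x Ax e e0; exists d => // y xy Ay.
  by rewrite /= distrC; apply: hd.
Qed.

Lemma cball_convex x0 rho x y a : 0 <= a <= 1 -> cball x0 rho x -> cball x0 rho y ->
  cball x0 rho (x + a *: (y - x)).
Proof.
move=> /andP[a0 a1] hx hy; rewrite /cball /=.
have -> : x + a *: (y - x) - x0 = (1 - a) *: (x - x0) + a *: (y - x0).
  by apply/rowP => i; rewrite !mxE; ring.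
apply: (le_trans (enorm_triangle _ _)); rewrite !enormZ !ger0_norm ?subr_ge0 //.
have : (1 - a) * enorm (x - x0) <= (1 - a) * rho by rewrite ler_wpM2l ?subr_ge0.
have : a * enorm (y - x0) <= a * rho by rewrite ler_wpM2l.
by lra.
Qed.

End EuclideanNorm.

(** * Polynomial functions *)

Section PolynomialFunctions.
Context {R : realType} {n : nat}.
Local Notation E := 'rV[R]_n.
Implicit Types (x y v : E) (i j : 'I_n) (c t : R) (f g : E -> R).

(** The bound [d] on the degree is what confines the Dirichlet problem to a
    finite-dimensional space. *)
Inductive pdeg : nat -> (E -> R) -> Prop :=
| pdeg_cst d c : pdeg d (fun=> c)
| pdegD d f g : pdeg d f -> pdeg d g -> pdeg d (fun x => f x + g x)
| pdegX d i f : pdeg d f -> pdeg d.+1 (fun x => x 0 i * f x).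

Definition polyfun f := exists d, pdeg d f.

Lemma pdegS d f : pdeg d f -> pdeg d.+1 f.
Proof.
elim=> {d f} [d c|d f g _ hf _ hg|d i f _ hf]; first exact: pdeg_cst.
  exact: pdegD.
exact: pdegX.
Qed.

Lemma pdegW d e f : (d <= e)%N -> pdeg d f -> pdeg e f.
Proof.
move=> /subnK <- hf; elim: (e - d)%N => [//|k IH]; rewrite addSn; exact: pdegS.
Qed.

Lemma pdegZ d c f : pdeg d f -> pdeg d (fun x => c * f x).
Proof.
elim=> {d f} [d e|d f g _ hf _ hg|d i f _ hf]; first exact: pdeg_cst.
- have -> : (fun x => c * (f x + g x)) = (fun x => c * f x + c * g x).
    by apply/funext => x; rewrite mulrDr.
  exact: pdegD.
- have -> : (fun x => c * (x 0 i * f x)) = (fun x => x 0 i * (c * f x)).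
    by apply/funext => x; rewrite mulrCA.
  exact: pdegX.
Qed.

Lemma pdegM d e f g : pdeg d f -> pdeg e g -> pdeg (d + e) (fun x => f x * g x).
Proof.
move=> + hg; elim=> {d f} [d c|d f f' _ hf _ hf'|d i f _ hf].
- by apply: (@pdegW e); [exact: leq_addl|exact: pdegZ].
- have -> : (fun x => (f x + f' x) * g x) = (fun x => f x * g x + f' x * g x).
    by apply/funext => x; rewrite mulrDl.
  exact: pdegD.
- have -> : (fun x => x 0 i * f x * g x) = (fun x => x 0 i * (f x * g x)).
    by apply/funext => x; rewrite mulrA.
  exact: pdegX.
Qed.

Lemma pdeg_coord i : pdeg 1 (fun x => x 0 i).
Proof.
have -> : (fun x : E => x 0 i) = (fun x => x 0 i * 1).
  by apply/funext => x; rewrite mulr1.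
exact/pdegX/pdeg_cst.
Qed.

Lemma pdeg_sum (I : Type) (s : seq I) (P : pred I) d (F : I -> E -> R) :
  (forall k, P k -> pdeg d (F k)) -> pdeg d (fun x => \sum_(k <- s | P k) F k x).
Proof.
move=> hF; elim: s => [|k s IH].
  have -> : (fun x : E => \sum_(k <- [::] | P k) F k x) = (fun=> 0).
    by apply/funext => x; rewrite big_nil.
  exact: pdeg_cst.
have [Pk|Pk] := boolP (P k).
  have -> : (fun x => \sum_(j <- k :: s | P j) F j x) =
            (fun x => F k x + \sum_(j <- s | P j) F j x).
    by apply/funext => x; rewrite big_cons Pk.
  by apply: pdegD => //; exact: hF.
have -> // : (fun x => \sum_(j <- k :: s | P j) F j x) =
            (fun x => \sum_(j <- s | P j) F j x).
by apply/funext => x; rewrite big_cons (negPf Pk).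
Qed.

Lemma pdeg_comp d f (A : E -> E) :
  (forall i, pdeg 1 (fun x => A x 0 i)) -> pdeg d f -> pdeg d (fun x => f (A x)).
Proof.
move=> hA; elim=> {d f} [d c|d f g _ hf _ hg|d i f _ hf]; first exact: pdeg_cst.
  exact: pdegD.
exact: (pdegM (hA i) hf).
Qed.

Lemma pdeg0 f : pdeg 0 f -> exists c, f = (fun _ : E => c).
Proof.
suff h d : pdeg d f -> d = 0%N -> exists c, f = (fun _ : E => c) by move/h; exact.
elim=> {d f} //.
- by move=> _ c _; exists c.
- move=> d f g _ hf _ hg d0; have [a ->] := hf d0; have [b ->] := hg d0.
  by exists (a + b).
Qed.

Lemma polyfun_cst c : polyfun (fun=> c).
Proof. by exists 0%N; exact: pdeg_cst. Qed.

Lemma polyfunD f g : polyfun f -> polyfun g -> polyfun (fun x => f x + g x).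
Proof.
move=> [d hf] [e hg]; exists (maxn d e).
by apply: pdegD; [apply: pdegW hf|apply: pdegW hg]; rewrite ?leq_maxl ?leq_maxr.
Qed.

Lemma polyfunM f g : polyfun f -> polyfun g -> polyfun (fun x => f x * g x).
Proof. by move=> [d hf] [e hg]; exists (d + e)%N; exact: pdegM. Qed.

Lemma polyfunZ c f : polyfun f -> polyfun (fun x => c * f x).
Proof. by move=> [d hf]; exists d; exact: pdegZ. Qed.

Lemma polyfunN f : polyfun f -> polyfun (fun x => - f x).
Proof.
move=> hf; have -> : (fun x => - f x) = (fun x => (-1) * f x).
  by apply/funext => x; rewrite mulN1r.
exact: polyfunZ.
Qed.

Lemma polyfunB f g : polyfun f -> polyfun g -> polyfun (fun x => f x - g x).
Proof. by move=> hf hg; apply: polyfunD => //; exact: polyfunN. Qed.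

Lemma polyfun_coord i : polyfun (fun x => x 0 i).
Proof. by exists 1%N; exact: pdeg_coord. Qed.

Lemma polyfun_sum (I : Type) (s : seq I) (F : I -> E -> R) :
  (forall k, polyfun (F k)) -> polyfun (fun x => \sum_(k <- s) F k x).
Proof.
move=> hF; elim: s => [|k s IH].
  have -> : (fun x : E => \sum_(k <- [::]) F k x) = (fun=> 0).
    by apply/funext => x; rewrite big_nil.
  exact: polyfun_cst.
have -> : (fun x => \sum_(j <- k :: s) F j x) = (fun x => F k x + \sum_(j <- s) F j x).
  by apply/funext => x; rewrite big_cons.
exact: polyfunD.
Qed.

Lemma polyfun_prod (I : Type) (s : seq I) (F : I -> E -> R) :
  (forall k, polyfun (F k)) -> polyfun (fun x => \prod_(k <- s) F k x).
Proof.
move=> hF; elim: s => [|k s IH].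
  have -> : (fun x : E => \prod_(k <- [::]) F k x) = (fun=> 1).
    by apply/funext => x; rewrite big_nil.
  exact: polyfun_cst.
have -> : (fun x => \prod_(j <- k :: s) F j x) = (fun x => F k x * \prod_(j <- s) F j x).
  by apply/funext => x; rewrite big_cons.
exact: polyfunM.
Qed.

Lemma polyfun_comp f (A : E -> E) : (forall i, pdeg 1 (fun x => A x 0 i)) ->
  polyfun f -> polyfun (fun x => f (A x)).
Proof. by move=> hA [d hf]; exists d; exact: pdeg_comp. Qed.

Lemma polyfun_differentiable f x : polyfun f -> differentiable f x.
Proof.
move=> [d hf]; elim: hf => {d f} [d c|d f g _ hf _ hg|d i f _ hf].
- exact: differentiable_cst.
- exact: differentiableD.
- apply: (@differentiableM _ _ (fun x : E => x 0 i)) => //.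
  exact: differentiable_coord.
Qed.

Lemma polyfun_derivable f x v : polyfun f -> derivable f x v.
Proof. by move=> hf; exact/diff_derivable/polyfun_differentiable. Qed.

Lemma polyfun_continuous f : polyfun f -> continuous f.
Proof. by move=> hf x; exact/differentiable_continuous/polyfun_differentiable. Qed.

Lemma polyfun_within f (A : set E) : polyfun f -> {within A, continuous f}.
Proof. by move=> hf; exact/continuous_subspaceT/polyfun_continuous. Qed.

Lemma partial_cst i c : partial i (fun=> c : R) = (fun=> 0 : R) :> (E -> R).
Proof. by apply/funext => x; rewrite /partial -[RHS](derive_cst c x (delta_mx 0 i)). Qed.

Lemma partialD i f g : polyfun f -> polyfun g ->
  partial i (fun x => f x + g x) = (fun x => partial i f x + partial i g x).
Proof.
move=> hf hg; apply/funext => x.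
by rewrite /partial -deriveD //; exact: polyfun_derivable.
Qed.

Lemma partialZ i c f : polyfun f ->
  partial i (fun x => c * f x) = (fun x => c * partial i f x).
Proof.
move=> hf; apply/funext => x.
by have := @deriveZ _ _ _ f c x (delta_mx 0 i) (polyfun_derivable (f:=f) hf).
Qed.

Lemma partialN i f : polyfun f -> partial i (fun x => - f x) = (fun x => - partial i f x).
Proof.
move=> hf; apply/funext => x.
by rewrite /partial -deriveN //; exact: polyfun_derivable.
Qed.

Lemma partialB i f g : polyfun f -> polyfun g ->
  partial i (fun x => f x - g x) = (fun x => partial i f x - partial i g x).
Proof. by move=> hf hg; rewrite partialD ?partialN //; exact: polyfunN. Qed.

Lemma partial_sum i (I : finType) (F : I -> E -> R) : (forall k, polyfun (F k)) ->
  partial i (fun x => \sum_k F k x) = (fun x => \sum_k partial i (F k) x).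
Proof.
move=> hF; suff h (s : seq I) : partial i (fun x => \sum_(k <- s) F k x) =
    (fun x => \sum_(k <- s) partial i (F k) x) by exact: h.
elim: s => [|k s IH].
  have -> : (fun x : E => \sum_(k <- [::]) F k x) = (fun=> 0).
    by apply/funext => x; rewrite big_nil.
  by rewrite partial_cst; apply/funext => x; rewrite big_nil.
have -> : (fun x => \sum_(j <- k :: s) F j x) = (fun x => F k x + \sum_(j <- s) F j x).
  by apply/funext => x; rewrite big_cons.
rewrite partialD //; last exact: polyfun_sum.
by rewrite IH; apply/funext => x; rewrite big_cons.
Qed.

Lemma partialM i f g : polyfun f -> polyfun g ->
  partial i (fun x => f x * g x) = (fun x => partial i f x * g x + f x * partial i g x).
Proof.
move=> hf hg; apply/funext => x.
have := deriveM (@polyfun_derivable f x (delta_mx 0 i) hf)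
  (@polyfun_derivable g x (delta_mx 0 i) hg).
by rewrite addrC [X in _ = X + _ -> _]mulrC.
Qed.

Lemma partial_coord i j : partial i (fun x => x 0 j) = (fun=> (i == j)%:R : R).
Proof.
apply/funext => x; rewrite /partial /derive.
apply/lim_near_cst => //=; near=> h.
have h0 : h != 0 by near: h; exact: nbhs_dnbhs_neq.
by rewrite !mxE /= addrK [LHS]mulrA mulVf // mul1r eq_sym.
Unshelve. all: by end_near. Qed.

Lemma pdeg_partial d f i : pdeg d f -> pdeg d.-1 (partial i f).
Proof.
elim=> {d f} [d c|d f g pf hf pg hg|d j f pf hf].
- by rewrite partial_cst; exact: pdeg_cst.
- by rewrite partialD; [exact: pdegD|exists d..].
- rewrite partialM; [|exact: polyfun_coord|by exists d].
  rewrite partial_coord /=; apply: pdegD; first exact: pdegZ.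
  case: d pf hf => [|d] pf hf; last exact: pdegX.
  have [c ->] := pdeg0 pf; rewrite partial_cst.
  have -> : (fun x : E => x 0 j * 0 : R) = (fun=> 0) by apply/funext => x; rewrite mulr0.
  exact: pdeg_cst.
Qed.

Lemma polyfun_partial f i : polyfun f -> polyfun (partial i f).
Proof. by move=> [d hf]; exists d.-1; exact: pdeg_partial. Qed.

Lemma partialC i j f : polyfun f -> partial i (partial j f) = partial j (partial i f).
Proof.
move=> [d hf]; elim: hf => {d f} [d c|d f g pf hf pg hg|d k f pf hf].
- by rewrite (partial_cst j c) (partial_cst i c) !partial_cst.
- have hf' : polyfun f by exists d.
  have hg' : polyfun g by exists d.
  rewrite (partialD j hf' hg') (partialD i hf' hg').
  rewrite (partialD i (polyfun_partial j hf') (polyfun_partial j hg')).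
  rewrite (partialD j (polyfun_partial i hf') (polyfun_partial i hg')).
  by rewrite hf hg.
- have hf' : polyfun f by exists d.
  have hx := polyfun_coord k.
  have dX l h : polyfun h -> partial l (fun x => x 0 k * h x) =
      (fun x => (l == k)%:R * h x + x 0 k * partial l h x).
    by move=> ph; rewrite (partialM l hx ph) partial_coord.
  have dXX l m : partial l (partial m (fun x => x 0 k * f x)) =
      (fun x => (m == k)%:R * partial l f x +
         ((l == k)%:R * partial m f x + x 0 k * partial l (partial m f) x)).
    rewrite (dX m f hf') partialD; first last.
    - exact: polyfunM hx (polyfun_partial m hf').
    - exact: polyfunZ.
    by rewrite (partialZ l _ hf') (dX l _ (polyfun_partial m hf')).
  by rewrite (dXX i j) (dXX j i) hf; apply/funext => x; rewrite addrCA.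
Qed.

Lemma polyfun_laplacian f : polyfun f -> polyfun (laplacian f).
Proof.
by move=> hf; apply: polyfun_sum => i; exact: polyfun_partial i (polyfun_partial i hf).
Qed.

Lemma pdeg_laplacian d f : pdeg d f -> pdeg d.-2 (laplacian f).
Proof. by move=> hf; apply: pdeg_sum => i _; exact: pdeg_partial i (pdeg_partial i hf). Qed.

Lemma laplacianD f g : polyfun f -> polyfun g ->
  laplacian (fun x => f x + g x) = (fun x => laplacian f x + laplacian g x).
Proof.
move=> hf hg; apply/funext => x; rewrite /laplacian -big_split /=.
by apply: eq_bigr => i _; rewrite !partialD //; exact: polyfun_partial.
Qed.

Lemma laplacianZ c f : polyfun f ->
  laplacian (fun x => c * f x) = (fun x => c * laplacian f x).
Proof.
move=> hf; apply/funext => x; rewrite /laplacian mulr_sumr.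
by apply: eq_bigr => i _; rewrite !partialZ //; exact: polyfun_partial.
Qed.

Lemma laplacianN f : polyfun f ->
  laplacian (fun x => - f x) = (fun x => - laplacian f x).
Proof.
move=> hf; apply/funext => x; rewrite /laplacian -sumrN.
by apply: eq_bigr => i _; rewrite !partialN //; exact: polyfun_partial.
Qed.

Lemma laplacianB f g : polyfun f -> polyfun g ->
  laplacian (fun x => f x - g x) = (fun x => laplacian f x - laplacian g x).
Proof. by move=> hf hg; rewrite laplacianD ?laplacianN //; exact: polyfunN. Qed.

Lemma laplacian_partial i f : polyfun f ->
  laplacian (partial i f) = partial i (laplacian f).
Proof.
move=> hf; rewrite [in RHS]/laplacian partial_sum.
  apply/funext => x; apply: eq_bigr => j _.
  by rewrite (partialC j i hf) (partialC j i (polyfun_partial j hf)).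
by move=> k; exact: polyfun_partial k (polyfun_partial k hf).
Qed.

End PolynomialFunctions.

(** * Taylor expansion and the second derivative test *)

Section Taylor.
Context {R : realType} {n : nat}.
Local Notation E := 'rV[R]_n.
Implicit Types (x y v : E) (i j : 'I_n) (c t : R) (f g : E -> R).

Definition dirD v f : E -> R := fun x => \sum_i v 0 i * partial i f x.

Lemma polyfun_dirD v f : polyfun f -> polyfun (dirD v f).
Proof. by move=> hf; apply: polyfun_sum => i; exact/polyfunZ/polyfun_partial. Qed.

Lemma derive_dirD f x v : polyfun f -> 'D_v f x = dirD v f x.
Proof.
move=> hf; have df : differentiable f x by exact: polyfun_differentiable.
rewrite deriveE // {1}(row_sum_delta v) linear_sum /dirD; apply: eq_bigr => i _.
by rewrite linearZ /= -deriveE.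
Qed.

Lemma is_derive_line f x v t : polyfun f ->
  is_derive t 1 (fun t => f (x + t *: v)) (dirD v f (x + t *: v)).
Proof.
move=> hf; have h : (fun h => h^-1 *: (((fun t => f (x + t *: v)) \o shift t) (h *: 1) -
     f (x + t *: v))) =
   (fun h => h^-1 *: ((f \o shift (x + t *: v)) (h *: v) - f (x + t *: v))).
  apply/funext => h /=; congr (_ *: (f _ - _)).
  by rewrite scalerDl addrCA /GRing.scale /= mulr1.
split; rewrite /derivable /derive h; first exact: (polyfun_derivable (f := f)).
exact: derive_dirD.
Qed.

Lemma mvt_bound (g g' : R -> R) (K : R) :
  (forall t, is_derive t 1 g (g' t)) -> g 0 = 0 ->
  (forall t, 0 <= t <= 1 -> `|g' t| <= K) -> forall t, 0 <= t <= 1 -> `|g t| <= K.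
Proof.
move=> dg g0 hK t /andP[t0 t1].
have [c] : exists2 c, c \in `[0, t]%R & g t - g 0 = g' c * (t - 0).
  have cg : {within `[0, t], continuous g}.
    by apply: derivable_within_continuous => s _; have [] := dg s.
  exact: MVT_segment t0 (fun a _ => dg a) cg.
rewrite in_itv /= g0 !subr0 => /andP[c0 ct] ->; rewrite normrM (ger0_norm t0).
rewrite -[K]mulr1 ler_pM // hK // c0 (le_trans ct) //.
Qed.

(** The bound on the third derivative along the segment is integrated three times
    from the endpoint [x], each time by the mean value theorem. *)
Lemma taylor3 f x v (K : R) : polyfun f ->
  (forall t, 0 <= t <= 1 -> `|dirD v (dirD v (dirD v f)) (x + t *: v)| <= K) ->
  `|f (x + v) - f x - dirD v f x - dirD v (dirD v f) x / 2| <= K.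
Proof.
move=> hf hK; have hf1 := polyfun_dirD v hf; have hf2 := polyfun_dirD v hf1.
pose g0 t := f (x + t *: v); pose g1 t := dirD v f (x + t *: v).
pose g2 t := dirD v (dirD v f) (x + t *: v).
have d0 t : is_derive t 1 g0 (g1 t) by exact: is_derive_line.
have d1 t : is_derive t 1 g1 (g2 t) by exact: is_derive_line.
have d2 t : is_derive t 1 g2 (dirD v (dirD v (dirD v f)) (x + t *: v)).
  exact: is_derive_line.
have lin (a : R) t : is_derive t 1 (fun t => t * a) a.
  apply: (is_derive_eq (is_deriveM (is_derive_id t 1) (is_derive_cst a t 1))).
  by rewrite scaler0 add0r /GRing.scale /= mulr1.
have quad (a : R) t : is_derive t 1 (fun t => t * t * (a / 2)) (t * a).
  apply: (is_derive_eq (is_deriveM (is_deriveM (is_derive_id t 1) (is_derive_id t 1))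
    (is_derive_cst (a / 2) t 1))).
  by rewrite scaler0 add0r /GRing.scale /=; field.
have e2 (s : R) : is_derive s 1 (fun t => g2 t - g2 0)
    (dirD v (dirD v (dirD v f)) (x + s *: v)).
  apply: (is_derive_eq (is_deriveB (d2 s) (is_derive_cst (g2 0) s 1))).
  exact: subr0.
have h2 := mvt_bound e2 (subrr _) hK.
have e1 t : is_derive t 1 (fun t => g1 t - g1 0 - t * g2 0) (g2 t - g2 0).
  have := is_deriveB (is_deriveB (d1 t) (is_derive_cst (g1 0) t 1)) (lin (g2 0) t).
  by rewrite subr0.
have z1 : g1 0 - g1 0 - 0 * g2 0 = 0 by rewrite subrr mul0r subrr.
have h1 := mvt_bound e1 z1 h2.
have e0 t : is_derive t 1 (fun t => g0 t - g0 0 - t * g1 0 - t * t * (g2 0 / 2))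
    (g1 t - g1 0 - t * g2 0).
  have := is_deriveB (is_deriveB (is_deriveB (d0 t) (is_derive_cst (g0 0) t 1))
    (lin (g1 0) t)) (quad (g2 0) t).
  by rewrite subr0.
have z0 : g0 0 - g0 0 - 0 * g1 0 - 0 * 0 * (g2 0 / 2) = 0.
  by rewrite !mul0r !subr0 subrr.
have h0 := mvt_bound e0 z0 h1.
have := h0 1; rewrite ler01 lexx => /(_ isT).
by rewrite /g0 /g1 /g2 !scale0r !addr0 scale1r !mul1r.
Qed.

Lemma polyfun_bounded f x0 rho : polyfun f ->
  exists2 C, 0 <= C & forall x, cball x0 rho x -> `|f x| <= C.
Proof.
move=> [d hf]; elim: hf => {d f} [d c|d f g _ [C C0 hC] _ [D D0 hD]|d i f _ [C C0 hC]].
- by exists `|c|.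
- exists (C + D); first exact: addr_ge0.
  by move=> x hx; apply: (le_trans (ler_normD _ _)); rewrite lerD ?hC ?hD.
- exists ((`|rho| + enorm x0) * C); first by rewrite mulr_ge0 ?addr_ge0 ?enorm_ge0.
  move=> x hx; rewrite normrM ler_pM ?hC //.
  apply: (le_trans (coord_le_enorm _ _)); rewrite -(subrK x0 x).
  apply: (le_trans (enorm_triangle _ _)); rewrite lerD2r.
  exact: (le_trans hx (ler_norm _)).
Qed.

Lemma dirD_delta i t f : dirD (t *: delta_mx 0 i) f = (fun x => t * partial i f x).
Proof.
apply/funext => x; rewrite /dirD (bigD1 i) //= big1 ?addr0; first by rewrite !mxE !eqxx mulr1.
by move=> j /negPf ji; rewrite !mxE ji andbF mulr0 mul0r.
Qed.

Lemma enorm_delta i : enorm (delta_mx 0 i : E) = 1.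
Proof.
apply/eqP; rewrite -(eqrXn2 (_ : 0 < 2)%N) ?enorm_ge0 ?ler01 // expr1n.
by rewrite enorm_sqr dot_delta mxE !eqxx.
Qed.

Lemma taylor_coord f x i : polyfun f -> exists2 C, 0 <= C & forall t, `|t| <= 1 ->
  `|f (x + t *: delta_mx 0 i) - f x - t * partial i f x
     - t ^+ 2 * partial i (partial i f) x / 2| <= `|t| ^+ 3 * C.
Proof.
move=> hf; have hf1 := polyfun_partial i hf; have hf2 := polyfun_partial i hf1.
have [C C0 hC] := polyfun_bounded x 1 (polyfun_partial i hf2).
exists C => // t t1; have := @taylor3 f x (t *: delta_mx 0 i) (`|t| ^+ 3 * C) hf.
rewrite (dirD_delta i t f) (dirD_delta i t (fun x => t * partial i f x)).
rewrite (partialZ i t hf1) (dirD_delta i t (fun x => t * (t * partial i (partial i f) x))).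
rewrite (partialZ i t (polyfunZ t hf2)) (partialZ i t hf2) => h.
rewrite (_ : t ^+ 2 * _ = t * (t * partial i (partial i f) x)); last by rewrite mulrA expr2.
apply: h => s /andP[s0 s1]; rewrite !mulrA -expr2 -exprSr normrM normrX.
rewrite ler_wpM2l ?exprn_ge0 //.
apply: hC; rewrite /cball /= addrC addKr !enormZ enorm_delta mulr1.
by rewrite -[leRHS]mulr1 ler_pM // ger0_norm.
Qed.

(** At a maximum the symmetric second difference is nonpositive, and it equals
    [t ^ 2] times the second derivative up to [O(t ^ 3)]. *)
Lemma second_derivative_test f x i (d : R) : polyfun f -> 0 < d ->
  (forall t, `|t| < d -> f (x + t *: delta_mx 0 i) <= f x) ->
  partial i (partial i f) x <= 0.
Proof.
move=> hf d0 hmax; have [C C0 hC] := taylor_coord x i hf.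
rewrite leNgt; apply/negP => pos; set a := partial i (partial i f) x in pos hC.
pose t := Num.min (d / 2) (Num.min 1 (a / (4 * (C + 1)))).
have C1 : 0 < C + 1 by lra.
have t0 : 0 < t by rewrite !lt_min ?ltr01 !divr_gt0 ?mulr_gt0.
have td : t < d by rewrite (@le_lt_trans _ _ (d / 2)) ?ge_min ?lexx //; lra.
have t1 : t <= 1 by rewrite !ge_min lexx orbT.
have ta : t * (4 * (C + 1)) <= a.
  by rewrite -ler_pdivlMr ?mulr_gt0 // !ge_min lexx !orbT.
have nt : `|t| = t by rewrite ger0_norm ?ltW.
have := hC t; have := hC (- t); rewrite normrN nt sqrrN => /(_ t1) h1 /(_ t1) h2.
have := hmax t; have := hmax (- t); rewrite normrN nt => /(_ td) m1 /(_ td) m2.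
move: h1 h2; rewrite !ler_norml => /andP[h1 _] /andP[h2 _].
have : t ^+ 2 * a <= 2 * t ^+ 3 * C by lra.
have : 0 < t ^+ 2 by rewrite exprn_gt0.
have -> : 2 * t ^+ 3 * C = t ^+ 2 * (2 * t * C) by ring.
move=> t2; rewrite ler_pM2l // => h; have : 0 <= t * C by rewrite mulr_ge0 // ltW.
by lra.
Qed.

Definition sqd (x0 : E) : E -> R := fun x => dot (x - x0) (x - x0).

Lemma sqdE x0 x : sqd x0 x = enorm (x - x0) ^+ 2.
Proof. by rewrite enorm_sqr. Qed.

Lemma polyfun_shift (x0 : E) i : polyfun (fun x => x 0 i - x0 0 i).
Proof. by apply: polyfunB; [exact: polyfun_coord|exact: polyfun_cst]. Qed.

Lemma partial_shift (x0 : E) i j : partial j (fun x => x 0 i - x0 0 i) = (fun=> (j == i)%:R).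
Proof.
rewrite (partialB j (polyfun_coord i) (polyfun_cst _)).
by rewrite partial_coord partial_cst; apply/funext => x; rewrite subr0.
Qed.

Lemma sqd_sum x0 : sqd x0 = fun x => \sum_i (x 0 i - x0 0 i) * (x 0 i - x0 0 i).
Proof. by apply/funext => x; apply: eq_bigr => i _; rewrite !mxE. Qed.

Lemma pdeg_sqd x0 : pdeg 2 (sqd x0).
Proof.
rewrite sqd_sum; apply: pdeg_sum => i _; apply: (@pdegM _ _ 1 1).
  by apply: pdegD; [exact: pdeg_coord|exact: pdeg_cst].
by apply: pdegD; [exact: pdeg_coord|exact: pdeg_cst].
Qed.

Lemma polyfun_sqd x0 : polyfun (sqd x0).
Proof. by exists 2%N; exact: pdeg_sqd. Qed.

Lemma partial_sqd x0 i : partial i (sqd x0) = fun x => 2 * (x 0 i - x0 0 i).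
Proof.
rewrite sqd_sum partial_sum => [|k]; last exact: polyfunM (polyfun_shift _ _) (polyfun_shift _ _).
apply/funext => x; rewrite (bigD1 i) //= big1 ?addr0.
  rewrite (partialM i (polyfun_shift x0 i) (polyfun_shift x0 i)) !partial_shift eqxx.
  by rewrite mul1r mulr1 -mulr2n mulr_natl.
move=> j /negPf ji; rewrite (partialM i (polyfun_shift x0 j) (polyfun_shift x0 j)).
by rewrite !partial_shift eq_sym ji mul0r mulr0 addr0.
Qed.

Lemma laplacian_sqd x0 : laplacian (sqd x0) = fun=> 2 * n%:R.
Proof.
apply/funext => x; rewrite /laplacian (eq_bigr (fun=> 2)) => [|i _].
  by rewrite sumr_const card_ord mulr_natr.
by rewrite partial_sqd (partialZ i 2 (polyfun_shift x0 i)) partial_shift eqxx mulr1.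
Qed.

End Taylor.

(** * The maximum principle *)

Section MaximumPrinciple.
Context {R : realType} {n : nat}.
Local Notation E := 'rV[R]_n.
Implicit Types (x y v : E) (i j : 'I_n) (c t : R) (f g h : E -> R).
Hypothesis n_gt0 : (0 < n)%N.

Definition oball (x0 : E) (rho : R) : set E := [set x | enorm (x - x0) < rho].

Lemma oball_sub x0 rho : oball x0 rho `<=` cball x0 rho.
Proof. by move=> x; exact: ltW. Qed.

Lemma oball_nbhs x0 rho x (P : set E) :
  oball x0 rho x -> (forall y, oball x0 rho y -> P y) -> \forall y \near x, P y.
Proof.
move=> hx hP; apply/nbhs_enormP; exists (rho - enorm (x - x0)); first by rewrite subr_gt0.
by move=> y hy; apply: hP; rewrite /oball /=; have := enorm_distD x y x0; lra.
Qed.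

(** A small multiple of [|x| ^ 2] makes the laplacian positive where it was
    nonnegative, which an interior maximum forbids. The compact set is arbitrary
    because half balls occur below. *)
Lemma max_principle (K : set E) f (M : R) : compact K -> polyfun f ->
  (forall x, K x -> f x <= M \/ 0 <= laplacian f x /\ nbhs x K) ->
  forall x, K x -> f x <= M.
Proof.
move=> cK pf hK x Kx.
have [B B0 hB] : exists2 B, 0 <= B & forall y, K y -> sqd 0 y <= B.
  have [c] := EVT_max_rV (ex_intro K x Kx) cK (polyfun_within (polyfun_sqd 0)).
  move=> _ hc; exists (sqd 0 c); first exact: dot_ge0.
  by move=> y Ky; exact/hc/mem_set.
apply/ler_addgt0Pr => e e0; pose eps := e / (B + 1).
have eps0 : 0 < eps by rewrite divr_gt0 //; lra.
pose F y := f y + eps * sqd 0 y.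
have pq : polyfun (fun y => eps * sqd 0 y) by exact/polyfunZ/polyfun_sqd.
have pF : polyfun F by exact: polyfunD pf pq.
have [c cK' hc] := EVT_max_rV (ex_intro K x Kx) cK (polyfun_within pF).
have Kc : K c by exact: set_mem.
have [fc|[lc nc]] := hK c Kc.
  apply: (@le_trans _ _ (F x)); first by rewrite lerDl mulr_ge0 ?dot_ge0 // ltW.
  apply: (le_trans (hc x (mem_set Kx))); rewrite lerD //.
  apply: (@le_trans _ _ (eps * B)); first by rewrite ler_wpM2l ?hB // ltW.
  have B1 : 0 < B + 1 by lra.
  by rewrite /eps mulrAC ler_pdivrMr ?ler_pM2l; lra.

exfalso; move/nbhs_enormP : nc => [d d0 hd].
have : laplacian F c <= 0.
  apply: sumr_le0 => i _; apply: (second_derivative_test pF d0) => t td.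
  apply/hc/mem_set/hd; by rewrite addrC addKr enormZ enorm_delta mulr1.
rewrite /F (laplacianD pf pq) (laplacianZ eps (polyfun_sqd 0)) laplacian_sqd.
apply/negP; rewrite -ltNge; apply: ltr_wpDl => //.
by rewrite mulr_gt0 // mulr_gt0 // ltr0n.
Qed.

(** Adding a multiple of [|x - x0| ^ 2 - rho ^ 2] makes [u] subharmonic without
    changing it on the sphere. *)
Lemma subharmonic_bound x0 rho u (G F : R) : 0 <= F -> polyfun u ->
  (forall x, oball x0 rho x -> - F <= laplacian u x) ->
  (forall x, enorm (x - x0) = rho -> u x <= G) ->
  forall x, cball x0 rho x -> u x <= G + F * rho ^+ 2.
Proof.
move=> F0 pu hF hG x hx.
have rho0 : 0 <= rho by exact: le_trans (enorm_ge0 _) hx.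
have pq := polyfunZ (F / 2) (polyfun_sqd x0).
have le_sq y : cball x0 rho y -> sqd x0 y <= rho ^+ 2.
  by move=> hy; rewrite sqdE lerXn2r ?nnegrE ?enorm_ge0.
have h : u x + F / 2 * sqd x0 x <= G + F / 2 * rho ^+ 2.
  have H := @max_principle (cball x0 rho) (fun y => u y + F / 2 * sqd x0 y)
    (G + F / 2 * rho ^+ 2) (@compact_cball R n x0 rho) (polyfunD pu pq).
  apply: H hx => y.
  rewrite /cball /= le_eqVlt => /orP[/eqP yr|yr].
    by left; rewrite sqdE yr lerD2r hG.
  right; split; last by apply: (oball_nbhs yr) => z; exact: oball_sub.
  rewrite (laplacianD pu pq) (laplacianZ (F / 2) (polyfun_sqd x0)) laplacian_sqd.
  have := hF y yr; have : F <= F / 2 * (2 * n%:R).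
    by rewrite mulrA divfK // ler_peMr // ler1n.
  by lra.
have : 0 <= F / 2 * sqd x0 x by rewrite mulr_ge0 ?divr_ge0 ?dot_ge0.
have : 0 <= F * rho ^+ 2 by rewrite mulr_ge0 ?sqr_ge0.
by lra.
Qed.

Lemma poisson_bound x0 rho u (G F : R) : 0 <= F -> polyfun u ->
  (forall x, oball x0 rho x -> `|laplacian u x| <= F) ->
  (forall x, enorm (x - x0) = rho -> `|u x| <= G) ->
  forall x, cball x0 rho x -> `|u x| <= G + F * rho ^+ 2.
Proof.
move=> F0 pu hF hG x hx; rewrite ler_norml lerNl; apply/andP; split.
- apply: (@subharmonic_bound x0 rho (fun y => - u y)) hx => //; first exact: polyfunN.
    move=> y hy; rewrite (laplacianN pu) lerN2.
    exact: le_trans (ler_norm _) (hF y hy).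
  by move=> y hy; rewrite (le_trans _ (hG y hy)) // -normrN ler_norm.
- apply: (@subharmonic_bound x0 rho u) hx => // y hy.
    by have := hF y hy; rewrite ler_norml => /andP[].
  exact: le_trans (ler_norm _) (hG y hy).
Qed.

Lemma partial_congr x0 rho f g i : (forall x, oball x0 rho x -> f x = g x) ->
  forall x, oball x0 rho x -> partial i f x = partial i g x.
Proof.
by move=> fg x hx; apply: near_eq_derive; exact: oball_nbhs hx fg.
Qed.

Lemma harmonic_partial x0 rho h i : polyfun h ->
  (forall x, oball x0 rho x -> laplacian h x = 0) ->
  forall x, oball x0 rho x -> laplacian (partial i h) x = 0.
Proof.
move=> ph hh x hx; rewrite (laplacian_partial i ph).
by rewrite (partial_congr i hh hx) (partial_cst i 0).
Qed.

Definition mirror (x0 : E) i (x : E) : E :=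
  \row_j (if j == i then 2 * x0 0 i - x 0 i else x 0 j).

Lemma pdeg_mirror x0 i j : pdeg 1 (fun x => mirror x0 i x 0 j).
Proof.
have [->|ji] := eqVneq j i.
  have -> : (fun x => mirror x0 i x 0 i) = (fun x => 2 * x0 0 i + (-1) * x 0 i).
    by apply/funext => x; rewrite mxE eqxx mulN1r.
  by apply: pdegD; [exact: pdeg_cst|exact/pdegZ/pdeg_coord].
have -> : (fun x => mirror x0 i x 0 j) = (fun x => x 0 j).
  by apply/funext => x; rewrite mxE (negPf ji).
exact: pdeg_coord.
Qed.

Lemma mirror_dist x0 i x : sqd x0 (mirror x0 i x) = sqd x0 x.
Proof.
rewrite !sqd_sum; apply: eq_bigr => j _; rewrite mxE; case: eqP => [->|//].
by ring.
Qed.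

Lemma partial_mirror x0 i j f : polyfun f -> partial j (fun x => f (mirror x0 i x)) =
  (fun x => (if j == i then -1 else 1) * partial j f (mirror x0 i x)).
Proof.
move=> pf; apply/funext => x; set s : R := if _ then _ else _.
have hr t : mirror x0 i (t *: delta_mx 0 j + x) = t *: (s *: delta_mx 0 j) + mirror x0 i x.
  apply/rowP => k; rewrite !mxE /s eqxx /=.
  have [->|ki] := eqVneq k i; last first.
    by case: (eqVneq k j) => [<-|_]; rewrite ?(negPf ki) ?mul1r ?mulr0.
  by rewrite (eq_sym j i); case: (eqVneq i j) => _; rewrite ?mulr0 ?mulr1 ?add0r //; ring.
have hq : partial j (fun x => f (mirror x0 i x)) x = 'D_(s *: delta_mx 0 j) f (mirror x0 i x).
  rewrite /partial /derive.
  have -> // : (fun t => t^-1 *: (((fun y => f (mirror x0 i y)) \o shift x) (t *: delta_mx 0 j)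
      - f (mirror x0 i x))) = (fun t => t^-1 *: ((f \o shift (mirror x0 i x))
      (t *: (s *: delta_mx 0 j)) - f (mirror x0 i x))).
  by apply/funext => t /=; rewrite hr.
by rewrite hq (derive_dirD _ _ pf) dirD_delta.
Qed.

End MaximumPrinciple.

(** * Interior estimates for harmonic polynomials *)

Section InteriorEstimates.
Context {R : realType} {n : nat}.
Local Notation E := 'rV[R]_n.
Implicit Types (x y v : E) (i j : 'I_n) (c t : R) (f g h : E -> R).
Hypothesis n_gt0 : (0 < n)%N.

Lemma polyfun_mirror x0 i f : polyfun f -> polyfun (fun x => f (mirror x0 i x)).
Proof. by move=> pf; apply: polyfun_comp => // j; exact: pdeg_mirror. Qed.

Lemma laplacian_mirror x0 i f x : polyfun f ->
  laplacian (fun x => f (mirror x0 i x)) x = laplacian f (mirror x0 i x).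
Proof.
move=> pf; apply: eq_bigr => j _; rewrite (partial_mirror x0 i j pf).
rewrite (partialZ j _ (polyfun_mirror x0 i (polyfun_partial j pf))).
rewrite (partial_mirror x0 i j (polyfun_partial j pf)).
by case: eqP => _; rewrite ?mulN1r ?opprK ?mul1r ?mulN1r ?opprK.
Qed.

(** A harmonic function that is at least [rho ^ 2] on the upper half of the sphere,
    nonnegative on the equator and zero at the centre. *)
Definition barrier (x0 : E) (rho : R) i : E -> R := fun x =>
  sqd x0 x + n%:R * (rho * (x 0 i - x0 0 i) - (x 0 i - x0 0 i) * (x 0 i - x0 0 i)).

Lemma polyfun_barrier x0 rho i : polyfun (barrier x0 rho i).
Proof.
apply: polyfunD; first exact: polyfun_sqd.
apply: polyfunZ; apply: polyfunB; first exact/polyfunZ/polyfun_shift.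
by apply: polyfunM; exact: polyfun_shift.
Qed.

Lemma laplacian_barrier x0 rho i x : laplacian (barrier x0 rho i) x = 0.
Proof.
have pt := polyfun_shift x0 i; have ptt := polyfunM pt pt.
have pq := polyfunB (polyfunZ rho pt) ptt.
rewrite /barrier (laplacianD (polyfun_sqd x0) (polyfunZ n%:R pq)) laplacian_sqd.
rewrite (laplacianZ n%:R pq) (laplacianB (polyfunZ rho pt) ptt) (laplacianZ rho pt).
have -> : laplacian (fun x : E => x 0 i - x0 0 i) x = 0.
  by apply: big1 => j _; rewrite partial_shift partial_cst.
have -> : laplacian (fun x : E => (x 0 i - x0 0 i) * (x 0 i - x0 0 i)) x = 2.
  rewrite /laplacian (bigD1 i) //= big1 ?addr0 => [|j /negPf ji].
    rewrite (partialM i pt pt) partial_shift eqxx.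
    have -> : (fun x : E => 1 * (x 0 i - x0 0 i) + (x 0 i - x0 0 i) * 1) =
       (fun x => 2 * (x 0 i - x0 0 i)) by apply/funext => z; ring.
    by rewrite (partialZ i 2 pt) partial_shift eqxx mulr1.
  rewrite (partialM j pt pt) partial_shift ji.
  have -> : (fun x : E => 0 * (x 0 i - x0 0 i) + (x 0 i - x0 0 i) * 0) = (fun=> 0 : R).
    by apply/funext => z; rewrite mul0r mulr0 addr0.
  by rewrite partial_cst.
by ring.
Qed.

(** The odd part of [h] in the direction [i] vanishes on the equator of the ball
    and is at most [M] on the sphere, so on the upper half ball it lies below
    the harmonic barrier [M / rho ^ 2 * barrier], which vanishes at the centre.
    Comparing slopes at the centre bounds the partial derivative. *)
Lemma gradient_upper x0 rho (M : R) h i : 0 < rho -> polyfun h ->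
  (forall x, oball x0 rho x -> laplacian h x = 0) ->
  (forall x, cball x0 rho x -> `|h x| <= M) ->
  partial i h x0 <= n%:R * M / rho.
Proof.
move=> rho0 ph hh hM.
have M0 : 0 <= M.
  apply: (le_trans (normr_ge0 (h x0))); apply: hM.
  by rewrite /cball /= subrr enorm0 ltW.
pose K := cball x0 rho `&` [set x | 0 <= x 0 i - x0 0 i].
have cK : compact K.
  apply: compact_closedI; first exact: compact_cball.
  suff : closed ((fun x : E => x 0 i - x0 0 i) @^-1` [set a | 0 <= a]) by [].
  apply: closed_comp; last exact: closed_ge.
  by move=> x _; exact: polyfun_continuous (polyfun_shift x0 i) x.
have prh := polyfun_mirror x0 i ph; have pb := polyfun_barrier x0 rho i.
have pd := polyfunZ 2^-1 (polyfunB ph prh); have pmb := polyfunZ (M / rho ^+ 2) pb.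
pose F := fun x => 2^-1 * (h x - h (mirror x0 i x)) - M / rho ^+ 2 * barrier x0 rho i x.
have pF : polyfun F by exact: polyfunB.
have Mrho : 0 <= M / rho ^+ 2 by rewrite divr_ge0 ?sqr_ge0.
have mirror_ball x : enorm (mirror x0 i x - x0) = enorm (x - x0).
  by apply/eqP; rewrite -(eqrXn2 (_ : 0 < 2)%N) ?enorm_ge0 // -!sqdE mirror_dist.
have F0 : forall x, K x -> F x <= 0.
  apply: (max_principle n_gt0 cK pF) => x [xr /= xi].
  move: xi; rewrite le_eqVlt => /orP[/eqP xi|xi].
    left; rewrite /F /barrier -xi.
    have -> : mirror x0 i x = x.
      by apply/rowP => k; rewrite mxE; case: eqP => [->|//]; move: xi; lra.
    by rewrite subrr !mulr0 subrr mulr0 addr0 sub0r oppr_le0 mulr_ge0 ?dot_ge0.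
  have tr : x 0 i - x0 0 i <= rho.
    have := coord_le_enorm (x - x0) i; rewrite !mxE => /(le_trans (ler_norm _)) h1.
    exact: le_trans h1 xr.
  move: (xr); rewrite /cball /= le_eqVlt => /orP[/eqP xe|xl].
    left; rewrite /F subr_le0; apply: (@le_trans _ _ M).
      have h1 := ler_norm (h x); have h2 := hM x xr.
      have h3 := ler_norm (- h (mirror x0 i x)); rewrite normrN in h3.
      have h4 : `|h (mirror x0 i x)| <= M by apply: hM; rewrite /cball /= mirror_ball.
      by lra.
    rewrite /barrier sqdE xe mulrDr divfK ?gt_eqF ?exprn_gt0 // lerDl.
    rewrite mulr_ge0 // mulr_ge0 // -mulrBl mulr_ge0 //; last exact: ltW.
    by rewrite subr_ge0.
  right; split.
    rewrite /F (laplacianB pd pmb) (laplacianZ 2^-1 (polyfunB ph prh)).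
    rewrite (laplacianB ph prh) (laplacianZ _ pb) laplacian_barrier (laplacian_mirror x0 i x ph).
    by rewrite !hh /oball /= ?mirror_ball // subrr !mulr0 subr0.
  apply/nbhs_enormP; exists (Num.min (rho - enorm (x - x0)) (x 0 i - x0 0 i)).
    by rewrite lt_min subr_gt0 xl xi.
  move=> y; rewrite lt_min => /andP[y1 y2]; split.
    by rewrite /cball /=; have := enorm_distD x y x0; lra.
  have := coord_le_enorm (y - x) i; rewrite !mxE ler_norml => /andP[h1 _] /=.
  by lra.
(* Evaluate at height [t] above the centre and at its mirror image, divide by [t] and
   let [t] tend to zero. *)
have [C C0 hC] := taylor_coord x0 i ph.
apply/ler_addgt0Pr => e e0.
pose D := M / rho ^+ 2 + C + 1.
have D0 : 0 < D by rewrite ltr_wpDl // addr_ge0.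
pose t := Num.min (Num.min 1 rho) (e / D).
have t0 : 0 < t by rewrite !lt_min ltr01 rho0 divr_gt0.
have t1 : t <= 1 by rewrite !ge_min lexx.
have tr : t <= rho by rewrite !ge_min lexx orbT.
have te : t * D <= e by rewrite -ler_pdivlMr // !ge_min lexx !orbT.
pose x := x0 + t *: delta_mx 0 i.
have xi : x 0 i - x0 0 i = t by rewrite !mxE !eqxx mulr1 addrC addKr.
have sx : sqd x0 x = t ^+ 2.
  by rewrite sqdE addrC addKr enormZ enorm_delta mulr1 ger0_norm // ltW.
have rx : mirror x0 i x = x0 + (- t) *: delta_mx 0 i.
  apply/rowP => k; rewrite !mxE !eqxx /=; case: (eqVneq k i) => [->|ki] /=; last first.
    by rewrite !mulr0.
  by ring.
have Kx : K x.
  split=> /=; last by rewrite xi ltW.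
  by rewrite /cball /= addrC addKr enormZ enorm_delta mulr1 ger0_norm // ltW.
have := F0 x Kx; rewrite /F /barrier sx xi rx => hF.
have nt : `|t| = t by rewrite ger0_norm // ltW.
have := hC t; have := hC (- t); rewrite normrN nt sqrrN => /(_ t1) h1 /(_ t1) h2.
move: h1 h2; rewrite !ler_norml => /andP[_ h1] /andP[h2 _]; rewrite -/x in h2.
have h3 : t * partial i h x0 <= M / rho ^+ 2 * (t ^+ 2 + n%:R * (rho * t - t * t)) + t ^+ 3 * C.
  by lra.
have h4 : t ^+ 3 * C <= t ^+ 2 * C.
  by rewrite ler_wpM2r // exprS ler_piMl // sqr_ge0.
have h5 : M / rho ^+ 2 * (n%:R * (t * t)) >= 0.
  by rewrite mulr_ge0 // mulr_ge0 // mulr_ge0 // ltW.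
have h6 : M / rho ^+ 2 * (n%:R * (rho * t)) = t * (n%:R * M / rho).
  by field; rewrite gt_eqF.
have h7 : t ^+ 2 * D <= t * e by rewrite expr2 -mulrA ler_wpM2l // ltW.
rewrite -(ler_pM2l t0) mulrDr -h6; apply: (le_trans h3).
have t20 : 0 <= t ^+ 2 by exact: sqr_ge0.
by move: h7; rewrite /D; lra.
Qed.

Lemma gradient_estimate x0 rho (M : R) h i : 0 < rho -> polyfun h ->
  (forall x, oball x0 rho x -> laplacian h x = 0) ->
  (forall x, cball x0 rho x -> `|h x| <= M) ->
  `|partial i h x0| <= n%:R * M / rho.
Proof.
move=> rho0 ph hh hM; rewrite ler_norml lerNl; apply/andP; split; last exact: gradient_upper.
have -> : - partial i h x0 = partial i (fun x => - h x) x0 by rewrite (partialN i ph).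
apply: (@gradient_upper x0 rho M (fun x => - h x) i rho0 (polyfunN ph)).
  by move=> x hx; rewrite (laplacianN ph) hh // oppr0.
by move=> x hx; rewrite normrN hM.
Qed.

Lemma gradient_interior x0 rho d (M : R) h i : 0 < d -> polyfun h ->
  (forall x, oball x0 rho x -> laplacian h x = 0) ->
  (forall x, cball x0 rho x -> `|h x| <= M) ->
  forall x, cball x0 (rho - d) x -> `|partial i h x| <= n%:R / d * M.
Proof.
move=> d0 ph hh hM x hx; rewrite mulrAC; rewrite /cball /= in hx.
apply: gradient_estimate => // y hy; [apply: hh|apply: hM];
  by move: hy; rewrite /oball /cball /= => hy; have := enorm_distD x y x0; lra.
Qed.

(** A sixth of the radius is spent on each of three applications of the gradient
    estimate. *)
Lemma third_derivatives x0 rho (M : R) h : 0 < rho -> polyfun h ->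
  (forall x, oball x0 rho x -> laplacian h x = 0) ->
  (forall x, cball x0 rho x -> `|h x| <= M) ->
  let q := n%:R / (rho / 6) in
  [/\ forall i, `|partial i h x0| <= q * M,
      forall i j, `|partial i (partial j h) x0| <= q * (q * M)
    & forall i j k x, cball x0 (rho / 2) x ->
        `|partial i (partial j (partial k h)) x| <= q * (q * (q * M))].
Proof.
move=> rho0 ph hh hM q; have d0 : 0 < rho / 6 by rewrite divr_gt0.
have g1 k := gradient_interior k d0 ph hh hM.
have sub a b x : a <= b -> oball x0 a x -> oball x0 b x by move=> ab hx; exact: lt_le_trans hx ab.
have subc a b x : a <= b -> cball x0 a x -> cball x0 b x by move=> ab hx; exact: le_trans hx ab.
have le1 : rho - rho / 6 <= rho by lra.
have le2 : rho - rho / 6 - rho / 6 <= rho by lra.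
have h1 k x : oball x0 (rho - rho / 6) x -> laplacian (partial k h) x = 0.
  by move=> hx; apply: (harmonic_partial k ph hh); exact: sub hx.
have g2 j k := gradient_interior j d0 (polyfun_partial k ph) (h1 k) (g1 k).
have h2 j k x : oball x0 (rho - rho / 6 - rho / 6) x -> laplacian (partial j (partial k h)) x = 0.
  move=> hx; apply: (harmonic_partial j (polyfun_partial k ph) (h1 k)).
  by apply: sub hx; lra.
have g3 i j k := gradient_interior i d0 (polyfun_partial j (polyfun_partial k ph))
  (h2 j k) (g2 j k).
have c0 a : 0 <= a -> cball x0 a x0 by rewrite /cball /= subrr enorm0.
split.
- by move=> i; apply: g1; apply: c0; lra.
- by move=> i j; apply: g2; apply: c0; lra.
- by move=> i j k x hx; apply: g3; apply: subc hx; lra.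
Qed.

Definition quad (x0 : E) (c : R) (b : E) (A : 'M[R]_n) : E -> R := fun x =>
  c + \sum_i (x - x0) 0 i * b 0 i +
  (\sum_i (x - x0) 0 i * \sum_j (x - x0) 0 j * A i j) / 2.

Lemma sum_bound v (s B : R) (a : 'I_n -> R) : enorm v <= s -> (forall i, `|a i| <= B) ->
  `|\sum_i v 0 i * a i| <= n%:R * s * B.
Proof.
move=> hs ha; apply: (le_trans (ler_norm_sum _ _ _)).
apply: (@le_trans _ _ (\sum_(i < n) s * B)).
  apply: ler_sum => i _; rewrite normrM ler_pM ?ha //.
  exact: le_trans (coord_le_enorm _ _) hs.
by rewrite sumr_const card_ord -[leLHS]mulr_natl mulrA.
Qed.

Lemma dirD2 v f x : polyfun f ->
  dirD v (dirD v f) x = \sum_i v 0 i * \sum_j v 0 j * partial i (partial j f) x.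
Proof.
move=> pf; apply: eq_bigr => i _; congr (_ * _).
rewrite /dirD partial_sum => [|j]; last exact/polyfunZ/polyfun_partial.
by apply: eq_bigr => j _; rewrite (partialZ i _ (polyfun_partial j pf)).
Qed.

Lemma dirD3 v f x : polyfun f -> dirD v (dirD v (dirD v f)) x =
  \sum_i v 0 i * \sum_j v 0 j * \sum_k v 0 k * partial i (partial j (partial k f)) x.
Proof.
move=> pf; rewrite dirD2; last exact: polyfun_dirD.
apply: eq_bigr => i _; congr (_ * _); apply: eq_bigr => j _; congr (_ * _).
have -> : partial j (dirD v f) = fun x => \sum_k v 0 k * partial j (partial k f) x.
  rewrite /dirD partial_sum => [|k]; last exact/polyfunZ/polyfun_partial.
  by apply/funext => y; apply: eq_bigr => k _; rewrite (partialZ j _ (polyfun_partial k pf)).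
rewrite partial_sum => [|k]; last exact/polyfunZ/polyfun_partial/polyfun_partial.
apply: eq_bigr => k _.
by rewrite (partialZ i _ (polyfun_partial j (polyfun_partial k pf))).
Qed.

Definition hessian f x : 'M[R]_n := \matrix_(i, j) partial i (partial j f) x.

(** The cubic remainder is controlled by the third derivatives, hence by the
    supremum of [h] on a ball twice as large. *)
Lemma harmonic_taylor x0 rho s (M : R) h : 0 < rho -> s <= rho / 2 -> polyfun h ->
  (forall x, oball x0 rho x -> laplacian h x = 0) ->
  (forall x, cball x0 rho x -> `|h x| <= M) ->
  forall x, cball x0 s x ->
  `|h x - quad x0 (h x0) (gradient h x0) (hessian h x0) x|
    <= (6 * n%:R ^+ 2) ^+ 3 * M * (s / rho) ^+ 3.
Proof.
move=> rho0 srho ph hh hM x hx.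
have [_ _ g3] := third_derivatives rho0 ph hh hM.
have hx' : enorm (x - x0) <= s by [].
have s0 : 0 <= s by exact: le_trans (enorm_ge0 _) hx'.
set q := n%:R / (rho / 6) in g3.
have hT : forall t, 0 <= t <= 1 -> `|dirD (x - x0) (dirD (x - x0) (dirD (x - x0) h))
    (x0 + t *: (x - x0))| <= n%:R * s * (n%:R * s * (n%:R * s * (q * (q * (q * M))))).
  move=> t /andP[t0 t1]; rewrite dirD3 //.
  apply: sum_bound => // i; apply: sum_bound => // j; apply: sum_bound => // k.
  apply: g3; rewrite /cball /= addrC addKr enormZ ger0_norm //.
  apply: (le_trans _ srho); rewrite -[s]mul1r; apply: ler_pM => //; exact: enorm_ge0.
have := taylor3 ph hT; rewrite [x0 + _]addrC subrK dirD2 //.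
have -> : n%:R * s * (n%:R * s * (n%:R * s * (q * (q * (q * M))))) =
    (6 * n%:R ^+ 2) ^+ 3 * M * (s / rho) ^+ 3.
  by rewrite /q; field; rewrite gt_eqF.
apply: le_trans; rewrite le_eqVlt; apply/orP; left; apply/eqP; congr `|_|.
rewrite /quad /dirD.
have -> : \sum_i (x - x0) 0 i * gradient h x0 0 i = \sum_i (x - x0) 0 i * partial i h x0.
  by apply: eq_bigr => i _; rewrite [gradient h x0 0 i]mxE.
have -> : \sum_i (x - x0) 0 i * \sum_j (x - x0) 0 j * hessian h x0 i j =
  \sum_i (x - x0) 0 i * \sum_j (x - x0) 0 j * partial i (partial j h) x0.
  by apply: eq_bigr => i _; congr (_ * _); apply: eq_bigr => j _; rewrite [hessian _ _ _ _]mxE.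
by ring.
Qed.

End InteriorEstimates.

(** * The Dirichlet problem for polynomials *)

Section FiniteSpan.
Context {R : realType} {n : nat}.
Local Notation E := 'rV[R]_n.
Implicit Types (x : E) (f g : E -> R).

Definition in_span (T : finType) (e : T -> E -> R) f :=
  exists c : T -> R, forall x, f x = \sum_t c t * e t x.

Lemma in_spanD (T : finType) (e : T -> E -> R) f g :
  in_span e f -> in_span e g -> in_span e (fun x => f x + g x).
Proof.
move=> [c hc] [d hd]; exists (fun t => c t + d t) => x.
by rewrite hc hd -big_split; apply: eq_bigr => t _; rewrite mulrDl.
Qed.

Lemma in_spanZ (T : finType) (e : T -> E -> R) a f :
  in_span e f -> in_span e (fun x => a * f x).
Proof.
move=> [c hc]; exists (fun t => a * c t) => x.
by rewrite hc mulr_sumr; apply: eq_bigr => t _; rewrite mulrA.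
Qed.

Lemma in_span_gen (T : finType) (e : T -> E -> R) t : in_span e (e t).
Proof.
exists (fun s => (s == t)%:R) => x.
by rewrite (bigD1 t) //= eqxx mul1r big1 ?addr0 // => s /negPf ->; rewrite mul0r.
Qed.

Lemma in_span_sum (T I : finType) (e : T -> E -> R) (F : I -> E -> R) :
  (forall k, in_span e (F k)) -> in_span e (fun x => \sum_k F k x).
Proof.
move=> /choice[c hc]; exists (fun t => \sum_k c k t) => x.
under eq_bigr do rewrite hc; rewrite exchange_big; apply: eq_bigr => t _ /=.
by rewrite mulr_suml.
Qed.

(** A monomial of degree at most [d], as a word of at most [d] variables. *)
Fixpoint monoT (d : nat) : finType :=
  if d is d'.+1 then option ('I_n * monoT d')%type else unit.

Fixpoint mono (d : nat) : monoT d -> E -> R :=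
  match d with
  | 0 => fun _ _ => 1
  | d'.+1 => fun t x => if t is Some (i, s) then x 0 i * mono s x else 1
  end.

Lemma pdeg_in_span d f : pdeg d f -> in_span (@mono d) f.
Proof.
elim=> {d f} [d c|d f g _ hf _ hg|d i f _ [c hc]]; last first.
- have -> : (fun x : E => x 0 i * f x) =
      (fun x => \sum_t c t * mono (Some (i, t) : monoT d.+1) x).
    by apply/funext => x; rewrite hc mulr_sumr; apply: eq_bigr => t _ /=; rewrite mulrCA.
  by apply: in_span_sum => t; apply/in_spanZ/in_span_gen.
- exact: in_spanD.
- have [t0 h0] : exists t0 : monoT d, forall x, mono t0 x = 1.
    by case: d => [|d]; [exists tt|exists None].
  have -> : (fun _ : E => c) = (fun x => c * mono t0 x).
    by apply/funext => x; rewrite h0 mulr1.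
  exact/in_spanZ/in_span_gen.
Qed.

(** More vectors than generators: the matrix of coefficients has one row more than
    columns, hence a nonzero left kernel. *)
Lemma span_dependent (T : finType) (e : T -> E -> R) (f : nat -> E -> R) :
  (forall k, in_span e (f k)) ->
  exists2 v : seq R, has (fun a => a != 0) v &
    forall x, \sum_(k < size v) v`_k * f k x = 0.
Proof.
move=> /choice[c hc]; pose m := #|T|.
pose A := \matrix_(k < m.+1, j < m) c k (enum_val j).
have : kermx A != 0.
  by rewrite kermx_eq0 -row_leq_rank -ltnNge ltnS rank_leq_col.
move=> /rowV0Pn[v /sub_kermxP vA v0].
exists (mkseq (fun k => v 0 (inord k)) m.+1).
  apply: contraT => /hasPn h; case/eqP: v0; apply/rowP => k; rewrite mxE.
  apply/eqP; rewrite -[_ == _]negbK; apply: h; apply/mapP; exists (k : nat).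
    by rewrite mem_iota ltn_ord.
  by rewrite inord_val.
move=> x; rewrite size_mkseq.
transitivity (\sum_t (\sum_(k < m.+1) v 0 k * c k t) * e t x).
  under [RHS]eq_bigr do rewrite mulr_suml.
  rewrite exchange_big /=; apply: eq_bigr => k _.
  rewrite nth_mkseq // inord_val hc mulr_sumr.
  by apply: eq_bigr => t _; rewrite mulrA.
apply: big1 => t _; have := congr1 (fun B : 'rV_m => B 0 (enum_rank t)) vA.
rewrite !mxE => h; have -> : \sum_(k < m.+1) v 0 k * c k t = 0.
  by rewrite -[RHS]h; apply: eq_bigr => k _; rewrite mxE enum_rankK.
by rewrite mul0r.
Qed.

End FiniteSpan.

Section DirichletProblem.
Context {R : realType} {n : nat}.
Local Notation E := 'rV[R]_n.
Implicit Types (x : E) (f g : E -> R).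
Hypothesis n_gt0 : (0 < n)%N.
Variables (x0 : E) (rho : R).

Definition sphere_eq : E -> R := fun x => rho ^+ 2 - sqd x0 x.

Lemma pdeg_sphere_eq : pdeg 2 sphere_eq.
Proof.
rewrite /sphere_eq; apply: pdegD; first exact: pdeg_cst.
have -> : (fun x => - sqd x0 x) = (fun x => (-1) * sqd x0 x).
  by apply/funext => x; rewrite mulN1r.
exact/pdegZ/pdeg_sqd.
Qed.

Lemma polyfun_sphere_eq : polyfun sphere_eq.
Proof. by exists 2%N; exact: pdeg_sphere_eq. Qed.

Lemma sphere_eq0 x : enorm (x - x0) = rho -> sphere_eq x = 0.
Proof. by rewrite /sphere_eq sqdE => ->; rewrite subrr. Qed.

Lemma sphere_eq_gt0 x : oball x0 rho x -> 0 < sphere_eq x.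
Proof.
by move=> hx; rewrite /sphere_eq subr_gt0 sqdE ltrXn2r ?nnegrE ?enorm_ge0 ?ltW.
Qed.

(** The laplacian on multiples of [sphere_eq], the polynomials that vanish on the
    sphere. *)
Definition sphere_lap f : E -> R := laplacian (fun x => sphere_eq x * f x).

Lemma pdeg_sphere_lap d f : pdeg d f -> pdeg d (sphere_lap f).
Proof. by move=> hf; have := pdeg_laplacian (pdegM pdeg_sphere_eq hf). Qed.

Lemma sphere_lapDZ f g a : polyfun f -> polyfun g ->
  sphere_lap (fun x => f x + a * g x) = (fun x => sphere_lap f x + a * sphere_lap g x).
Proof.
move=> pf pg; have pe := polyfun_sphere_eq.
have -> : sphere_lap (fun x => f x + a * g x) =
    laplacian (fun x => sphere_eq x * f x + a * (sphere_eq x * g x)).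
  by congr laplacian; apply/funext => x; rewrite mulrDr mulrCA.
rewrite (laplacianD (polyfunM pe pf) (polyfunZ a (polyfunM pe pg))).
by rewrite (laplacianZ a (polyfunM pe pg)).
Qed.

Lemma sphere_lapZ f a : polyfun f -> sphere_lap (fun x => a * f x) = (fun x => a * sphere_lap f x).
Proof.
move=> pf; have pe := polyfun_sphere_eq.
have -> : sphere_lap (fun x => a * f x) = laplacian (fun x => a * (sphere_eq x * f x)).
  by congr laplacian; apply/funext => x; rewrite mulrCA.
by rewrite (laplacianZ a (polyfunM pe pf)).
Qed.

Lemma sphere_lap_sum (m : nat) (a : nat -> R) (f : nat -> E -> R) :
  (forall k, polyfun (f k)) ->
  sphere_lap (fun x => \sum_(k < m) a k * f k x) = (fun x => \sum_(k < m) a k * sphere_lap (f k) x).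
Proof.
move=> pf; elim: m => [|m IH].
  have -> : (fun x : E => \sum_(k < 0) a k * f k x) = (fun x => 0 * 0).
    by apply/funext => x; rewrite big_ord0 mul0r.
  rewrite (sphere_lapZ 0 (polyfun_cst 0)); apply/funext => x.
  by rewrite big_ord0 mul0r.
have -> : (fun x : E => \sum_(k < m.+1) a k * f k x) =
    (fun x => \sum_(k < m) a k * f k x + a m * f m x).
  by apply/funext => x; rewrite big_ord_recr.
rewrite sphere_lapDZ //; last by apply: polyfun_sum => k; exact: polyfunZ.
by rewrite IH; apply/funext => x; rewrite big_ord_recr.
Qed.

(** Uniqueness in the Dirichlet problem: [sphere_eq * f] is harmonic in the ball
    and zero on its boundary. *)
Lemma sphere_lap_inj f : polyfun f -> (forall x, oball x0 rho x -> sphere_lap f x = 0) ->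
  forall x, oball x0 rho x -> f x = 0.
Proof.
move=> pf h x hx; have pe := polyfunM polyfun_sphere_eq pf.
have : `|sphere_eq x * f x| <= 0 + 0 * rho ^+ 2.
  apply: (@poisson_bound _ _ n_gt0 x0 rho (fun x => sphere_eq x * f x)) => //.
  - by move=> y hy; rewrite [laplacian _ _]h // normr0.
  - by move=> y hy; rewrite sphere_eq0 // mul0r normr0.
  - exact: oball_sub.
rewrite mul0r addr0 normr_le0 mulf_eq0 gt_eqF ?sphere_eq_gt0 //= => /eqP//.
Qed.

(** An injective operator on a finite-dimensional space is onto; here injectivity
    is only up to equality on the ball. The functions [sphere_lap ^ k q] lie in a space
    of finite dimension, hence satisfy a linear relation, and injectivity reduces
    it to one with nonzero constant term. *)
Lemma sphere_lap_surj q : polyfun q ->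
  exists2 p, polyfun p & forall x, oball x0 rho x -> sphere_lap p x = q x.
Proof.
move=> [d dq].
have dk k : pdeg d (iter k sphere_lap q) by elim: k => [//|k]; exact: pdeg_sphere_lap.
have pk k : polyfun (iter k sphere_lap q) by exists d.
have [v hv] := span_dependent (fun k => pdeg_in_span (dk k)).
move=> v0; have {}v0 x : oball x0 rho x -> \sum_(k < size v) v`_k * iter k sphere_lap q x = 0 by [].
elim: v hv v0 => [//|a s IH] /= hv v0.
pose p x := \sum_(k < size s) s`_k * iter k sphere_lap q x.
have pp : polyfun p by apply: polyfun_sum => k; exact: polyfunZ.
have e x : oball x0 rho x -> a * q x + sphere_lap p x = 0.
  move=> hx; rewrite -[RHS](v0 x hx) big_ord_recl; congr (_ + _).
  by rewrite /p (sphere_lap_sum (size s) (fun k => s`_k) pk).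
have [a0|an0] := eqVneq a 0.
  apply: IH; first by move: hv; rewrite a0 eqxx.
  by apply: (sphere_lap_inj pp) => x hx; have := e x hx; rewrite a0 mul0r add0r.
exists (fun x => - a^-1 * p x); first exact: polyfunZ.
move=> x hx; rewrite (sphere_lapZ _ pp); have /eqP := e x hx.
rewrite addrC addr_eq0 => /eqP ->; rewrite mulrN mulNr opprK mulrA mulVf //.
by rewrite mul1r.
Qed.

(** Correct the boundary datum [p], whose laplacian is wrong, by a polynomial that
    vanishes on the sphere. *)
Theorem poisson_polynomial p w : polyfun p -> polyfun w ->
  exists v, [/\ polyfun v, forall x, oball x0 rho x -> laplacian v x = w x
    & forall x, enorm (x - x0) = rho -> v x = p x].
Proof.
move=> pp pw; have pl := polyfun_laplacian pp.
have [s ps hs] := sphere_lap_surj (polyfunB pl pw).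
have pes := polyfunM polyfun_sphere_eq ps.
exists (fun x => p x - sphere_eq x * s x); split; first exact: polyfunB.
- by move=> x hx; rewrite (laplacianB pp pes) -/(sphere_lap s) hs // opprB addrC subrK.
- by move=> x hx; rewrite sphere_eq0 // mul0r subr0.
Qed.

End DirichletProblem.

(** * Weierstrass approximation on the ball *)

Section UniformContinuity.
Context {R : realType} {n : nat}.
Local Notation E := 'rV[R]_n.
Implicit Types (x y z : E) (f : E -> R) (K : set E).

Lemma compact_uniform_continuous K f : compact K -> {within K, continuous f} ->
  forall e, 0 < e -> exists2 d, 0 < d &
    forall x y, K x -> K y -> enorm (x - y) < d -> `|f x - f y| < e.
Proof.
move=> cK /within_continuousE cf e e0.
pose P (d : R) x := K x -> forall y, K y -> enorm (y - x) < d -> `|f y - f x| < e.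
have : \forall d \near 0^'+, K `<=` P d.
  move: cK => /compact_near_coveringP /(_ R (at_right 0) P _); apply => x Kx.
  have e2 : 0 < e / 2 by rewrite divr_gt0.
  have [d d0 hd] := cf x Kx (e / 2) e2.
  exists ([set y | enorm (y - x) < d / 2], [set t | t < d / 2]) => /=.
    split; last by apply: nbhs_right_lt; rewrite divr_gt0.
    by apply/nbhs_enormP; exists (d / 2); rewrite ?divr_gt0.
  move=> [y t] /= [yx td] Ky z Kz zy.
  have h1 : `|f z - f x| < e / 2.
    by apply: hd => //; have := enorm_distD y z x; lra.
  have h2 : `|f y - f x| < e / 2 by apply: hd => //; lra.
  rewrite -(subrKA (f x)) (le_lt_trans (ler_normD _ _)) // (distrC (f x)).
  lra.
move=> [d /= d0 hd]; exists (d / 2); first by rewrite divr_gt0.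
move=> x y Kx Ky xy; apply: (hd (d / 2)) => //=; last by rewrite divr_gt0.
by rewrite sub0r normrN gtr0_norm ?divr_gt0 //; lra.
Qed.

Lemma compact_bounded_fun K f : compact K -> {within K, continuous f} ->
  exists2 M, 0 <= M & forall x, K x -> `|f x| <= M.
Proof.
move=> cK cf; have [[x Kx]|K0] := pselect (exists x, K x); last first.
  by exists 0 => // x Kx; exfalso; apply: K0; exists x.
have K0 : K !=set0 by exists x.
have [a _ ha] := EVT_max_rV K0 cK cf; have [b _ hb] := EVT_min_rV K0 cK cf.
exists (`|f a| + `|f b|); first exact: addr_ge0.
move=> y Ky; have h1 := ha y (mem_set Ky); have h2 := hb y (mem_set Ky).
have h3 := ler_norm (f a); have h4 := ler_norm (- f b); rewrite normrN in h4.
have h5 := normr_ge0 (f a); have h6 := normr_ge0 (f b).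
by rewrite ler_norml; apply/andP; split; lra.
Qed.

(** A modulus of continuity that is quadratic in the distance, the form in which
    it combines with a variance bound. *)
Lemma quadratic_modulus K f : compact K -> {within K, continuous f} ->
  forall e, 0 < e -> exists2 C, 0 <= C &
    forall x y, K x -> K y -> `|f x - f y| <= e + C * enorm (x - y) ^+ 2.
Proof.
move=> cK cf e e0; have [M M0 hM] := compact_bounded_fun cK cf.
have [d d0 hd] := compact_uniform_continuous cK cf e0.
have d2 : 0 < d ^+ 2 by rewrite exprn_gt0.
exists (2 * M / d ^+ 2); first by rewrite divr_ge0 ?mulr_ge0 // ltW.
move=> x y Kx Ky; have C0 : 0 <= 2 * M / d ^+ 2 by rewrite divr_ge0 ?mulr_ge0 // ltW.
have [xy|xy] := ltP (enorm (x - y)) d.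
  rewrite (le_trans (ltW (hd x y Kx Ky xy))) // lerDl mulr_ge0 //; exact: sqr_ge0.
have h : 2 * M <= 2 * M / d ^+ 2 * enorm (x - y) ^+ 2.
  rewrite -{1}(divfK (lt0r_neq0 d2) (2 * M)) ler_wpM2l // lerXn2r ?nnegrE ?enorm_ge0 //.
  exact: ltW.
apply: (le_trans (ler_normB _ _)); have := hM x Kx; have := hM y Ky; lra.
Qed.

End UniformContinuity.

(** [weight] is the probability of an outcome of independent coins, the coin [a]
    showing heads with probability [p a]. *)
Section Coins.
Context {R : realType} {T : finType}.
Variable p : T -> R.
Implicit Types (w : {ffun T -> bool}) (a b : T).

Definition coin a (s : bool) : R := if s then p a else 1 - p a.
Definition weight w : R := \prod_a coin a (w a).
Definition dev a w : R := (w a)%:R - p a.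

Lemma sum_prod_coin (g : T -> bool -> R) :
  \sum_(w : {ffun T -> bool}) \prod_a g a (w a) = \prod_a (g a true + g a false).
Proof.
rewrite -(bigA_distr_bigA (fun a s => g a s)) /=; apply: eq_bigr => a _.
by rewrite big_bool.
Qed.

Lemma sum_weight : \sum_w weight w = 1.
Proof. by rewrite sum_prod_coin big1 // => a _; rewrite /coin addrC subrK. Qed.

Lemma prod_at (F : R) a w : \prod_b (if b == a then F else 1) = F.
Proof. by rewrite -big_mkcond big_pred1_eq. Qed.

(** The product of the weight and of both deviations splits over the coins, and the
    factor of the coin [a] is its mean deviation, zero. *)
Lemma dev_uncorrelated a b : a != b -> \sum_w weight w * (dev a w * dev b w) = 0.
Proof.
move=> ab; pose g c (s : bool) := coin c s *
   ((if c == a then s%:R - p c else 1) * (if c == b then s%:R - p c else 1)).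
have e w : weight w * (dev a w * dev b w) = \prod_c g c (w c).
  rewrite /g !big_split /=; congr (_ * (_ * _)).
  - rewrite -[LHS](prod_at _ a w); apply: eq_bigr => c _.
    by case: eqP => [->|].
  - rewrite -[LHS](prod_at _ b w); apply: eq_bigr => c _.
    by case: eqP => [->|].
under eq_bigr do rewrite e; rewrite sum_prod_coin (bigD1 a) //=.
have -> : g a true + g a false = 0 by rewrite /g eqxx (negPf ab) /coin /=; ring.
exact: mul0r.
Qed.

Hypothesis p01 : forall a, 0 <= p a <= 1.

Lemma weight_ge0 w : 0 <= weight w.
Proof.
apply: prodr_ge0 => a _; rewrite /coin; have /andP[h1 h2] := p01 a.
by case: (w a) => //; rewrite subr_ge0.
Qed.

Lemma dev_sqr_le1 a w : dev a w * dev a w <= 1.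
Proof.
have /andP[h1 h2] := p01 a; rewrite -expr2 -[1](expr1n _ 2) -[leLHS]real_normK ?num_real //.
by rewrite lerXn2r ?nnegrE // /dev ler_norml; case: (w a) => /=; apply/andP; split; lra.
Qed.

(** Bienayme: distinct coins are uncorrelated, so only the squares contribute. *)
Lemma variance_sum (I : finType) (F : I -> T) : injective F ->
  \sum_w weight w * (\sum_i dev (F i) w) ^+ 2 <= #|I|%:R.
Proof.
move=> injF.
have -> : \sum_w weight w * (\sum_i dev (F i) w) ^+ 2 =
   \sum_i \sum_j \sum_w weight w * (dev (F i) w * dev (F j) w).
  under eq_bigr => w _.
    rewrite expr2 mulr_suml mulr_sumr.
    under eq_bigr do rewrite mulr_sumr mulr_sumr.
    over.
  rewrite exchange_big; apply: eq_bigr => i _; by rewrite exchange_big.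
rewrite -sum1_card natr_sum; apply: ler_sum => i _.
rewrite (bigD1 i) //= [X in _ + X]big1 ?addr0 => [|j ji].
  apply: (@le_trans _ _ (\sum_w weight w)); last by rewrite sum_weight.
  apply: ler_sum => w _.
  by rewrite -[leRHS]mulr1 ler_wpM2l ?weight_ge0 ?dev_sqr_le1.
by apply: dev_uncorrelated; apply: contra_neq ji => /injF.
Qed.

End Coins.

Section Weierstrass.
Context {R : realType} {n : nat}.
Local Notation E := 'rV[R]_n.
Implicit Types (x y z : E) (f : E -> R).
Variable r : R.
Hypothesis r_gt0 : 0 < r.

Definition nearest z : E := if enorm z <= r then z else (r / enorm z) *: z.

Lemma nearest_ball z : cball 0 r (nearest z).
Proof.
rewrite /cball /= subr0 /nearest; case: ifPn => //; rewrite -ltNge => zr.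
have z0 : 0 < enorm z by exact: lt_trans zr.
by rewrite enormZ ger0_norm ?divfK ?lt0r_neq0 // divr_ge0 // ltW.
Qed.

(** As [x] is in the ball, [z] is at least as close to [nearest z] as to [x]. *)
Lemma nearest_dist x z : cball 0 r x -> enorm (nearest z - x) <= 2 * enorm (z - x).
Proof.
rewrite /cball /= subr0 => hx; rewrite /nearest; case: ifPn => [_|].
  by have := enorm_ge0 (z - x); lra.
rewrite -ltNge => zr; have z0 : 0 < enorm z by exact: lt_trans zr.
have h1 := enorm_distD z ((r / enorm z) *: z) x.
have h2 : enorm ((r / enorm z) *: z - z) = enorm z - r.
  have -> : (r / enorm z) *: z - z = (r / enorm z - 1) *: z by rewrite scalerBl scale1r.
  rewrite enormZ ler0_norm; last by rewrite subr_le0 ler_pdivrMr // mul1r ltW.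
  by rewrite opprB mulrBl mul1r divfK // lt0r_neq0.
have h3 := enorm_distD x z 0; rewrite !subr0 in h3.
by lra.
Qed.

(** Bernstein's proof: toss [N] coins for each coordinate, with bias the rescaled
    coordinate of [x]; the empirical means give a random point [z] close to [x],
    and the expectation of [f] at the point of the ball nearest to [z] is a
    polynomial in [x]. *)
Theorem weierstrass f : {within cball 0 r, continuous f} ->
  forall e, 0 < e -> exists2 p, polyfun p & forall x, cball 0 r x -> `|p x - f x| <= e.
Proof.
move=> cf e e0; have e2 : 0 < e / 2 by rewrite divr_gt0.
have [C C0 hC] := quadratic_modulus (@compact_cball R n 0 r) cf e2.
pose B := C * 4 * (n%:R * (2 * r) ^+ 2).
have B0 : 0 <= B by rewrite !mulr_ge0 // ltW.
(* [B / N] bounds [4 C] times the mean squared distance of the random point to [x]. *)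
pose N := (Num.truncn (B / (e / 2))).+1.
have NB : B / N%:R <= e / 2.
  rewrite ler_pdivrMr ?ltr0Sn // mulrC -ler_pdivrMr //.
  exact/ltW/truncnS_gt.
pose T := ('I_n * 'I_N)%type.
pose bias x (a : T) := (x 0 a.1 + r) / (2 * r).
pose node (w : {ffun T -> bool}) : E :=
  \row_i (2 * r * ((\sum_(l < N) (w (i, l))%:R) / N%:R) - r).
pose p x := \sum_(w : {ffun T -> bool}) weight (bias x) w * f (nearest (node w)).
have pbias a : polyfun (fun x => bias x a).
  have -> : (fun x => bias x a) = (fun x => (2 * r)^-1 * (x 0 a.1 + r)).
    by apply/funext => x; rewrite mulrC.
  by apply: polyfunZ; apply: polyfunD; [exact: polyfun_coord|exact: polyfun_cst].
have pp : polyfun p.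
  apply: polyfun_sum => w; apply: polyfunM; last exact: polyfun_cst.
  apply: polyfun_prod => a; rewrite /coin; case: (w a); first exact: pbias.
  by apply: polyfunB; [exact: polyfun_cst|exact: pbias].
exists p => // x hx.
have N0 : N%:R != 0 :> R by rewrite pnatr_eq0.
have b01 a : 0 <= bias x a <= 1.
  have := coord_le_enorm x a.1; have : enorm x <= r by move: hx; rewrite /cball /= subr0.
  move=> h1 /le_trans /(_ h1); rewrite ler_norml => /andP[h2 h3].
  have r2 : 0 < 2 * r by rewrite mulr_gt0.
  by rewrite /bias ler_pdivrMr // divr_ge0 ?(ltW r2) //=; lra.
have -> : p x - f x = \sum_(w : {ffun T -> bool}) weight (bias x) w * (f (nearest (node w)) - f x).
  under [RHS]eq_bigr do rewrite mulrBr.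
  by rewrite sumrB -mulr_suml sum_weight mul1r.
apply: (le_trans (ler_norm_sum _ _ _)).
apply: (@le_trans _ _ (\sum_(w : {ffun T -> bool}) weight (bias x) w *
    (e / 2 + C * 4 * enorm (node w - x) ^+ 2))).
  apply: ler_sum => w _; rewrite normrM ger0_norm ?weight_ge0 // ler_wpM2l ?weight_ge0 //.
  apply: (le_trans (hC _ _ (nearest_ball _) hx)); rewrite lerD2l -mulrA ler_wpM2l //.
  have -> : 4 * enorm (node w - x) ^+ 2 = (2 * enorm (node w - x)) ^+ 2 by ring.
  by rewrite lerXn2r ?nnegrE ?mulr_ge0 ?enorm_ge0 ?nearest_dist.
under eq_bigr do rewrite mulrDr [X in _ + X]mulrCA.
rewrite big_split /= -mulr_suml sum_weight mul1r -mulr_sumr.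
suff h : \sum_(w : {ffun T -> bool}) weight (bias x) w * enorm (node w - x) ^+ 2
    <= n%:R * (2 * r) ^+ 2 / N%:R.
  have h2 : C * 4 * (n%:R * (2 * r) ^+ 2 / N%:R) <= e / 2 by rewrite mulrA.
  have := ler_wpM2l (mulr_ge0 C0 (ler0n R 4)) h; lra.
have dist w : enorm (node w - x) ^+ 2 =
    (2 * r / N%:R) ^+ 2 * \sum_i (\sum_(l < N) dev (bias x) (i, l) w) ^+ 2.
  rewrite enorm_sqr /dot mulr_sumr; apply: eq_bigr => i _; rewrite !mxE -expr2 -exprMn.
  congr (_ ^+ 2); rewrite /dev sumrB /bias /= sumr_const card_ord -[X in _ = _ * (_ - X)]mulr_natl.
  by field; rewrite N0 gt_eqF.
under eq_bigr do rewrite dist mulrCA mulr_sumr.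
rewrite -mulr_sumr exchange_big /=.
apply: (@le_trans _ _ ((2 * r / N%:R) ^+ 2 * (n%:R * N%:R))).
  rewrite ler_wpM2l ?sqr_ge0 //.
  apply: (@le_trans _ _ (\sum_(i < n) N%:R)); last first.
    by rewrite sumr_const card_ord -[leLHS]mulr_natl.
  apply: ler_sum => i _.
  have := @variance_sum R T (bias x) b01 'I_N (fun l => (i, l)) _.
  by rewrite card_ord; apply => l1 l2 [].
by rewrite le_eqVlt; apply/orP; left; apply/eqP; field.
Qed.

End Weierstrass.

(** * Quadratic polynomials *)

Section Quadratics.
Context {R : realType} {n : nat}.
Local Notation E := 'rV[R]_n.
Implicit Types (x y z u v b : E) (i j : 'I_n) (c s e t : R) (A B : 'M[R]_n).

Definition bil A u v : R := \sum_i u 0 i * \sum_j v 0 j * A i j.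

Lemma quadE x0 c b A x :
  quad x0 c b A x = c + dot (x - x0) b + bil A (x - x0) (x - x0) / 2.
Proof. by []. Qed.

Lemma bilDl A u u' v : bil A (u + u') v = bil A u v + bil A u' v.
Proof. by rewrite /bil -big_split; apply: eq_bigr => i _; rewrite mxE mulrDl. Qed.

Lemma bilZl A t u v : bil A (t *: u) v = t * bil A u v.
Proof. by rewrite /bil mulr_sumr; apply: eq_bigr => i _; rewrite mxE mulrA. Qed.

Lemma bilDr A u v v' : bil A u (v + v') = bil A u v + bil A u v'.
Proof.
rewrite /bil -big_split; apply: eq_bigr => i _ /=; rewrite -mulrDr; congr (_ * _).
by rewrite -big_split; apply: eq_bigr => j _; rewrite mxE mulrDl.
Qed.

Lemma bilZr A t u v : bil A u (t *: v) = t * bil A u v.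
Proof.
rewrite /bil mulr_sumr; apply: eq_bigr => i _; rewrite mulrCA; congr (_ * _).
by rewrite mulr_sumr; apply: eq_bigr => j _; rewrite mxE mulrA.
Qed.

Lemma bilDm A B u v : bil (A + B) u v = bil A u v + bil B u v.
Proof.
rewrite /bil -big_split; apply: eq_bigr => i _ /=; rewrite -mulrDr; congr (_ * _).
by rewrite -big_split; apply: eq_bigr => j _; rewrite mxE mulrDr.
Qed.

Lemma bilNm A u v : bil (- A) u v = - bil A u v.
Proof.
rewrite /bil -sumrN; apply: eq_bigr => i _ /=; rewrite -mulrN; congr (_ * _).
by rewrite -sumrN; apply: eq_bigr => j _; rewrite mxE mulrN.
Qed.

Lemma bilC A u v : A^T = A -> bil A u v = bil A v u.
Proof.
move=> sA; rewrite /bil; under eq_bigr do rewrite mulr_sumr.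
rewrite exchange_big; apply: eq_bigr => j _ /=; rewrite mulr_sumr.
by apply: eq_bigr => i _; rewrite -{1}sA mxE mulrCA.
Qed.

Lemma bil_delta A i j : bil A (delta_mx 0 i) (delta_mx 0 j) = A i j.
Proof.
rewrite /bil (bigD1 i) //= [X in _ + X]big1 ?addr0 => [|k /negPf ki]; last first.
  by rewrite mxE ki andbF mul0r.
rewrite mxE !eqxx mul1r (bigD1 j) //= [X in _ + X]big1 ?addr0 => [|k /negPf kj].
  by rewrite mxE !eqxx mul1r.
by rewrite mxE kj andbF mul0r.
Qed.

Lemma bil_bound A u v s e : enorm u <= s -> enorm v <= s -> (forall i j, `|A i j| <= e) ->
  `|bil A u v| <= n%:R * s * (n%:R * s * e).
Proof. by move=> us vs hA; apply: sum_bound => // i; apply: sum_bound. Qed.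

Lemma quadD x0 c b A c' b' A' x :
  quad x0 (c + c') (b + b') (A + A') x = quad x0 c b A x + quad x0 c' b' A' x.
Proof. by rewrite !quadE dotDr bilDm; ring. Qed.

Lemma quadN x0 c b A x : quad x0 (- c) (- b) (- A) x = - quad x0 c b A x.
Proof. by rewrite !quadE dotNr bilNm; ring. Qed.

Lemma quadB x0 c b A c' b' A' x :
  quad x0 (c - c') (b - b') (A - A') x = quad x0 c b A x - quad x0 c' b' A' x.
Proof. by rewrite quadD quadN. Qed.

Lemma quad_center x0 c b A : quad x0 c b A x0 = c.
Proof.
by rewrite quadE subrr dot0l -(scale0r x0) bilZl !mul0r !addr0.
Qed.

Lemma polyfun_quad x0 c b A : polyfun (quad x0 c b A).
Proof.
have ps i : polyfun (fun x => (x - x0) 0 i).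
  have -> : (fun x => (x - x0) 0 i) = (fun x => x 0 i - x0 0 i).
    by apply/funext => x; rewrite !mxE.
  exact: polyfun_shift.
apply: polyfunD.
  apply: polyfunD; first exact: polyfun_cst.
  by apply: polyfun_sum => i; apply: polyfunM => //; exact: polyfun_cst.
apply: polyfunM; last exact: polyfun_cst.
apply: polyfun_sum => i; apply: polyfunM => //; apply: polyfun_sum => j.
by apply: polyfunM => //; exact: polyfun_cst.
Qed.

Lemma quad_shift x0 c b A z u : A^T = A ->
  quad x0 c b A (z + u) = quad x0 c b A z + (dot u b + bil A u (z - x0)) + bil A u u / 2.
Proof.
move=> sA; rewrite !quadE [z + u - x0]addrAC; move: (z - x0) => d.
by rewrite dotDl !(bilDl, bilDr) (bilC d u sA); field.
Qed.

Lemma quad_recenter x c b A y z : A^T = A ->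
  quad x c b A z = quad y (quad x c b A y) (b + \row_i \sum_j (y - x) 0 j * A i j) A z.
Proof.
move=> sA; rewrite -{1}(subrK y z) addrC (quad_shift _ _ _ _ _ sA).
rewrite [RHS]quadE dotDr; congr (_ + (_ + _) + _).
by apply: eq_bigr => i _; congr (_ * _); rewrite mxE.
Qed.

(** The coefficients of a quadratic polynomial are recovered from its values by
    second differences. *)
Lemma quad_coef_bound x0 c b A s e : A^T = A -> 0 < s ->
  (forall x, cball x0 s x -> `|quad x0 c b A x| <= e) ->
  [/\ `|c| <= e, forall i, `|b 0 i| <= e / s & forall i j, `|A i j| <= 12 * e / s ^+ 2].
Proof.
move=> sA s0 hQ.
have hc : `|c| <= e.
  by rewrite -(quad_center x0 c b A) hQ // /cball /= subrr enorm0 ltW.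
have hv u : enorm u <= s -> `|quad x0 c b A (x0 + u)| <= e /\ `|quad x0 c b A (x0 - u)| <= e.
  by move=> us; split; apply: hQ; rewrite /cball /= addrAC subrr add0r ?enormN.
have qv u : quad x0 c b A (x0 + u) = c + dot u b + bil A u u / 2.
  by rewrite quadE [x0 + u - x0]addrAC subrr add0r.
have qn u : quad x0 c b A (x0 - u) = c - dot u b + bil A u u / 2.
  rewrite qv dotNl -(scaleN1r u) bilZl bilZr; ring.
have hd i : enorm (s *: delta_mx 0 i : E) <= s.
  by rewrite enormZ enorm_delta mulr1 ger0_norm // ltW.
have e0 : 0 <= e by exact: le_trans (normr_ge0 _) hc.
split => //.
- move=> i; have [] := hv _ (hd i).
  rewrite qv qn dotZl dotC dot_delta ler_pdivlMr //.
  have -> : `|b 0 i| * s = `|b 0 i * s| by rewrite normrM (gtr0_norm s0).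
  by rewrite !ler_norml => /andP[h1 h2] /andP[h3 h4]; apply/andP; split; lra.
- have hbil u : enorm u <= s -> `|bil A u u| <= 4 * e.
    move=> us; have [] := hv u us; rewrite qv qn.
    move: hc; rewrite !ler_norml => /andP[h5 h6] /andP[h1 h2] /andP[h3 h4].
    by apply/andP; split; lra.
  move=> i j; rewrite ler_pdivlMr ?exprn_gt0 //.
  have hdd : enorm ((s / 2) *: (delta_mx 0 i + delta_mx 0 j) : E) <= s.
    rewrite enormZ ger0_norm; last by rewrite divr_ge0 // ltW.
    have := enorm_triangle (delta_mx 0 i : E) (delta_mx 0 j); rewrite !enorm_delta => h.
    apply: (@le_trans _ _ (s / 2 * (1 + 1))); last lra.
    by rewrite ler_wpM2l // divr_ge0 // ltW.
  have := hbil _ hdd; have := hbil _ (hd i); have := hbil _ (hd j).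
  rewrite !(bilZl, bilZr, bilDl, bilDr) !bil_delta.
  have -> : A j i = A i j by rewrite -{1}sA mxE.
  have -> : `|A i j| * s ^+ 2 = `|A i j * s ^+ 2| by rewrite normrM (ger0_norm (sqr_ge0 s)).
  rewrite !ler_norml => /andP[h1 h2] /andP[h3 h4] /andP[h5 h6]; apply/andP; split; lra.
Qed.

Lemma quad_bound x0 c b A s e1 e2 e3 x : cball x0 s x -> `|c| <= e1 ->
  (forall i, `|b 0 i| <= e2) -> (forall i j, `|A i j| <= e3) ->
  `|quad x0 c b A x| <= e1 + n%:R * s * e2 + n%:R * s * (n%:R * s * e3).
Proof.
move=> hx hc hb hA; rewrite quadE.
have h1 : `|dot (x - x0) b| <= n%:R * s * e2 by exact: sum_bound.
have h2 : `|bil A (x - x0) (x - x0)| <= n%:R * s * (n%:R * s * e3) by exact: bil_bound.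
apply: (le_trans (ler_normD _ _)); rewrite lerD //.
  by apply: (le_trans (ler_normD _ _)); rewrite lerD.
rewrite normrM [`|2^-1|]ger0_norm ?invr_ge0 //; apply: le_trans h2.
have := normr_ge0 (bil A (x - x0) (x - x0)); lra.
Qed.

Lemma partial_quad x0 c b A i : A^T = A ->
  partial i (quad x0 c b A) = (fun x => b 0 i + \sum_j (x - x0) 0 j * A i j).
Proof.
move=> sA; apply/funext => x; rewrite /partial /derive.
apply/cvg_lim => //; apply/cvgrPdist_le => e e0.
near=> t; have t0 : t != 0 by near: t; exact: nbhs_dnbhs_neq.
rewrite /=; set S := \sum_j _; set q := quad x0 c b A x.
have db : dot (delta_mx 0 i) b = b 0 i by rewrite dotC dot_delta.
have dS : bil A (delta_mx 0 i) (x - x0) = S.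
  rewrite /bil (bigD1 i) //= [X in _ + X]big1 ?addr0 => [|k /negPf ki].
    by rewrite mxE !eqxx mul1r.
  by rewrite mxE ki andbF mul0r.
have -> : quad x0 c b A (t *: delta_mx 0 i + x) =
    q + (t * b 0 i + t * S) + t * (t * A i i) / 2.
  by rewrite addrC (quad_shift _ _ _ _ _ sA) !(bilZl, bilZr) bil_delta dotZl db dS.
have -> : b 0 i + S - t^-1 *: (q + (t * b 0 i + t * S) + t * (t * A i i) / 2 - q) =
   - (t * (A i i / 2)).
  by rewrite /GRing.scale /=; field.
rewrite normrN normrM.
have : `|t| < e / (`|A i i / 2| + 1).
  by near: t; apply: dnbhs0_lt; rewrite divr_gt0 // ltr_wpDl.
rewrite ltr_pdivlMr ?ltr_wpDl // mulrDr mulr1 => /ltW; apply: le_trans.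
by rewrite lerDl.
Unshelve. all: by end_near. Qed.

Lemma laplacian_quad x0 c b A x : A^T = A -> laplacian (quad x0 c b A) x = \tr A.
Proof.
move=> sA; apply: eq_bigr => i _; rewrite (partial_quad _ _ _ _ sA).
have ps j : polyfun (fun x : E => (x - x0) 0 j * A i j).
  have -> : (fun x => (x - x0) 0 j * A i j) = (fun x => A i j * (x 0 j - x0 0 j)).
    by apply/funext => y; rewrite !mxE mulrC.
  exact/polyfunZ/polyfun_shift.
rewrite (partialD i (polyfun_cst _) (polyfun_sum _ ps)) partial_cst add0r.
rewrite (partial_sum i ps) (bigD1 i) //= [X in _ + X]big1 ?addr0.
  have -> : (fun x : E => (x - x0) 0 i * A i i) = (fun x => A i i * (x 0 i - x0 0 i)).
    by apply/funext => y; rewrite !mxE mulrC.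
  by rewrite (partialZ i _ (polyfun_shift x0 i)) partial_shift eqxx mulr1.
move=> j /negPf ji.
have -> : (fun x : E => (x - x0) 0 j * A i j) = (fun x => A i j * (x 0 j - x0 0 j)).
  by apply/funext => y; rewrite !mxE mulrC.
by rewrite (partialZ i _ (polyfun_shift x0 j)) partial_shift eq_sym ji mulr0.
Qed.

Lemma hessian_sym f x : polyfun f -> (hessian f x)^T = hessian f x.
Proof. by move=> pf; apply/matrixP => i j; rewrite !mxE partialC. Qed.

Lemma hessian_trace f x : \tr (hessian f x) = laplacian f x.
Proof. by apply: eq_bigr => i _; rewrite mxE. Qed.

End Quadratics.

(** * The Poisson problem as a limit of polynomial ones *)

Section Helly.
Context {R : realType}.

(** The supremum of the left endpoints of pairwise intersecting intervals lies in all
    of them. *)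
Lemma common_point (I : Type) (P : set I) (a e : I -> R) : P !=set0 ->
  (forall i j, P i -> P j -> `|a i - a j| <= e i + e j) ->
  exists l, forall i, P i -> `|a i - l| <= e i.
Proof.
move=> [i0 Pi0] h; pose S := [set x | exists2 i, P i & x = a i - e i].
have ubS j : P j -> ubound S (a j + e j).
  move=> Pj x [i Pi ->]; have := h i j Pi Pj; rewrite ler_norml => /andP[_ h1]; lra.
have S0 : S !=set0 by exists (a i0 - e i0); exists i0.
exists (sup S) => i Pi; rewrite ler_norml; apply/andP; split.
  have : sup S <= a i + e i by apply: ge_sup => //; exact: ubS.
  lra.
have : a i - e i <= sup S.
  by apply: ub_le_sup; [exists (a i0 + e i0); exact: ubS|exists i].
lra.
Qed.

Lemma geometric_limit (a : nat -> R) (D q : R) : 0 <= D -> 0 <= q -> q < 1 ->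
  (forall k, `|a k.+1 - a k| <= D * q ^+ k) ->
  exists l, forall k, `|a k - l| <= D / (1 - q) * q ^+ k.
Proof.
move=> D0 q0 q1 h; have q1' : 0 < 1 - q by rewrite subr_gt0.
pose e k := D / (1 - q) * q ^+ k.
have e0 k : 0 <= e k by rewrite mulr_ge0 ?exprn_ge0 // divr_ge0 // ltW.
have eS k : e k - e k.+1 = D * q ^+ k.
  by rewrite /e exprS; field; rewrite gt_eqF.
have step k m : `|a (k + m)%N - a k| <= e k - e (k + m)%N.
  elim: m => [|m IH]; first by rewrite addn0 !subrr normr0.
  rewrite addnS; have := h (k + m)%N; rewrite -eS => h1.
  have := ler_normD (a (k + m).+1 - a (k + m)%N) (a (k + m)%N - a k).
  by rewrite subrKA; lra.
have pw i j : setT i -> setT j -> `|a i - a j| <= e i + e j.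
  move=> _ _; wlog ij : i j / (i <= j)%N => [H|].
    by case/orP: (leq_total i j) => ij; [|rewrite distrC [leRHS]addrC]; exact: H.
  have := step i (j - i)%N; rewrite subnKC // distrC.
  by have := e0 j; have := e0 i; lra.
have [l hl] := common_point (ex_intro _ 0%N I) pw.
by exists l => k; exact: hl.
Qed.

End Helly.

Section PoissonApproximation.
Context {R : realType} {n : nat}.
Local Notation E := 'rV[R]_n.
Implicit Types (x y z : E) (f g u v w : E -> R).
Hypothesis n_gt0 : (0 < n)%N.
Variable r : R.
Hypothesis r_gt0 : 0 < r.

Definition poisson_limit w v := forall e, 0 < e -> exists u, [/\ polyfun u,
    forall x, cball 0 r x -> `|u x - v x| <= e
  & forall x, oball 0 r x -> `|laplacian u x - w x| <= e].

(** Polynomial data give polynomial solutions; by the maximum principle these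
    converge uniformly when the data do. *)
Lemma poisson_limit_exists w g :
  {within cball 0 r, continuous w} -> {within cball 0 r, continuous g} ->
  exists v, [/\ {within cball 0 r, continuous v},
    forall x, enorm x = r -> v x = g x & poisson_limit w v].
Proof.
move=> cw cg.
have sol (e : R) : exists u, 0 < e -> [/\ polyfun u,
    forall x, enorm x = r -> `|u x - g x| <= e
  & forall x, oball 0 r x -> `|laplacian u x - w x| <= e].
  have [e0|e0] := ltP 0 e; last first.
    by exists (fun=> 0).
  have [p pp hp] := weierstrass r_gt0 cw e0.
  have [q pq hq] := weierstrass r_gt0 cg e0.
  have [u [pu lu bu]] := @poisson_polynomial _ _ n_gt0 0 r _ _ pq pp.
  exists u => _; split => // x hx.
    by rewrite bu ?subr0 // hq // /cball /= subr0 hx.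
  by rewrite lu // hp //; exact: oball_sub.
have {sol} [u hu] := choice sol.
pose c := 1 + r ^+ 2; have c0 : 0 < c by rewrite ltr_pwDl ?ltr01 // sqr_ge0.
have cau x : cball 0 r x -> forall e d : R, 0 < e -> 0 < d ->
    `|u e x - u d x| <= e * c + d * c.
  move=> hx e d e0 d0; have [pe be le] := hu e e0; have [pd bd ld] := hu d d0.
  have := @poisson_bound _ _ n_gt0 0 r (fun y => u e y - u d y) (e + d) (e + d).
  move=> /(_ (addr_ge0 (ltW e0) (ltW d0)) (polyfunB pe pd)) h.
  have -> : e * c + d * c = e + d + (e + d) * r ^+ 2 by rewrite /c; ring.
  apply: h hx => y hy.
    rewrite (laplacianB pe pd) -(subrKA (w y)) (le_trans (ler_normD _ _)) //.
    by rewrite (distrC (w y)); apply: lerD; [exact: le|exact: ld].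
  rewrite subr0 in hy; rewrite -(subrKA (g y)) (le_trans (ler_normD _ _)) //.
  by rewrite (distrC (g y)); apply: lerD; [exact: be|exact: bd].
have lim x : exists l : R, cball 0 r x -> forall e, 0 < e -> `|u e x - l| <= e * c.
  have [hx|hx] := pselect (cball 0 r x); last by exists 0.
  have [l hl] := @common_point R R [set e | 0 < e] (u ^~ x) (fun e => e * c)
    (ex_intro _ 1 ltr01) (cau x hx).
  by exists l.
have {lim} [v hv] := choice lim.
exists v; split.
- apply/within_continuousE => x Kx e e0.
  pose d := e / (3 * c) / 2; have d0 : 0 < d by rewrite !divr_gt0 ?mulr_gt0.
  have dc : 6 * (d * c) = e by rewrite /d; field; rewrite gt_eqF.
  have [pd _ _] := hu d d0.
  have := polyfun_within (A := cball 0 r) pd; rewrite within_continuousE.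
  have d3 : 0 < e / 3 by rewrite divr_gt0.
  move=> /(_ x Kx (e / 3) d3)[t t0 ht]; exists t => // y Ky xy.
  have := ht y Ky xy; have := hv x Kx d d0; have := hv y Ky d d0.
  rewrite !ler_norml !ltr_norml => /andP[a1 a2] /andP[b1 b2] /andP[c1 c2].
  by apply/andP; split; lra.
- move=> x hx; apply/eqP; rewrite -subr_eq0 -normr_le0; apply/ler_addgt0Pr => e e0.
  rewrite add0r; pose d := e / (1 + c).
  have c1 : 0 < 1 + c by rewrite addr_gt0.
  have d0 : 0 < d by rewrite divr_gt0.
  have dc : d + d * c = e by rewrite /d; field; rewrite gt_eqF.
  have Kx : cball 0 r x by rewrite /cball /= subr0 hx.
  have [_ bd _] := hu d d0; have h1 := bd x hx; have h2 := hv x Kx d d0.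
  by rewrite -(subrKA (u d x)) (le_trans (ler_normD _ _)) // (distrC (v x)) -dc addrC lerD.
- move=> e e0; have d0 : 0 < e / c by rewrite divr_gt0.
  have [pd bd ld] := hu _ d0; exists (u (e / c)); split => // x hx.
    by rewrite (le_trans (hv x hx _ d0)) // divfK // gt_eqF.
  by rewrite (le_trans (ld x hx)) // ler_pdivrMr // ler_peMr ?(ltW e0) // /c lerDl sqr_ge0.
Qed.

End PoissonApproximation.

(** * Campanato iteration *)

Section Geometric.
Context {R : realType}.

Lemma geometric_lt (q e : R) : q < 1 -> 0 <= q -> 0 < e -> exists k, q ^+ k < e.
Proof.
move=> q1 q0 e0; have /cvgrPdist_lt /(_ e e0) [k _ hk] : q ^+ k @[k --> \oo] --> 0.
  by apply: cvg_expr; rewrite ger0_norm.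
exists k; have := hk k (leqnn k); rewrite /= sub0r normrN ger0_norm //.
exact: exprn_ge0.
Qed.

Lemma geometric_small (x D q : R) : 0 <= q -> q < 1 -> (forall k, x <= D * q ^+ k) -> x <= 0.
Proof.
move=> q0 q1 h; rewrite leNgt; apply/negP => x0.
have D1 : 0 < `|D| + 1 by rewrite ltr_wpDl.
have [k hk] := geometric_lt q1 q0 (divr_gt0 x0 D1).
have := h k; apply/negP; rewrite -ltNge.
have qk : 0 <= q ^+ k by exact: exprn_ge0.
rewrite ltr_pdivlMr // in hk; have h1 := ler_norm D.
have := ler_wpM2r qk h1; lra.
Qed.

End Geometric.

Section Campanato.
Context {R : realType} {n : nat}.
Local Notation E := 'rV[R]_n.
Implicit Types (x y z : E) (f g u : E -> R).
Hypothesis n_gt0 : (0 < n)%N.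
Variables (r bt K : R) (v w : E -> R).
Hypotheses (bt_gt0 : 0 < bt) (bt_lt1 : bt < 1) (K_gt0 : 0 < K).
Hypothesis v_sol : poisson_limit r w v.
Hypothesis w_hoelder : forall x y, cball 0 r x -> cball 0 r y ->
  `|w x - w y| <= K * enorm (x - y) `^ bt.

(** The size of the error allowed on a ball of radius [s]. *)
Definition scale (s : R) : R := s ^+ 2 * s `^ bt.

Lemma scale_gt0 s : 0 < s -> 0 < scale s.
Proof. by move=> s0; rewrite mulr_gt0 ?exprn_gt0 ?powR_gt0. Qed.

Lemma scaleM a s : 0 <= a -> 0 <= s -> scale (a * s) = scale a * scale s.
Proof. by move=> a0 s0; rewrite /scale powRM //; ring. Qed.

Lemma scale_le a s : 0 <= a -> a <= s -> scale a <= scale s.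
Proof.
move=> a0 as'; have s0 := le_trans a0 as'.
rewrite ler_pM ?sqr_ge0 ?powR_ge0 ?lerXn2r ?nnegrE //.
by apply: ge0_ler_powR; rewrite ?nnegrE // ltW.
Qed.

Lemma subball x0 s : enorm x0 + s <= r ->
  (forall x, cball x0 s x -> cball 0 r x) /\ (forall x, oball x0 s x -> oball 0 r x).
Proof.
move=> h; split=> x; rewrite /cball /oball /= subr0 => hx;
  by have := enorm_triangle (x - x0) x0; rewrite subrK; lra.
Qed.

(** Take a polynomial [u] close to [v] to within the allowed error and solve
    [Delta h = w x0] with the values of [u] on the sphere; by the Hoelder condition the
    laplacians of [u] and [h] differ by at most [2 K s ^ bt]. *)
Lemma local_harmonic x0 s : 0 < s -> enorm x0 + s <= r -> exists h, [/\ polyfun h,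
    forall x, oball x0 s x -> laplacian h x = w x0
  & forall x, cball x0 s x -> `|v x - h x| <= 3 * K * scale s].
Proof.
move=> s0 sr; have [subc subo] := subball sr.
have sb : 0 < s `^ bt by exact: powR_gt0.
(* The factor [m] makes [e] small enough both for the laplacian, where [K s ^ bt] is
   allowed, and for the values, where [K s ^ (2 + bt)] is. *)
pose m := Num.min 1 (s ^+ 2); pose e := K * s `^ bt * m.
have s20 : 0 < s ^+ 2 by rewrite exprn_gt0.
have m0 : 0 < m by rewrite lt_min ltr01.
have e0 : 0 < e by rewrite !mulr_gt0.
have Ks : 0 <= K * s `^ bt by rewrite mulr_ge0 ?ltW.
have e1 : e <= K * s `^ bt by rewrite -[leRHS]mulr1 ler_wpM2l // ge_min lexx.
have e2 : e <= K * scale s.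
  by rewrite /scale (mulrC (s ^+ 2)) mulrA ler_wpM2l // ge_min lexx orbT.
have [u [pu bu lu]] := v_sol e0.
have [h [ph lh bh]] := @poisson_polynomial _ _ n_gt0 x0 s _ _ pu (polyfun_cst (w x0)).
exists h; split => // x hx.
have : `|u x - h x| <= 0 + 2 * K * s `^ bt * s ^+ 2.
  apply: (@poisson_bound _ _ n_gt0 x0 s (fun y => u y - h y)) hx.
  - by rewrite !mulr_ge0 // ltW.
  - exact: polyfunB.
  - move=> y hy; rewrite (laplacianB pu ph) lh //.
    have h1 := lu y (subo y hy).
    have x0r : cball 0 r x0 by apply: subc; rewrite /cball /= subrr enorm0 ltW.
    have h2 := w_hoelder (subc y (oball_sub hy)) x0r.
    have h3 : enorm (y - x0) `^ bt <= s `^ bt.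
      by apply: ge0_ler_powR; rewrite ?nnegrE ?enorm_ge0 ?ltW.
    have h4 := ler_wpM2l (ltW K_gt0) h3.
    by rewrite -(subrKA (w y)) (le_trans (ler_normD _ _)) //; lra.
  - by move=> y hy; rewrite bh // subrr normr0.
rewrite add0r => h1; have h2 := bu x (subc x hx).
rewrite -(subrKA (u x)) (le_trans (ler_normD _ _)) // distrC.
have -> : 3 * K * scale s = K * scale s + 2 * K * s `^ bt * s ^+ 2 by rewrite /scale; ring.
by apply: lerD => //; exact: le_trans h2 e2.
Qed.

Definition taylor_const : R := (6 * n%:R ^+ 2) ^+ 3.

Lemma taylor_const_ge0 : 0 <= taylor_const.
Proof. by rewrite exprn_ge0 // mulr_ge0 // exprn_ge0. Qed.

(** The contraction ratio: the cubic Taylor remainder [theta ^ 3] of a harmonic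
    function beats the target decay [theta ^ (2 + bt)]. *)
Lemma exists_ratio : exists theta : R,
  [/\ 0 < theta, theta <= 1 / 2 & 4 * taylor_const * theta <= theta `^ bt].
Proof.
have C0 := taylor_const_ge0; pose D := 4 * taylor_const + 1.
have D0 : 0 < D by rewrite ltr_wpDl ?mulr_ge0.
have g0 : 0 < 1 - bt by rewrite subr_gt0.
pose a := D^-1 `^ (1 - bt)^-1.
have a0 : 0 < a by rewrite powR_gt0 // invr_gt0.
have t0 : 0 < Num.min (1 / 2) a by rewrite lt_min a0 andbT.
exists (Num.min (1 / 2) a); split => //; first by rewrite ge_min lexx.
set t := Num.min _ _ in t0 *.
have ta : t `^ (1 - bt) <= D^-1.
  have -> : D^-1 = a `^ (1 - bt).
    by rewrite /a -powRrM mulVf ?gt_eqF // powRr1 // invr_ge0 ltW.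
  by apply: ge0_ler_powR; rewrite ?nnegrE ?(ltW g0) ?(ltW t0) ?(ltW a0) // /t ge_min lexx orbT.
have -> : 4 * taylor_const * t = 4 * taylor_const * t `^ (1 - bt) * t `^ bt.
  rewrite -[RHS]mulrA -powRD ?subrK ?powRr1 ?(ltW t0) //.
  by rewrite (gt_eqF t0) implybT.
rewrite ler_piMl ?powR_ge0 //; apply: (@le_trans _ _ (4 * taylor_const * D^-1)).
  by rewrite ler_wpM2l // mulr_ge0.
by rewrite ler_pdivrMr // mul1r /D lerDl.
Qed.

Section AtPoint.
Variables (theta : R) (x0 : E) (dl M : R).
Hypotheses (theta_gt0 : 0 < theta) (theta_le : theta <= 1 / 2).
Hypothesis theta_decay : 4 * taylor_const * theta <= theta `^ bt.
Hypotheses (dl_gt0 : 0 < dl) (dl_r : enorm x0 + dl <= r).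
Hypotheses (M_gt0 : 0 < M) (M_large : 6 * K <= M * scale theta).

Definition approx_at s c b (A : 'M[R]_n) : Prop := [/\ A^T = A, \tr A = w x0
  & forall x, cball x0 s x -> `|v x - quad x0 c b A x| <= M * scale s].

Lemma theta_lt1 : theta < 1.
Proof. by apply: (le_lt_trans theta_le); lra. Qed.

Lemma scale_theta_le1 : scale theta <= 1.
Proof.
have -> : 1 = scale 1 :> R by rewrite /scale expr1n powR1 mulr1.
by apply: scale_le; rewrite ltW // theta_lt1.
Qed.

(** Campanato's iteration step: subtract the Taylor polynomial at the centre of the
    harmonic replacement of the current error. *)
Lemma improve s c b A : 0 < s -> s <= dl -> approx_at s c b A ->
  exists c' b' A', approx_at (theta * s) c' b' A'.
Proof.
move=> s0 sdl [sA tA hA].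
have sr : enorm x0 + s <= r by apply: le_trans dl_r; rewrite lerD2l.
have [h [ph lh bh]] := local_harmonic s0 sr.
pose P := quad x0 c b A; have pP : polyfun P by exact: polyfun_quad.
pose h' x := h x - P x; have ph' : polyfun h' by exact: polyfunB.
have lh' x : oball x0 s x -> laplacian h' x = 0.
  by move=> hx; rewrite (laplacianB ph pP) lh // (laplacian_quad _ _ _ _ sA) tA subrr.
have S0 := scale_gt0 s0; have T0 := scale_gt0 theta_gt0.
have K3 : 3 * K <= M.
  have h1 : M * scale theta <= M by rewrite ler_piMr ?scale_theta_le1 // ltW.
  by have := M_large; have := K_gt0; lra.
have bh' x : cball x0 s x -> `|h' x| <= 2 * M * scale s.
  move=> hx; have h1 := bh x hx; have h2 := hA x hx.
  rewrite /h' -(subrKA (v x)) (le_trans (ler_normD _ _)) // distrC.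
  have h3 : 3 * K * scale s <= M * scale s by rewrite ler_wpM2r // ltW.
  by rewrite -/P in h2; lra.
have ts : theta * s <= s / 2.
  by have := ler_wpM2r (ltW s0) theta_le; lra.
have HT := harmonic_taylor n_gt0 s0 ts ph' lh' bh'.
have x0s : oball x0 s x0 by rewrite /oball /= subrr enorm0.
exists (c + h' x0), (b + gradient h' x0), (A + hessian h' x0); split.
- by rewrite linearD /= sA hessian_sym.
- by rewrite mxtraceD tA hessian_trace lh' // addr0.
- move=> x hx; rewrite quadD -/(P x).
  have hxs : cball x0 s x by apply: (le_trans hx); apply: (le_trans ts); lra.
  have h1 := HT x hx; have h2 := bh x hxs.
  have -> : v x - (P x + quad x0 (h' x0) (gradient h' x0) (hessian h' x0) x) =
    (v x - h x) + (h' x - quad x0 (h' x0) (gradient h' x0) (hessian h' x0) x).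
    by rewrite /h'; ring.
  apply: (le_trans (ler_normD _ _)); apply: (le_trans (lerD h2 h1)).
  rewrite mulfK ?gt_eqF // scaleM ?(ltW theta_gt0) ?(ltW s0) //.
  have h3 : 3 * K * scale s <= M * scale theta * scale s / 2.
    have := ler_wpM2r (ltW S0) M_large; lra.
  have h4 : taylor_const * (2 * M * scale s) * theta ^+ 3 <= M * scale theta * scale s / 2.
    have h5 : 4 * taylor_const * theta * (M * theta ^+ 2 * scale s / 2) <=
       theta `^ bt * (M * theta ^+ 2 * scale s / 2).
      apply: ler_wpM2r theta_decay.
      apply: divr_ge0 => //; apply: mulr_ge0; last exact: ltW.
      by apply: mulr_ge0; [exact: ltW|exact: sqr_ge0].
    have e1 : taylor_const * (2 * M * scale s) * theta ^+ 3 =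
      4 * taylor_const * theta * (M * theta ^+ 2 * scale s / 2) by field.
    have e2 : M * scale theta * scale s / 2 =
      theta `^ bt * (M * theta ^+ 2 * scale s / 2) by rewrite /scale; field.
    by rewrite e1 e2.
  by rewrite -/taylor_const mulrA; lra.
Qed.

Definition radius k := theta ^+ k * dl.

Lemma radius_gt0 k : 0 < radius k.
Proof. by rewrite mulr_gt0 ?exprn_gt0. Qed.

Lemma radius_le k : radius k <= dl.
Proof.
by rewrite /radius ler_piMl ?exprn_ile1 // ?ltW // theta_lt1.
Qed.

Lemma radiusS k : radius k.+1 = theta * radius k.
Proof. by rewrite /radius exprS mulrA. Qed.

Hypothesis approx0 : exists c b A, approx_at dl c b A.

Lemma approx_radius k : exists t : R * E * 'M[R]_n, approx_at (radius k) t.1.1 t.1.2 t.2.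
Proof.
elim: k => [|k [[[c b] A] /= h]].
  have [c [b [A h]]] := approx0; exists (c, b, A).
  by rewrite /radius expr0 mul1r.
rewrite radiusS; have [c' [b' [A' h']]] := improve (radius_gt0 k) (radius_le k) h.
by exists (c', b', A').
Qed.

(** The term [2] comes from the approximant and from its constant coefficient, the
    other two from the geometric series of the linear and quadratic coefficients. The
    division by [scale theta] accounts for radii between two consecutive terms. *)
Definition limit_const : R := (2 + 2 * n%:R / (theta * (1 - theta * theta `^ bt)) +
   24 * n%:R ^+ 2 / (theta ^+ 2 * (1 - theta `^ bt))) * M / scale theta.

Lemma powR_exprn (a b : R) k : 0 <= a -> (a ^+ k) `^ b = (a `^ b) ^+ k.
Proof.
move=> a0; elim: k => [|k IH]; first by rewrite !expr0 powR1.
by rewrite !exprS powRM ?IH // exprn_ge0.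
Qed.

(** Consecutive approximants differ little on the smaller ball, hence so do their
    coefficients, and these converge geometrically. The limit inherits the symmetry and
    the trace. *)
Lemma second_order_expansion : exists b A, [/\ A^T = A, \tr A = w x0
  & forall x, cball x0 dl x ->
      `|v x - quad x0 (v x0) b A x| <= limit_const * scale (enorm (x - x0))].
Proof.
have [t ht] := choice approx_radius.
pose c k := (t k).1.1; pose b k := (t k).1.2; pose A k := (t k).2.
have hk k : approx_at (radius k) (c k) (b k) (A k) by exact: ht.
have q0 : 0 < theta `^ bt by exact: powR_gt0.
have q1 : theta `^ bt < 1.
  have -> : 1 = 1 `^ bt :> R by rewrite powR1.
  by apply: gt0_ltr_powR => //; rewrite ?nnegrE ?ltW // theta_lt1.
have p0 : 0 < theta * theta `^ bt by exact: mulr_gt0.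
have p1 : theta * theta `^ bt < 1 by rewrite mulr_ilt1 ?theta_lt1 ?ltW.
have db : 0 < dl `^ bt by exact: powR_gt0.
have rb k : radius k `^ bt = (theta `^ bt) ^+ k * dl `^ bt.
  by rewrite /radius powRM ?exprn_ge0 ?powR_exprn ?ltW.
have diff k : (forall i, `|b k.+1 0 i - b k 0 i| <=
        2 * M * dl * dl `^ bt / theta * (theta * theta `^ bt) ^+ k) /\
   forall i j, `|A k.+1 i j - A k i j| <= 24 * M * dl `^ bt / theta ^+ 2 * (theta `^ bt) ^+ k.
  have [sA1 _ h1] := hk k.+1; have [sA0 _ h0] := hk k.
  have sA : (A k.+1 - A k)^T = A k.+1 - A k by rewrite linearB /= sA1 sA0.
  have rk := radius_gt0 k; have rk1 := radius_gt0 k.+1.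
  have hr : radius k.+1 <= radius k by rewrite radiusS ler_piMl ?ltW ?theta_lt1.
  have hq x : cball x0 (radius k.+1) x ->
     `|quad x0 (c k.+1 - c k) (b k.+1 - b k) (A k.+1 - A k) x| <= 2 * M * scale (radius k).
    move=> hx; rewrite quadB -(subrKA (v x)) (le_trans (ler_normD _ _)) // distrC.
    have g1 := h1 x hx; have g0 := h0 x (le_trans hx hr).
    have := ler_wpM2l (ltW M_gt0) (scale_le (ltW rk1) hr); lra.
  have [_ hb hA] := quad_coef_bound sA rk1 hq.
  have rn : radius k != 0 by rewrite gt_eqF.
  have tn : theta != 0 by rewrite gt_eqF.
  have dn : dl != 0 by rewrite gt_eqF.
  split => [i|i j].
    have := hb i; rewrite !mxE => /le_trans; apply.
    rewrite le_eqVlt; apply/orP; left; apply/eqP.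
    rewrite radiusS /scale rb [in RHS]exprMn /radius.
    move: (expf_neq0 k tn); move: (theta ^+ k) => a an; move: ((theta `^ bt) ^+ k) => d.
    by field; rewrite tn dn an.
  have := hA i j; rewrite !mxE => /le_trans; apply.
  rewrite le_eqVlt; apply/orP; left; apply/eqP.
  rewrite radiusS /scale rb /radius.
  move: (expf_neq0 k tn); move: (theta ^+ k) => a an; move: ((theta `^ bt) ^+ k) => d.
  by field; rewrite tn dn an.
have D1 : 0 <= 2 * M * dl * dl `^ bt / theta by rewrite !mulr_ge0 ?invr_ge0 ?ltW.
have D2 : 0 <= 24 * M * dl `^ bt / theta ^+ 2.
  by rewrite !mulr_ge0 ?invr_ge0 ?exprn_ge0 ?ltW.
have [bl hbl] := choice (fun i => geometric_limit D1 (ltW p0) p1 (fun k => (diff k).1 i)).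
have [Al hAl] := choice (fun ij : 'I_n * 'I_n =>
  geometric_limit D2 (ltW q0) q1 (fun k => (diff k).2 ij.1 ij.2)).
pose C1 := 2 * M / (theta * (1 - theta * theta `^ bt)).
pose C2 := 24 * M / (theta ^+ 2 * (1 - theta `^ bt)).
pose bb : E := \row_i bl i; pose AA : 'M[R]_n := \matrix_(i, j) Al (i, j).
have hb k i : `|b k 0 i - bb 0 i| <= C1 * (radius k * radius k `^ bt).
  rewrite mxE; apply: (le_trans (hbl i k)); rewrite le_eqVlt; apply/orP; left; apply/eqP.
  rewrite /C1 rb /radius exprMn; move: (theta ^+ k) ((theta `^ bt) ^+ k) => a d.
  by field; rewrite !gt_eqF // subr_gt0.
have hA k i j : `|A k i j - AA i j| <= C2 * radius k `^ bt.
  rewrite mxE; apply: (le_trans (hAl (i, j) k)); rewrite le_eqVlt; apply/orP; left; apply/eqP.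
  by rewrite /C2 rb; field; rewrite !gt_eqF // subr_gt0.
have hA' k i j : `|A k i j - AA i j| <= C2 * dl `^ bt * (theta `^ bt) ^+ k.
  by rewrite -mulrA (mulrC (dl `^ bt)) -rb.
have C10 : 0 <= C1 by rewrite /C1 divr_ge0 // ?mulr_ge0 // ?subr_ge0 ltW.
have C20 : 0 <= C2.
  by rewrite /C2 divr_ge0 // ?mulr_ge0 ?exprn_ge0 // ?subr_ge0 ltW.
exists bb, AA; split.
- apply/matrixP => i j; rewrite mxE; apply/eqP; rewrite -subr_eq0 -normr_le0.
  apply: (geometric_small (D := 2 * (C2 * dl `^ bt)) (ltW q0) q1) => k.
  have := hA' k i j; have := hA' k j i; have [sk _ _] := hk k.
  have -> : A k i j = A k j i by rewrite -{1}sk mxE.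
  move=> h1 h2; rewrite -(subrKA (A k j i)) (le_trans (ler_normD _ _)) // distrC.
  by lra.
- apply/eqP; rewrite -subr_eq0 -normr_le0.
  apply: (geometric_small (D := n%:R * (C2 * dl `^ bt)) (ltW q0) q1) => k.
  have [_ <- _] := hk k; rewrite /mxtrace -sumrB.
  apply: (le_trans (ler_norm_sum _ _ _)).
  apply: (@le_trans _ _ (\sum_(i < n) C2 * dl `^ bt * (theta `^ bt) ^+ k)).
    by apply: ler_sum => i _; rewrite distrC.
  by rewrite sumr_const card_ord -[leLHS]mulr_natl !mulrA.
- have key k x : cball x0 (radius k) x ->
      `|v x - quad x0 (v x0) bb AA x| <= (2 * M + n%:R * C1 + n%:R ^+ 2 * C2) * scale (radius k).
    move=> hx; have [_ _ h0] := hk k; have rk := radius_gt0 k.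
    have c1 : `|c k - v x0| <= M * scale (radius k).
      have := h0 x0; rewrite quad_center distrC; apply.
      by rewrite /cball /= subrr enorm0 ltW.
    have b1 i : `|(b k - bb) 0 i| <= C1 * (radius k * radius k `^ bt).
      by have := hb k i; rewrite !mxE.
    have A1 i j : `|(A k - AA) i j| <= C2 * radius k `^ bt.
      by have := hA k i j; rewrite !mxE.
    have := quad_bound hx c1 b1 A1; rewrite quadB => h1.
    have h2 := h0 x hx.
    rewrite -(subrKA (quad x0 (c k) (b k) (A k) x)) (le_trans (ler_normD _ _)) //.
    apply: (le_trans (lerD h2 h1)); rewrite le_eqVlt; apply/orP; left; apply/eqP.
    by rewrite /scale; ring.
  move=> x hx; have [x00|xn0] := eqVneq (enorm (x - x0)) 0.
    have -> : x = x0 by apply/eqP; rewrite -subr_eq0; apply/eqP; exact: enorm_eq0.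
    by rewrite quad_center subrr normr0 subrr enorm0 /scale expr0n mul0r mulr0.
  have xp : 0 < enorm (x - x0) by rewrite lt_def xn0 enorm_ge0.
  have [k0 hk0] := geometric_lt theta_lt1 (ltW theta_gt0) (divr_gt0 xp dl_gt0).
  have : exists k, radius k < enorm (x - x0).
    by exists k0; rewrite /radius -ltr_pdivlMr.
  move=> ex; case: (ex_minnP ex) => -[|k] hk1 kmin.
    by move: hk1; rewrite /radius expr0 mul1r ltNge hx.
  have rkx : enorm (x - x0) <= radius k.
    by rewrite leNgt; apply/negP => /kmin; rewrite ltnn.
  apply: (le_trans (key k x rkx)).
  have T0 := scale_gt0 theta_gt0.
  have h1 : scale theta * scale (radius k) <= scale (enorm (x - x0)).
    rewrite -scaleM ?(ltW theta_gt0) ?(ltW (radius_gt0 k)) // -radiusS.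
    by apply: scale_le; rewrite ltW // radius_gt0.
  have -> : (2 * M + n%:R * C1 + n%:R ^+ 2 * C2) * scale (radius k) =
     limit_const * (scale theta * scale (radius k)).
    by rewrite /limit_const /C1 /C2; field; rewrite !gt_eqF // subr_gt0.
  rewrite ler_wpM2l // /limit_const divr_ge0 ?(ltW T0) //.
  apply: mulr_ge0; last exact: ltW.
  have g1 : 0 <= 1 - theta * theta `^ bt by rewrite subr_ge0 ltW.
  have g2 : 0 <= 1 - theta `^ bt by rewrite subr_ge0 ltW.
  have t0 := ltW theta_gt0.
  by rewrite !addr_ge0 // divr_ge0 // ?mulr_ge0 // exprn_ge0.
Qed.

End AtPoint.
End Campanato.

(** * From expansions to derivatives *)

Section UniformExpansion.
Context {R : realType} {n : nat}.
Local Notation E := 'rV[R]_n.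
Implicit Types (x y z : E) (f g u : E -> R).
Hypothesis n_gt0 : (0 < n)%N.
Variables (r bt K V W : R) (v w : E -> R).
Hypotheses (bt_gt0 : 0 < bt) (bt_lt1 : bt < 1) (K_gt0 : 0 < K).
Hypothesis v_sol : poisson_limit r w v.
Hypothesis w_hoelder : forall x y, cball 0 r x -> cball 0 r y ->
  `|w x - w y| <= K * enorm (x - y) `^ bt.
Hypotheses (v_bound : forall x, cball 0 r x -> `|v x| <= V)
  (w_bound : forall x, cball 0 r x -> `|w x| <= W).

(** The constant of [second_order_expansion] depends on the bounds of the data and on
    the distance to the sphere, but not on the point. The iteration starts from
    [w x0 / (2 n) |x - x0| ^ 2]. *)
Lemma uniform_expansion dl : 0 < dl -> exists2 C, 0 <= C &
  forall x0, enorm x0 + dl <= r -> exists b A, [/\ A^T = A, \tr A = w x0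
  & forall x, cball x0 dl x ->
      `|v x - quad x0 (v x0) b A x| <= C * scale bt (enorm (x - x0))].
Proof.
move=> dl0; have [theta [t0 t2 tb]] := @exists_ratio R n bt bt_lt1.
have T0 : 0 < scale bt theta by exact: scale_gt0.
have S0 : 0 < scale bt dl by exact: scale_gt0.
pose Z := `|V| + n%:R * dl * (n%:R * dl * `|W|).
have Z0 : 0 <= Z.
  by apply: addr_ge0 => //; apply: mulr_ge0; [|apply: mulr_ge0 => //];
     apply: mulr_ge0 => //; exact: ltW.
pose M := 6 * K / scale bt theta + Z / scale bt dl.
have M1 : 0 < 6 * K / scale bt theta by rewrite divr_gt0 // mulr_gt0.
have M2 : 0 <= Z / scale bt dl by rewrite divr_ge0 // ltW.
have M0 : 0 < M by rewrite ltr_pwDl.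
have ML : 6 * K <= M * scale bt theta.
  have -> : M * scale bt theta = 6 * K + Z / scale bt dl * scale bt theta.
    by rewrite /M; field; rewrite (gt_eqF T0) (gt_eqF S0).
  by rewrite lerDl mulr_ge0 // ltW.
have MZ : Z <= M * scale bt dl.
  have -> : M * scale bt dl = 6 * K / scale bt theta * scale bt dl + Z.
    by rewrite /M; field; rewrite (gt_eqF T0) (gt_eqF S0).
  by rewrite lerDr mulr_ge0 // ltW.
have [C hC] : exists C, forall x0, enorm x0 + dl <= r -> exists b A, [/\ A^T = A, \tr A = w x0
  & forall x, cball x0 dl x ->
      `|v x - quad x0 (v x0) b A x| <= C * scale bt (enorm (x - x0))].
  exists (limit_const (n := n) bt theta M) => x0 hr.
  apply: (second_order_expansion n_gt0 bt_gt0 K_gt0 v_sol w_hoelder t0 t2 tb dl0 hr M0 ML).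
  exists 0, 0, ((w x0 / n%:R)%:M); split.
  - exact: tr_scalar_mx.
  - by rewrite mxtrace_scalar -[LHS]mulr_natr divfK // pnatr_eq0 -lt0n.
  - move=> x hx; have [subc _] := subball hr.
    have Kx0 : cball 0 r x0 by apply: subc; rewrite /cball /= subrr enorm0 ltW.
    have h1 : `|w x0 / n%:R| <= `|W|.
      rewrite normrM normfV (ger0_norm (ler0n R n)).
      rewrite ler_pdivrMr ?ltr0n //; apply: (le_trans (w_bound Kx0)).
      by apply: (le_trans (ler_norm W)); rewrite ler_peMr // ler1n.
    have z0 : `|0 : R| <= 0 by rewrite normr0.
    have z1 i : `|(0 : E) 0 i| <= 0 by rewrite mxE normr0.
    have A1 i j : `|((w x0 / n%:R)%:M : 'M[R]_n) i j| <= `|W|.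
      by rewrite mxE; case: eqP => _; rewrite ?mulr1n // mulr0n normr0.
    have := quad_bound hx z0 z1 A1; rewrite mulr0 !add0r => h2.
    apply: le_trans MZ; apply: (le_trans (ler_normB _ _)); rewrite lerD //.
    exact: le_trans (v_bound (subc x hx)) (ler_norm V).
exists `|C| => // x0 hr; have [b [A [sA tA hA]]] := hC x0 hr.
exists b, A; split => // x hx; apply: (le_trans (hA x hx)).
by rewrite ler_wpM2r ?ler_norm // mulr_ge0 ?sqr_ge0 ?powR_ge0.
Qed.

End UniformExpansion.

Section ConverseTaylor.
Context {R : realType} {n : nat}.
Local Notation E := 'rV[R]_n.
Implicit Types (x y z : E) (f g u : E -> R).

Lemma derive_of_expansion f x e a : (forall eps, 0 < eps -> exists2 d, 0 < d &
    forall h, `|h| < d -> `|f (x + h *: e) - f x - h * a| <= eps * `|h|) ->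
  derivable f x e /\ 'D_e f x = a.
Proof.
move=> H; suff c : (fun h => h^-1 *: ((f \o shift x) (h *: e) - f x)) @ 0^' --> a.
  by split; [apply/cvg_ex; exists a|exact: cvg_lim].
apply/cvgrPdist_le => eps eps0; have [d d0 hd] := H eps eps0.
near=> h; have h0 : h != 0 by near: h; exact: nbhs_dnbhs_neq.
have hd' : `|h| < d by near: h; exact: dnbhs0_lt.
have hp : 0 < `|h| by rewrite normr_gt0.
have := hd h hd'; rewrite -ler_pdivrMr // -normfV -normrM /= distrC [x + _]addrC.
suff -> : (f (h *: e + x) - f x - h * a) / h = h^-1 *: (f (h *: e + x) - f x) - a by [].
by rewrite /GRing.scale /=; field.
Unshelve. all: by end_near. Qed.

Lemma hoelder_continuous f x (L d b : R) : 0 < b -> 0 < d ->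
  (forall y, enorm (y - x) < d -> `|f y - f x| <= L * enorm (y - x) `^ b) ->
  {for x, continuous f}.
Proof.
move=> b0 d0 H; apply/(@cvgrPdist_lt _ _ _ _ (fmap_filter _ (nbhs_filter x))) => e e0.
pose D := `|L| + 1; have D0 : 0 < D by rewrite ltr_wpDl.
have eD : 0 < e / D by rewrite divr_gt0.
have q0 : 0 < (e / D) `^ b^-1 by exact: powR_gt0.
apply/nbhs_enormP; exists (Num.min d ((e / D) `^ b^-1)); first by rewrite lt_min d0 q0.
move=> y; rewrite lt_min => /andP[yd yq] /=; rewrite distrC.
apply: (le_lt_trans (H y yd)).
have h1 : enorm (y - x) `^ b < e / D.
  have -> : e / D = ((e / D) `^ b^-1) `^ b.
    by rewrite -powRrM mulVf ?gt_eqF // powRr1 // ltW.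
  by apply: gt0_ltr_powR => //; rewrite nnegrE ?enorm_ge0 // ltW.
have p0 := powR_ge0 (enorm (y - x)) b.
have h2 := ler_wpM2r p0 (ler_norm L).
by move: h1; rewrite ltr_pdivlMr // /D; lra.
Qed.

Variables (s dl C bt : R) (v : E -> R) (b : E -> E) (A : E -> 'M[R]_n).
Hypotheses (dl_gt0 : 0 < dl) (C_ge0 : 0 <= C) (bt_gt0 : 0 < bt) (bt_lt1 : bt < 1).
Hypothesis A_sym : forall x, oball 0 s x -> (A x)^T = A x.
Hypothesis expansion : forall x, oball 0 s x -> forall y, cball x dl y ->
  `|v y - quad x (v x) (b x) (A x) y| <= C * scale bt (enorm (y - x)).

Lemma scale_double t : 0 <= t -> scale bt (2 * t) <= 8 * scale bt t.
Proof.
move=> t0; rewrite scaleM //; apply: ler_wpM2r; first by rewrite mulr_ge0 ?sqr_ge0 ?powR_ge0.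
have h : 2 `^ bt <= 2 :> R by apply: ler1_powR; [rewrite ler1n|exact: ltW].
have -> : 8 = 2 ^+ 2 * 2 :> R by rewrite -exprSr -natrX.
by rewrite /scale ler_wpM2l.
Qed.

(** Two expansions about nearby points agree, to the order of the remainder, on a
    ball whose radius is the distance of the points; so do their coefficients. *)
Lemma compare_expansions x y : oball 0 s x -> oball 0 s y -> enorm (y - x) <= dl / 2 ->
  (forall i, `|b y 0 i - b x 0 i - \sum_j (y - x) 0 j * A x i j|
     <= 9 * C * (enorm (y - x) * enorm (y - x) `^ bt)) /\
  (forall i j, `|A y i j - A x i j| <= 108 * C * enorm (y - x) `^ bt).
Proof.
move=> hx hy; set t := enorm (y - x) => hd.
have t0 : 0 <= t by exact: enorm_ge0.
have [t00|tn0] := eqVneq t 0.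
  have -> : y = x by apply/eqP; rewrite -subr_eq0; apply/eqP; exact: enorm_eq0.
  rewrite t00 powR0 ?gt_eqF // !mulr0; split=> [i|i j]; last by rewrite subrr normr0.
  have z : \sum_j (x - x) 0 j * A x i j = 0.
    by apply: big1 => j _; rewrite subrr mxE mul0r.
  by rewrite z !subrr normr0.
have tp : 0 < t by rewrite lt_def tn0.
pose c' := quad x (v x) (b x) (A x) y.
pose b' := b x + \row_i \sum_j (y - x) 0 j * A x i j.
have sA : (A y - A x)^T = A y - A x by rewrite linearB /= !A_sym.
have hq z : cball y t z -> `|quad y (v y - c') (b y - b') (A y - A x) z| <= 9 * C * scale bt t.
  move=> hz; rewrite quadB -(quad_recenter _ _ _ _ z (A_sym hx)).
  have zx : enorm (z - x) <= 2 * t.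
    by have := enorm_distD y z x; move: hz; rewrite /cball /= /t; lra.
  have h1 : `|v z - quad y (v y) (b y) (A y) z| <= C * scale bt (enorm (z - y)).
    by apply: expansion => //; move: hz dl_gt0; rewrite /cball /=; lra.
  have h2 : `|v z - quad x (v x) (b x) (A x) z| <= C * scale bt (enorm (z - x)).
    by apply: expansion => //; move: dl_gt0; rewrite /cball /=; lra.
  have h3 : scale bt (enorm (z - y)) <= scale bt t by apply: scale_le => //; exact: enorm_ge0.
  have h4 : scale bt (enorm (z - x)) <= scale bt (2 * t).
    by apply: scale_le => //; exact: enorm_ge0.
  have h5 := le_trans h4 (scale_double t0).
  have h6 := ler_wpM2l C_ge0 h3; have h7 := ler_wpM2l C_ge0 h5.
  rewrite -(subrKA (v z)); apply: (le_trans (ler_normD _ _)); rewrite distrC.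
  apply: (le_trans (lerD h1 h2)); apply: (le_trans (lerD h6 h7)).
  by rewrite le_eqVlt; apply/orP; left; apply/eqP; ring.
have [_ hb hA] := quad_coef_bound sA tp hq; split=> [i|i j].
- have := hb i; rewrite !mxE.
  have -> : 9 * C * scale bt t / t = 9 * C * (t * t `^ bt) by rewrite /scale; field.
  have -> // : b y 0 i - (b x 0 i + \sum_j (y - x) 0 j * A x i j) =
     b y 0 i - b x 0 i - \sum_j (y - x) 0 j * A x i j by rewrite opprD addrA.
- have := hA i j; rewrite !mxE.
  have -> // : 12 * (9 * C * scale bt t) / t ^+ 2 = 108 * C * t `^ bt.
  by rewrite /scale; field.
Qed.

Lemma oball_shift x : oball 0 s x -> exists2 d, 0 < d &
  [/\ d <= 1, d <= dl / 2 & forall y, enorm (y - x) < d -> oball 0 s y].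
Proof.
move=> hx; pose d := Num.min (Num.min 1 (dl / 2)) (s - enorm x).
have hx' : enorm x < s by move: hx; rewrite /oball /= subr0.
exists d; first by rewrite !lt_min ltr01 divr_gt0 //= subr_gt0.
split; rewrite ?ge_min ?lexx ?orbT //.
move=> y; rewrite lt_min => /andP[_ yd]; rewrite /oball /= subr0.
by have := enorm_triangle (y - x) x; rewrite subrK; lra.
Qed.

Lemma small_powR (D eps : R) : 0 <= D -> 0 < eps -> exists2 d, 0 < d &
  forall t, 0 <= t -> t < d -> D * t `^ bt <= eps.
Proof.
move=> D0 e0; have D1 : 0 < D + 1 by rewrite ltr_wpDl.
have q0 : 0 < eps / (D + 1) by rewrite divr_gt0.
exists ((eps / (D + 1)) `^ bt^-1); first exact: powR_gt0.
move=> t t0 td; have h : t `^ bt <= eps / (D + 1).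
  have -> : eps / (D + 1) = ((eps / (D + 1)) `^ bt^-1) `^ bt.
    by rewrite -powRrM mulVf ?gt_eqF // powRr1 // ltW.
  apply: ge0_ler_powR; rewrite ?nnegrE //; [exact: ltW|exact: powR_ge0|exact: ltW].
rewrite ler_pdivlMr // in h; have := powR_ge0 t bt; lra.
Qed.

(** The quadratic part and the remainder of the expansion are [o(h)]. *)
Lemma first_derivative x i : oball 0 s x ->
  derivable v x (delta_mx 0 i) /\ partial i v x = b x 0 i.
Proof.
move=> hx; apply: derive_of_expansion => eps e0.
have D0 : 0 <= `|A x i i| + C by rewrite addr_ge0.
have [d1 d10 hd1] := small_powR D0 e0.
exists (Num.min (Num.min 1 dl) d1); first by rewrite !lt_min ltr01 dl_gt0 d10.
move=> h; rewrite !lt_min => /andP[/andP[h1 hdl] hd].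
have hn : enorm (x + h *: delta_mx 0 i - x) = `|h|.
  by rewrite addrC addKr enormZ enorm_delta mulr1.
have := expansion hx (y := x + h *: delta_mx 0 i); rewrite /cball /= hn => /(_ (ltW hdl)).
rewrite quadE [x + _ - x]addrC addKr bilZl bilZr bil_delta dotZl dotC dot_delta.
move=> h2.
have hb : `|h| <= `|h| `^ bt.
  have [->|hn0] := eqVneq h 0; first by rewrite normr0 powR_ge0.
  by apply: ger1_powR; rewrite ?normr_gt0 ?hn0 ?ltW.
have h3 : `|h| * `|h| <= `|h| * `|h| `^ bt by rewrite ler_wpM2l.
have h4 : scale bt `|h| <= `|h| * `|h| `^ bt.
  by rewrite /scale ler_wpM2r ?powR_ge0 // expr2 ler_piMl // ltW.
have h5 : `|h * (h * A x i i) / 2| <= `|A x i i| * (`|h| * `|h| `^ bt).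
  rewrite !normrM [`|2^-1|]ger0_norm ?invr_ge0 //.
  have h6 := ler_wpM2l (normr_ge0 (A x i i)) h3.
  have h7 : 0 <= `|A x i i| * (`|h| * `|h|) by rewrite !mulr_ge0.
  by move: h6 h7; lra.
have h6 := hd1 `|h| (normr_ge0 h) hd.
have h7 := ler_wpM2r (normr_ge0 h) h6.
have h8 := ler_wpM2l C_ge0 h4.
have -> : v (x + h *: delta_mx 0 i) - v x - h * b x 0 i =
   (v (x + h *: delta_mx 0 i) - (v x + h * b x 0 i + h * (h * A x i i) / 2)) +
   h * (h * A x i i) / 2 by ring.
apply: (le_trans (ler_normD _ _)); lra.
Qed.

Lemma first_order_gap x y i : oball 0 s x -> oball 0 s y -> enorm (y - x) <= dl / 2 ->
  `|b y 0 i - b x 0 i - \sum_j (y - x) 0 j * A x i j|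
     <= 9 * C * (enorm (y - x) * enorm (y - x) `^ bt).
Proof. by move=> hx hy hd; case: (compare_expansions hx hy hd). Qed.

(** The linear coefficients satisfy a first-order expansion of their own, which
    [compare_expansions] provides. *)
Lemma second_derivative x i j : oball 0 s x ->
  derivable (partial i v) x (delta_mx 0 j) /\ partial j (partial i v) x = A x i j.
Proof.
move=> hx; apply: derive_of_expansion => eps e0.
have [d d0 [d1 d2 hd]] := oball_shift hx.
have C9 : 0 <= 9 * C by rewrite mulr_ge0.
have [d3 d30 hd3] := small_powR C9 e0.
exists (Num.min d d3); first by rewrite lt_min d0.
move=> h; rewrite lt_min => /andP[hd' h3].
pose y := x + h *: delta_mx 0 j.
have yx : y - x = h *: delta_mx 0 j by rewrite /y addrC addKr.
have hn : enorm (y - x) = `|h| by rewrite yx enormZ enorm_delta mulr1.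
have hy : oball 0 s y by apply: hd; rewrite hn.
have [_ ->] := first_derivative i hx; have [_ ->] := first_derivative i hy.
have := first_order_gap i hx hy; rewrite hn => /(_ (le_trans (ltW hd') d2)).
have -> : \sum_k (y - x) 0 k * A x i k = h * A x i j.
  rewrite yx (bigD1 j) //= [X in _ + X]big1 ?addr0; first by rewrite !mxE !eqxx mulr1.
  by move=> k /negPf kj; rewrite !mxE kj andbF mulr0 mul0r.
move/le_trans; apply; rewrite mulrCA mulrC ler_wpM2r //.
by apply: hd3.
Qed.

Lemma partial_continuous x i : oball 0 s x -> {for x, continuous (partial i v)}.
Proof.
move=> hx; have [d d0 [d1 d2 hd]] := oball_shift hx.
pose L := 9 * C + n%:R * 1 * \sum_k `|A x i k|.
apply: (@hoelder_continuous _ x L d bt bt_gt0 d0) => y yd.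
have hy := hd y yd; have [_ ->] := first_derivative i hx.
have [_ ->] := first_derivative i hy; set t := enorm (y - x) in yd *.
have t0 : 0 <= t := enorm_ge0 _.
have h1 := first_order_gap i hx hy (le_trans (ltW yd) d2); rewrite -/t in h1.
have tb : t <= t `^ bt.
  have [->|tn] := eqVneq t 0; first exact: powR_ge0.
  by apply: ger1_powR; rewrite ?lt_def ?tn ?t0 //= ?ltW // (lt_le_trans yd).
have h2 : `|\sum_k (y - x) 0 k * A x i k| <= n%:R * t * \sum_k `|A x i k|.
  apply: sum_bound => // k; rewrite (bigD1 k) //= lerDl.
  exact: sumr_ge0.
have S0 : 0 <= \sum_k `|A x i k| by exact: sumr_ge0.
have h3 : n%:R * t * \sum_k `|A x i k| <= n%:R * 1 * (\sum_k `|A x i k|) * t `^ bt.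
  rewrite mulr1 [leRHS]mulrAC ler_wpM2r // ler_wpM2l //.
have h4 : t * t `^ bt <= t `^ bt.
  by rewrite ler_piMl ?powR_ge0 // ltW // (lt_le_trans yd).
have h5 := ler_wpM2l (mulr_ge0 (ler0n R 9) C_ge0) h4.
have -> : b y 0 i - b x 0 i = (b y 0 i - b x 0 i - \sum_k (y - x) 0 k * A x i k) +
   \sum_k (y - x) 0 k * A x i k by rewrite subrK.
apply: (le_trans (ler_normD _ _)); rewrite /L mulrDl; lra.
Qed.

Lemma partial2_hoelder x y i j : oball 0 s x -> oball 0 s y -> enorm (x - y) <= dl / 2 ->
  `|partial j (partial i v) x - partial j (partial i v) y| <= 108 * C * enorm (x - y) `^ bt.
Proof.
move=> hx hy hd; have [_ ->] := second_derivative i j hx.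
have [_ ->] := second_derivative i j hy.
by have [_ h] := compare_expansions hy hx hd; exact: h.
Qed.

Lemma partial2_continuous x i j : oball 0 s x ->
  {for x, continuous (partial j (partial i v))}.
Proof.
move=> hx; have [d d0 [_ d2 hd]] := oball_shift hx.
apply: (@hoelder_continuous _ x (108 * C) d bt bt_gt0 d0) => y yd.
by apply: partial2_hoelder => //; [exact: hd|exact: le_trans (ltW yd) d2].
Qed.

(** The expansion at scale [dl] bounds its own coefficients by the values of [v]. *)
Lemma partial2_bound (V : R) x i j : (forall y, cball x dl y -> `|v y| <= V) ->
  oball 0 s x -> `|partial j (partial i v) x| <= 12 * (V + C * scale bt dl) / dl ^+ 2.
Proof.
move=> hV hx; have [_ ->] := second_derivative i j hx.
have [|_ _] := @quad_coef_bound _ _ x (v x) (b x) (A x) dl (V + C * scale bt dl) (A_sym hx) dl_gt0.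
  move=> y hy; have h1 := expansion hx hy; have h2 := hV y hy.
  have h3 : scale bt (enorm (y - x)) <= scale bt dl.
    by apply: scale_le => //; exact: enorm_ge0.
  have h4 := ler_wpM2l C_ge0 h3.
  have -> : quad x (v x) (b x) (A x) y = v y - (v y - quad x (v x) (b x) (A x) y).
    by rewrite opprB addrC subrK.
  by apply: (le_trans (ler_normB _ _)); lra.
exact.
Qed.

End ConverseTaylor.

(** * The Poisson problem with Hoelder right-hand side *)

Section PoissonProblem.
Context {R : realType} {n : nat}.
Local Notation E := 'rV[R]_n.
Implicit Types (x y z : E) (f g u v w : E -> R).
Hypothesis n_gt0 : (0 < n)%N.
Variables (r bt K : R).
Hypotheses (r_gt0 : 0 < r) (bt_gt0 : 0 < bt) (bt_lt1 : bt < 1) (K_gt0 : 0 < K).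

Lemma compact_in_smaller_ball (D : set E) : compact D -> D `<=` oball 0 r ->
  exists2 s, s < r & D `<=` oball 0 s.
Proof.
move=> cD sD; have [[x Dx]|D0] := pselect (D !=set0); last first.
  by exists (r / 2); [move: r_gt0; lra|move=> x Dx; exfalso; apply: D0; exists x].
have cn : {within D, continuous (fun x : E => enorm (x - 0))}.
  by apply: continuous_subspaceT => y; exact: enorm_continuous.
have [c cD' hc] := EVT_max_rV (ex_intro _ x Dx) cD cn.
have hcr : enorm (c - 0) < r by exact: sD (set_mem cD').
exists ((enorm (c - 0) + r) / 2); first lra.
move=> y Dy; rewrite /oball /=; apply: (le_lt_trans (hc y (mem_set Dy))); lra.
Qed.

Section Regularity.
Variables (v w : E -> R).
Hypothesis v_cont : {within cball 0 r, continuous v}.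
Hypothesis w_cont : {within cball 0 r, continuous w}.
Hypothesis v_sol : poisson_limit r w v.
Hypothesis w_hoelder : forall x y, cball 0 r x -> cball 0 r y ->
  `|w x - w y| <= K * enorm (x - y) `^ bt.

Lemma interior_regularity s : s < r -> exists L, [/\
  forall x i, oball 0 s x -> derivable v x (delta_mx 0 i) /\ {for x, continuous (partial i v)},
  forall x i j, oball 0 s x -> derivable (partial i v) x (delta_mx 0 j) /\
     {for x, continuous (partial j (partial i v))},
  forall x, oball 0 s x -> laplacian v x = w x
  & forall x y i j, oball 0 s x -> oball 0 s y ->
     `|partial j (partial i v) x - partial j (partial i v) y| <= L * enorm (x - y) `^ bt].
Proof.
move=> sr; pose dl := (r - s) / 2; have dl0 : 0 < dl by rewrite divr_gt0 // subr_gt0.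
have [V V0 hV] := compact_bounded_fun (@compact_cball R n 0 r) v_cont.
have [W W0 hW] := compact_bounded_fun (@compact_cball R n 0 r) w_cont.
have [C C0 hC] := uniform_expansion n_gt0 bt_gt0 bt_lt1 K_gt0 v_sol w_hoelder hV hW dl0.
have room x : oball 0 s x -> enorm x + dl <= r.
  by rewrite /oball /= subr0 /dl; lra.
have pt x : exists t : E * 'M[R]_n, oball 0 s x ->
    [/\ t.2^T = t.2, \tr t.2 = w x & forall y, cball x dl y ->
      `|v y - quad x (v x) t.1 t.2 y| <= C * scale bt (enorm (y - x))].
  have [hx|hx] := pselect (oball 0 s x); last by exists (0, 0).
  by have [b [A h]] := hC x (room x hx); exists (b, A).
have [t ht] := choice pt.
pose b x := (t x).1; pose A x := (t x).2.
have sA x : oball 0 s x -> (A x)^T = A x by move=> /ht[].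
have ex x : oball 0 s x -> forall y, cball x dl y ->
  `|v y - quad x (v x) (b x) (A x) y| <= C * scale bt (enorm (y - x)) by move=> /ht[].
pose B := 12 * (V + C * scale bt dl) / dl ^+ 2.
have q0 : 0 < (dl / 2) `^ bt by rewrite powR_gt0 // divr_gt0.
exists (108 * C + 2 * B / (dl / 2) `^ bt); split.
- move=> x i hx; split; last exact: (partial_continuous dl0 C0 bt_gt0 bt_lt1 sA ex).
  by have [] := first_derivative dl0 C0 bt_gt0 bt_lt1 ex i hx.
- move=> x i j hx; split; last exact: (partial2_continuous dl0 C0 bt_gt0 bt_lt1 sA ex).
  by have [] := second_derivative dl0 C0 bt_gt0 bt_lt1 sA ex i j hx.
- move=> x hx; have [_ <- _] := ht x hx; apply: eq_bigr => i _.
  by have [_ ->] := second_derivative dl0 C0 bt_gt0 bt_lt1 sA ex i i hx.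
- move=> x y i j hx hy.
  have p0 := powR_ge0 (enorm (x - y)) bt.
  have bound z : oball 0 s z -> `|partial j (partial i v) z| <= B.
    move=> hz; apply: (partial2_bound dl0 C0 bt_gt0 bt_lt1 sA ex) => // u.
    by have [subc _] := subball (room z hz) => /subc; exact: hV.
  have B0 : 0 <= B := le_trans (normr_ge0 _) (bound x hx).
  have [xy|xy] := leP (enorm (x - y)) (dl / 2).
    have := partial2_hoelder dl0 C0 bt_gt0 bt_lt1 sA ex i j hx hy xy.
    move/le_trans; apply; rewrite ler_wpM2r // lerDl.
    by apply: divr_ge0; [exact: mulr_ge0|exact: ltW].
  apply: (@le_trans _ _ (2 * B)).
    apply: (le_trans (ler_normB _ _)); rewrite [leRHS]mulr_natl mulr2n.
    exact: lerD (bound x hx) (bound y hy).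
  have h1 : (dl / 2) `^ bt <= enorm (x - y) `^ bt.
    by apply: ge0_ler_powR; rewrite ?nnegrE ?enorm_ge0 // ltW // divr_gt0.
  have h2 : 2 * B <= 2 * B / (dl / 2) `^ bt * enorm (x - y) `^ bt.
    rewrite -{1}(divfK (lt0r_neq0 q0) (2 * B)) ler_wpM2l //.
    by apply: divr_ge0; [exact: mulr_ge0|exact: ltW].
  by apply: (le_trans h2); rewrite ler_wpM2r // lerDr mulr_ge0.
Qed.

Lemma eballE : eball r = oball 0 r :> set E.
Proof. by apply/seteqP; split => x /=; rewrite /oball /eball /= subr0. Qed.

Lemma eball_smaller x : eball r x -> exists2 s, s < r & oball 0 s x.
Proof.
rewrite /eball /= => hx; exists ((enorm x + r) / 2); first lra.
by rewrite /oball /= subr0; lra.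
Qed.

Lemma v_continuous x : eball r x -> {for x, continuous v}.
Proof.
rewrite eballE => hx; have /within_continuousE cv := v_cont.
apply/(@cvgrPdist_lt _ _ _ _ (fmap_filter _ (nbhs_filter x))) => e e0.
have [d d0 hd] := cv x (oball_sub hx) e e0.
apply/nbhs_enormP; exists (Num.min d (r - enorm x)).
  by rewrite lt_min d0 subr_gt0; move: hx; rewrite /oball /= subr0.
move=> y; rewrite lt_min => /andP[yd yr] /=; rewrite distrC; apply: hd => //.
rewrite /cball /= subr0; have := enorm_triangle (y - x) x; rewrite subrK; lra.
Qed.

Lemma solution_laplacian x : eball r x -> laplacian v x = w x.
Proof.
by move=> /eball_smaller[s sr hx]; have [L [_ _ h _]] := interior_regularity sr; exact: h.
Qed.

Lemma solution_C2 : Ck 2 (eball r) v.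
Proof.
split=> [[|i [|k l]] j x //= _ hx|[|i [|j [|k l]]] x //= _ hx].
- have [s sr xs] := eball_smaller hx; have [L [h _ _ _]] := interior_regularity sr.
  by have [] := h x j xs.
- have [s sr xs] := eball_smaller hx; have [L [_ h _ _]] := interior_regularity sr.
  by have [] := h x i j xs.
- exact: v_continuous.
- have [s sr xs] := eball_smaller hx; have [L [h _ _ _]] := interior_regularity sr.
  by have [] := h x i xs.
- have [s sr xs] := eball_smaller hx; have [L [_ h _ _]] := interior_regularity sr.
  by have [] := h x j i xs.
Qed.

Lemma solution_C2hoelder : Ckhoelder 2 bt (eball r) v.
Proof.
split; first exact: solution_C2.
move=> [|i [|j [|k l]]] // _ D cD; rewrite eballE => sD.
have [s sr Ds] := compact_in_smaller_ball cD sD.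
have [L [_ _ _ h]] := interior_regularity sr; exists L => x y Dx Dy.
by apply: h; exact: Ds.
Qed.

End Regularity.

Theorem poisson_hoelder w g :
  {within ceball r, continuous w} -> {within ceball r, continuous g} ->
  (forall x y, ceball r x -> ceball r y -> `|w x - w y| <= K * enorm (x - y) `^ bt) ->
  exists v, [/\ {within ceball r, continuous v}, Ckhoelder 2 bt (eball r) v,
    forall x, eball r x -> laplacian v x = w x
  & forall x, esphere r x -> v x = g x].
Proof.
rewrite ceballE => cw cg hw.
have [v [cv bv sv]] := poisson_limit_exists n_gt0 r_gt0 cw cg.
exists v; split => //.
- exact: solution_C2hoelder cv cw sv hw.
- exact: solution_laplacian cv cw sv hw.
Qed.

End PoissonProblem.

(** * The eikonal equation *)

Section Eikonal.
Context {R : realType} {n : nat}.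
Local Notation E := 'rV[R]_n.
Implicit Types (x y z p q : E) (u v w : E -> R).
Hypothesis n_gt0 : (0 < n)%N.
Variables (r : R) (h : E -> R).
Hypothesis r_gt0 : 0 < r.
Hypothesis h_cont : {within cball 0 r, continuous h}.
Hypothesis h_ge0 : forall x, cball 0 r x -> 0 <= h x.

(** The viscosity inequality [|Du| <= h] in integrated form along segments. *)
Definition eikonal_sub u : Prop := (forall x, enorm x = r -> u x <= 0) /\
  forall x y m, cball 0 r x -> cball 0 r y ->
    (forall a, 0 <= a <= 1 -> h (x + a *: (y - x)) <= m) -> u x - u y <= m * enorm (y - x).

Definition eikonal_sol : E -> R := fun x => sup [set u x | u in eikonal_sub].

Lemma eikonal_sub0 : eikonal_sub (fun=> 0).
Proof.
split=> // x y m hx hy hm; rewrite subrr mulr_ge0 ?enorm_ge0 //.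
have := hm 0; rewrite lexx ler01 scale0r addr0 => /(_ isT); exact: le_trans (h_ge0 hx).
Qed.

Lemma h_bounded : exists2 M, 0 <= M & forall x, cball 0 r x -> h x <= M.
Proof.
have [M M0 hM] := compact_bounded_fun (@compact_cball R n 0 r) h_cont.
by exists M => // x hx; exact: le_trans (ler_norm _) (hM x hx).
Qed.

Lemma eikonal_sub_lipschitz u M : (forall x, cball 0 r x -> h x <= M) -> eikonal_sub u ->
  forall x y, cball 0 r x -> cball 0 r y -> u x - u y <= M * enorm (y - x).
Proof.
move=> hM [_ hu] x y hx hy; apply: hu => // a a01; apply: hM; exact: cball_convex.
Qed.

(** Follow the segment to a point of the sphere. *)
Lemma eikonal_sub_bounded x : cball 0 r x -> has_sup [set u x | u in eikonal_sub].
Proof.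
move=> hx; split; first by exists 0, (fun=> 0) => //; exact: eikonal_sub0.
have [M M0 hM] := h_bounded.
pose p : E := r *: delta_mx 0 (Ordinal n_gt0).
have pr : enorm p = r by rewrite enormZ enorm_delta mulr1 gtr0_norm.
have Bp : cball 0 r p by rewrite /cball /= subr0 pr.
exists (M * enorm (p - x)) => _ [u su <-].
have := eikonal_sub_lipschitz hM su hx Bp; have := su.1 p pr; lra.
Qed.

Lemma eikonal_sol_ge u x : cball 0 r x -> eikonal_sub u -> u x <= eikonal_sol x.
Proof.
move=> hx su; have [_ bs] := eikonal_sub_bounded hx.
by apply: ub_le_sup => //; exists u.
Qed.

Lemma eikonal_sol_le x c : (forall u, eikonal_sub u -> u x <= c) -> eikonal_sol x <= c.
Proof.
move=> H; apply: ge_sup; first by exists 0, (fun=> 0) => //; exact: eikonal_sub0.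
by move=> _ [u su <-]; exact: H.
Qed.

Lemma eikonal_sol_sub : eikonal_sub eikonal_sol.
Proof.
split=> [x xr|x y m hx hy hm]; first by apply: eikonal_sol_le => u [h0 _]; exact: h0.
rewrite lerBlDr; apply: eikonal_sol_le => u su.
have := eikonal_sol_ge hy su; have := su.2 x y m hx hy hm; lra.
Qed.

Lemma eikonal_sol_ge0 x : cball 0 r x -> 0 <= eikonal_sol x.
Proof. by move=> hx; exact: eikonal_sol_ge hx eikonal_sub0. Qed.

Lemma eikonal_sol_boundary x : enorm x = r -> eikonal_sol x = 0.
Proof.
move=> xr; apply: le_anti; rewrite eikonal_sol_sub.1 //= eikonal_sol_ge0 //.
by rewrite /cball /= subr0 xr.
Qed.

Lemma eikonal_sol_lipschitz : exists2 M, 0 <= M & forall x y, cball 0 r x -> cball 0 r y ->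
  `|eikonal_sol x - eikonal_sol y| <= M * enorm (x - y).
Proof.
have [M M0 hM] := h_bounded; exists M => // x y hx hy.
have h1 := eikonal_sub_lipschitz hM eikonal_sol_sub hx hy.
have h2 := eikonal_sub_lipschitz hM eikonal_sol_sub hy hx.
rewrite (enormB y x) in h1; rewrite ler_norml; apply/andP; split; lra.
Qed.

Lemma ball_room x : enorm x < r -> exists2 d, 0 < d & forall y, enorm (y - x) <= d -> enorm y < r.
Proof.
move=> xr; exists ((r - enorm x) / 2); first by rewrite divr_gt0 // subr_gt0.
by move=> y yd; have := enorm_triangle (y - x) x; rewrite subrK; lra.
Qed.

Lemma h_near x e : enorm x < r -> 0 < e -> exists2 d, 0 < d & forall y, enorm (y - x) <= d ->
  enorm y < r /\ `|h y - h x| < e.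
Proof.
move=> xr e0; have [d d0 hd] := ball_room xr.
have Bx : cball 0 r x by rewrite /cball /= subr0 ltW.
have /within_continuousE hc := h_cont; have [t t0 ht] := hc x Bx e e0.
exists (Num.min d (t / 2)); first by rewrite lt_min d0 divr_gt0.
move=> y; rewrite le_min => /andP[yd yt]; have yr := hd y yd; split => //.
by apply: ht; [rewrite /cball /= subr0 ltW|lra].
Qed.

(** Moving from [x] against [q] decreases a function with slope [q] by
    [|q| |x - y|], while the solution loses at most [h |x - y|]. *)
Lemma eikonal_superdifferential x q : enorm x < r ->
  (forall e, 0 < e -> exists2 d, 0 < d & forall y, enorm (y - x) < d ->
     eikonal_sol y <= eikonal_sol x + dot q (y - x) + e * enorm (y - x)) ->
  enorm q <= h x.
Proof.
move=> xr H; rewrite leNgt; apply/negP => hq.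
pose e := (enorm q - h x) / 3; have e0 : 0 < e by rewrite divr_gt0 // subr_gt0.
have [d d0 hd] := H e e0; have [t t0 ht] := h_near xr e0.
have Bx : cball 0 r x by rewrite /cball /= subr0 ltW.
have q0 : 0 < enorm q by exact: le_lt_trans (h_ge0 Bx) hq.
pose k := Num.min (d / 2) t / enorm q.
have k0 : 0 < k by rewrite divr_gt0 // lt_min t0 divr_gt0.
have kq : k * enorm q = Num.min (d / 2) t by rewrite divfK // gt_eqF.
pose y := x - k *: q.
have yx : y - x = - (k *: q) by rewrite /y addrC addKr.
have dyx : enorm (y - x) = k * enorm q by rewrite yx enormN enormZ gtr0_norm.
have kt : k * enorm q <= t by rewrite kq ge_min lexx orbT.
have kd : k * enorm q < d.
  by rewrite kq; apply: (@le_lt_trans _ _ (d / 2)); [rewrite ge_min lexx|lra].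
have [yr _] : enorm y < r /\ `|h y - h x| < e by apply: ht; rewrite dyx.
have By : cball 0 r y by rewrite /cball /= subr0 ltW.
have seg a : 0 <= a <= 1 -> h (x + a *: (y - x)) <= h x + e.
  move=> /andP[a0 a1]; have [_] : enorm (x + a *: (y - x)) < r /\
      `|h (x + a *: (y - x)) - h x| < e.
    apply: ht; rewrite addrC addKr enormZ ger0_norm // dyx.
    by apply: le_trans kt; rewrite ler_piMl // mulr_ge0 ?enorm_ge0 // ltW.
  by rewrite ltr_norml => /andP[_]; lra.
have h1 := eikonal_sol_sub.2 x y _ Bx By seg.
have := hd y; rewrite dyx => /(_ kd).
have -> : dot q (y - x) = - (k * enorm q * enorm q).
  by rewrite yx dotNr dotZr -enorm_sqr expr2 mulrA.
rewrite dyx in h1 => h2; have kp : 0 < k * enorm q by exact: mulr_gt0.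
have : k * enorm q * enorm q <= k * enorm q * (h x + e + e) by lra.
by rewrite ler_pM2l // /e; lra.
Qed.

Lemma sphere_crossing x y z rho : enorm (y - x) <= rho -> rho <= enorm (z - x) ->
  exists2 a, 0 <= a <= 1 & enorm (y + a *: (z - y) - x) = rho.
Proof.
move=> hy hz; pose g (a : R) := enorm (y + a *: (z - y) - x).
have cg : continuous g.
  move=> a; apply/cvgrPdist_le => e e0.
  pose D := enorm (z - y) + 1; have D0 : 0 < D by rewrite ltr_wpDl ?enorm_ge0.
  near=> b; have ab : `|a - b| <= e / D.
    by near: b; apply: cvgr_dist_le; [exact: cvg_id|rewrite divr_gt0].
  have lip c d : g c - g d <= `|c - d| * enorm (z - y).
    rewrite /g; have := enorm_distD (y + d *: (z - y)) (y + c *: (z - y)) x.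
    have -> : y + c *: (z - y) - (y + d *: (z - y)) = (c - d) *: (z - y).
      by rewrite opprD addrACA subrr add0r scalerBl.
    by rewrite enormZ; lra.
  have h1 := lip a b; have h2 := lip b a; rewrite (distrC b a) in h2.
  have h3 : `|a - b| * enorm (z - y) <= e.
    rewrite ler_pdivlMr // in ab; apply: le_trans ab.
    by rewrite ler_wpM2l // /D lerDl.
  by rewrite ler_norml; apply/andP; split; lra.
have g0 : g 0 = enorm (y - x) by rewrite /g scale0r addr0.
have g1 : g 1 = enorm (z - x) by rewrite /g scale1r [y + _]addrC subrK.
have [a a01 ga] : exists2 a, a \in `[0, 1]%R & g a = rho.
  apply: IVT => //; first by apply: continuous_subspaceT.
  by rewrite g0 g1 ge_min le_max hy hz orbT.
by exists a => //; move: a01; rewrite in_itv.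
Unshelve. all: by end_near. Qed.

(** Perron's argument: were the slope [q] smaller than [h x], the cone [cone] over
    [x] with slope between the two could be glued to the solution, producing a
    larger subsolution. *)
Lemma eikonal_subdifferential x q : enorm x < r ->
  (forall e, 0 < e -> exists2 d, 0 < d & forall y, enorm (y - x) < d ->
     eikonal_sol x + dot q (y - x) - e * enorm (y - x) <= eikonal_sol y) ->
  h x <= enorm q.
Proof.
move=> xr H; rewrite leNgt; apply/negP => hq.
(* A quarter of the gap is left to the oscillation of [h], two quarters steepen the
   cone. *)
pose e := (h x - enorm q) / 4; have e0 : 0 < e by rewrite divr_gt0 // subr_gt0.
have [d d0 hd] := H e e0; have [t t0 ht] := h_near xr e0.
pose rho := Num.min (d / 2) t.
have rho0 : 0 < rho by rewrite lt_min t0 divr_gt0.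
have rhod : rho < d by apply: (@le_lt_trans _ _ (d / 2)); [rewrite ge_min lexx|lra].
have rhot : rho <= t by rewrite ge_min lexx orbT.
have Bx : cball 0 r x by rewrite /cball /= subr0 ltW.
pose cone y := eikonal_sol x + dot q (y - x) - 2 * e * enorm (y - x) + e * rho / 2.
pose glued y := if enorm (y - x) <= rho then Num.max (eikonal_sol y) (cone y)
                else eikonal_sol y.
have cone_low y : rho / 2 <= enorm (y - x) -> enorm (y - x) <= rho -> cone y <= eikonal_sol y.
  move=> h1 h2; have := hd y (le_lt_trans h2 rhod); rewrite /cone.
  by have := ler_wpM2l (ltW e0) h1; lra.
have cone_lip y z : cone y - cone z <= (enorm q + 2 * e) * enorm (z - y).
  have h1 : dot q (y - x) - dot q (z - x) <= enorm q * enorm (z - y).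
    have -> : dot q (y - x) - dot q (z - x) = dot q (y - z).
      by rewrite !dotDr !dotNr; ring.
    rewrite (enormB z y).
    exact: le_trans (ler_norm _) (cauchy_schwarz _ _).
  have h2 : enorm (z - x) <= enorm (z - y) + enorm (y - x) by exact: enorm_distD.
  by have := ler_wpM2l (ltW e0) h2; rewrite /cone; lra.
have glued_ge y : eikonal_sol y <= glued y.
  by rewrite /glued; case: ifP => // _; rewrite le_max lexx.
have glued_sub : eikonal_sub glued.
  split=> [y yr|y z m By Bz hm].
    rewrite /glued ifF ?eikonal_sol_sub.1 //; apply/negbTE/negP => hy.
    by have [] := ht y (le_trans hy rhot); rewrite yr ltxx.
  have sol_case : eikonal_sol y - glued z <= m * enorm (z - y).
    by have := eikonal_sol_sub.2 y z m By Bz hm; have := glued_ge z; lra.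
  rewrite {1}/glued; case: ifPn => // hy; case: (leP (cone y) (eikonal_sol y)) => // hcone.
  have hm0 : enorm q + 2 * e <= m.
    have := hm 0; rewrite lexx ler01 scale0r addr0 => /(_ isT).
    have [_] := ht y (le_trans hy rhot); rewrite ltr_norml => /andP[h1 _].
    by rewrite /e in h1 *; lra.
  have [hz|hz] := leP (enorm (z - x)) rho.
    have h1 : cone z <= glued z by rewrite /glued hz le_max lexx orbT.
    have := cone_lip y z; have := ler_wpM2r (enorm_ge0 (z - y)) hm0; lra.
  have [a a01 ha] := sphere_crossing hy (ltW hz).
  pose p := y + a *: (z - y); have /andP[a0 a1] := a01.
  have Bp : cball 0 r p by exact: cball_convex.
  have h1 : cone p <= eikonal_sol p by apply: cone_low; rewrite /p ha //; lra.
  have zp : z - p = (1 - a) *: (z - y) by rewrite /p scalerBl scale1r opprD addrA.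
  have h2 : eikonal_sol p - eikonal_sol z <= m * enorm (z - p).
    apply: eikonal_sol_sub.2 => // b /andP[b0 b1].
    have -> : p + b *: (z - p) = y + (a + b * (1 - a)) *: (z - y).
      by rewrite zp /p scalerA -addrA -scalerDl.
    apply: hm; rewrite addr_ge0 ?mulr_ge0 ?subr_ge0 //=.
    have : b * (1 - a) <= 1 * (1 - a) by rewrite ler_wpM2r // subr_ge0.
    lra.
  have h3 := cone_lip y p.
  have dp : enorm (p - y) = a * enorm (z - y) by rewrite /p addrC addKr enormZ ger0_norm.
  have dzp : enorm (z - p) = (1 - a) * enorm (z - y).
    by rewrite zp enormZ ger0_norm // subr_ge0.
  have gz : glued z = eikonal_sol z by rewrite /glued leNgt hz.
  rewrite dzp in h2; rewrite dp in h3; rewrite gz.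
  have h4 : (enorm q + 2 * e) * (a * enorm (z - y)) <= m * (a * enorm (z - y)).
    by rewrite ler_wpM2r // mulr_ge0 ?enorm_ge0.
  lra.
have := eikonal_sol_ge Bx glued_sub.
rewrite /glued subrr enorm0 (ltW rho0) ge_max => /andP[_].
rewrite /cone subrr enorm0 mulr0 dotC dot0l addr0 subr0.
by have := mulr_gt0 e0 rho0; lra.
Qed.

End Eikonal.

(** * First-order expansion of test functions *)

Section TestFunctions.
Context {R : realType}.

Lemma derive_expansion (V : normedModType R) (f : V -> R) x e : derivable f x e ->
  forall eps, 0 < eps -> exists2 d, 0 < d &
    forall t, `|t| < d -> `|f (x + t *: e) - f x - t * 'D_e f x| <= eps * `|t|.
Proof.
move=> df eps eps0; have /cvgrPdist_le /(_ eps eps0) := df.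
move=> [d /= d0 hd]; exists d => // t td.
have [->|t0] := eqVneq t 0.
  by rewrite scale0r addr0 subrr mul0r subrr !normr0 mulr0.
have := hd t; rewrite /= sub0r normrN => /(_ td t0).
have tp : 0 < `|t| by rewrite normr_gt0.
rewrite -(ler_pM2r tp) -normrM distrC mulrBl -/('D_e f x).
have -> : (t^-1 *: (f (t *: e + x) - f x)) * t = f (x + t *: e) - f x.
  by rewrite [t *: e + x]addrC /GRing.scale /= mulrC mulrA mulfV // mul1r.
by rewrite [_ * t]mulrC.
Qed.

Lemma mvt_dist (g g' : R -> R) (c m : R) :
  (forall t : R, `|t| <= `|c| -> is_derive t 1 g (g' t) /\ `|g' t| <= m) ->
  `|g c - g 0| <= m * `|c|.
Proof.
move=> H; have [c0|c0] := leP 0 c.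
- have le_c (t : R) : 0 <= t -> t <= c -> `|t| <= `|c| by move=> t0 tc; rewrite !ger0_norm.
  have cg : {within `[0, c], continuous g}.
    apply: derivable_within_continuous => t; rewrite in_itv /= => /andP[t0 tc].
    by have [[]] := H t (le_c t t0 tc).
  have dg (t : R) : t \in `]0, c[%R -> is_derive t 1 g (g' t).
    rewrite in_itv /= => /andP[t0 tc].
    by have [] := H t (le_c t (ltW t0) (ltW tc)).
  have [t] := MVT_segment c0 dg cg; rewrite in_itv /= => /andP[t0 tc] ->.
  rewrite subr0 normrM ler_wpM2r //.
  by have [] := H t (le_c t t0 tc).
- have le_c (t : R) : c <= t -> t <= 0 -> `|t| <= `|c|.
    by move=> tc t0; rewrite !ler0_norm ?lerN2 // ltW.
  have cg : {within `[c, 0], continuous g}.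
    apply: derivable_within_continuous => t; rewrite in_itv /= => /andP[tc t0].
    by have [[]] := H t (le_c t tc t0).
  have dg (t : R) : t \in `]c, 0[%R -> is_derive t 1 g (g' t).
    rewrite in_itv /= => /andP[tc t0].
    by have [] := H t (le_c t (ltW tc) (ltW t0)).
  have [t] := MVT_segment (ltW c0) dg cg; rewrite in_itv /= => /andP[tc t0] e.
  rewrite -normrN opprB e sub0r normrM normrN ler_wpM2r //.
  by have [] := H t (le_c t tc t0).
Qed.

Context {n : nat}.
Local Notation E := 'rV[R]_n.

(** A path from [x] to [y] that changes one coordinate at a time. *)
Definition hybrid (x y : E) (k : nat) : E :=
  \row_(j < n) (if (j < k)%N then y 0 j else x 0 j).

Lemma hybrid0 (x y : E) : hybrid x y 0 = x.
Proof. by apply/rowP => j; rewrite mxE. Qed.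

Lemma hybridn (x y : E) : hybrid x y n = y.
Proof. by apply/rowP => j; rewrite mxE ltn_ord. Qed.

Lemma hybridS (x y : E) (k : 'I_n) :
  hybrid x y k.+1 = hybrid x y k + (y 0 k - x 0 k) *: delta_mx 0 k.
Proof.
apply/rowP => j; rewrite !mxE eqxx /= ltnS leq_eqVlt.
have [->|jk] := eqVneq j k; first by rewrite eqxx ltnn mulr1 addrC subrK.
by rewrite -(inj_eq val_inj) in jk; rewrite (negPf jk) mulr0 addr0.
Qed.

Lemma hybrid_dist (x y : E) (k : 'I_n) t : `|t| <= `|y 0 k - x 0 k| ->
  enorm (hybrid x y k + t *: delta_mx 0 k - x) <= enorm (y - x).
Proof.
move=> ht; apply: ler_wsqrtr; apply: ler_sum => j _; rewrite !mxE eqxx /=.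
have [->|jk] := eqVneq j k.
  rewrite ltnn mulr1 addrC addKr -(real_normK (num_real t)).
  by rewrite -[leRHS](real_normK (num_real _)) lerXn2r ?nnegrE.
rewrite mulr0 addr0; case: ifP => // _.
by rewrite subrr expr0n sqr_ge0.
Qed.

(** Continuous partial derivatives give differentiability: apply the mean value
    theorem on each edge of the path of hybrid points. *)
Lemma C1_expansion r (phi : E -> R) x : Ck 1 (eball r) phi -> eball r x ->
  forall e, 0 < e -> exists2 d, 0 < d & forall y, enorm (y - x) < d ->
    `|phi y - phi x - dot (gradient phi x) (y - x)| <= e * enorm (y - x).
Proof.
move=> [dphi cphi] hx e e0; pose e1 := e / n.+1%:R; have e10 : 0 < e1 by rewrite divr_gt0.
have [d0 d00 hd0] := ball_room hx.
have near_k (k : 'I_n) : exists d : R, 0 < d /\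
    forall y, enorm (y - x) < d -> `|partial k phi y - partial k phi x| <= e1.
  have := cphi [:: k] x erefl hx.
  move=> /(@cvgrPdist_le _ _ _ _ (fmap_filter _ (nbhs_filter x))) /(_ e1 e10).
  move=> /nbhs_enormP[d dpos hd]; exists d; split => // y yd.
  by rewrite distrC; exact: hd.
have [d hd] := choice near_k.
pose dm := \big[Num.min/d0]_(k < n) d k.
have dm0 : 0 < dm by apply: lt_bigmin => // k _; case: (hd k).
exists dm => // y yd.
have step (k : 'I_n) : `|phi (hybrid x y k.+1) - phi (hybrid x y k) -
    gradient phi x 0 k * (y - x) 0 k| <= e1 * enorm (y - x).
  set c := y 0 k - x 0 k.
  pose g t := phi (hybrid x y k + t *: delta_mx 0 k) - t * partial k phi x.
  have := @mvt_dist g (fun t => partial k phi (hybrid x y k + t *: delta_mx 0 k)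
     - partial k phi x) c e1 _.
  rewrite /g scale0r addr0 mul0r subr0 -hybridS => h1.
  have -> : phi (hybrid x y k.+1) - phi (hybrid x y k) - gradient phi x 0 k * (y - x) 0 k
    = phi (hybrid x y k.+1) - c * partial k phi x - phi (hybrid x y k).
    have -> : (y - x) 0 k = c by rewrite !mxE.
    by rewrite [gradient _ _ _ _]mxE; ring.
  apply: (@le_trans _ _ (e1 * `|c|)); last first.
    apply: ler_wpM2l; first exact: ltW.
    by have := coord_le_enorm (y - x) k; rewrite !mxE.
  apply: h1 => t tc; pose p := hybrid x y k + t *: delta_mx 0 k.
  have px : enorm (p - x) < dm by apply: le_lt_trans yd; exact: hybrid_dist.
  have pr : eball r p.
    by apply: hd0; apply: ltW; apply: (lt_le_trans px); exact: bigmin_le_id.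
  split; last first.
    apply: (hd k).2; apply: (lt_le_trans px); exact: bigmin_le_cond.
  have dp : is_derive t 1 (fun t => phi (hybrid x y k + t *: delta_mx 0 k)) (partial k phi p).
    have e2 : (fun s => s^-1 *: (((fun t => phi (hybrid x y k + t *: delta_mx 0 k)) \o shift t)
          (s *: 1) - phi p)) =
       (fun s => s^-1 *: ((phi \o shift p) (s *: delta_mx 0 k) - phi p)).
      apply/funext => s /=; congr (_ *: (phi _ - _)).
      by rewrite scalerDl addrCA /GRing.scale /= mulr1.
    split; rewrite /derivable /derive e2; first exact: (dphi [::] k p erefl pr).
    by [].
  have dl : is_derive t 1 (fun t => t * partial k phi x) (partial k phi x).
    apply: (is_derive_eq (is_deriveM (is_derive_id t 1)
      (is_derive_cst (partial k phi x) t 1))).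
    by rewrite scaler0 add0r /GRing.scale /= mulr1.
  exact: is_deriveB dp dl.
have -> : phi y - phi x - dot (gradient phi x) (y - x) =
   \sum_(k < n) (phi (hybrid x y k.+1) - phi (hybrid x y k) -
    gradient phi x 0 k * (y - x) 0 k).
  rewrite sumrB; congr (_ - _).
  rewrite -(big_mkord xpredT (fun k => phi (hybrid x y k.+1) - phi (hybrid x y k))).
  by rewrite telescope_sumr // hybridn hybrid0.
apply: (le_trans (ler_norm_sum _ _ _)).
apply: (@le_trans _ _ (\sum_(k < n) e1 * enorm (y - x))); first exact: ler_sum.
rewrite sumr_const card_ord -[leLHS]mulr_natl mulrA ler_wpM2r ?enorm_ge0 //.
by rewrite /e1 mulrCA ler_piMr ?(ltW e0) // ler_pdivrMr ?mul1r ?ler_nat.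
Qed.

(** Transports a test function [phi] of [w] at [x], with [w x = s0], to a test
    function of [F w]. *)
Lemma chain_expansion r (phi : E -> R) x (F : R -> R) (s0 c : R) :
  Ck 1 (eball r) phi -> eball r x -> 0 < s0 -> is_derive s0 1 F c ->
  forall e, 0 < e -> exists2 d, 0 < d & forall y, enorm (y - x) < d ->
    0 <= s0 + (phi y - phi x) /\
    `|F (s0 + (phi y - phi x)) - F s0 - dot (c *: gradient phi x) (y - x)| <= e * enorm (y - x).
Proof.
move=> hphi hx s00 [dF Fc] e e0; set q := gradient phi x.
pose e1 := e / (2 * (`|c| + 1)); have c1 : 0 < `|c| + 1 by rewrite ltr_wpDl.
have e10 : 0 < e1 by rewrite divr_gt0 // mulr_gt0.
pose Q := enorm q + e1; have Q0 : 0 < Q by rewrite ltr_wpDl ?enorm_ge0.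
pose e2 := e / (2 * Q); have e20 : 0 < e2 by rewrite divr_gt0 // mulr_gt0.
have [d1 d10 hd1] := C1_expansion hphi hx e10.
have [d2 d20 hd2] := derive_expansion dF e20.
have m0 : 0 < Num.min d2 s0 by rewrite lt_min d20.
exists (Num.min d1 (Num.min d2 s0 / Q)); first by rewrite lt_min d10 divr_gt0.
move=> y; rewrite lt_min ltr_pdivlMr // => /andP[y1 y2].
have := hd1 y y1; rewrite -/q; set dlt := phi y - phi x; set a := dot q (y - x) => h1.
have a1 : `|a| <= enorm q * enorm (y - x) by exact: cauchy_schwarz.
have hdl : `|dlt| <= Q * enorm (y - x).
  have -> : dlt = (dlt - a) + a by rewrite subrK.
  by apply: (le_trans (ler_normD _ _)); rewrite /Q mulrDl addrC lerD.
have hdm : `|dlt| < Num.min d2 s0 by apply: le_lt_trans hdl _; rewrite mulrC.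
have [hdd hds] : `|dlt| < d2 /\ `|dlt| < s0 by apply/andP; rewrite -lt_min.
split; first by move: hds; rewrite ltr_norml => /andP[h2 _]; lra.
have := hd2 dlt hdd; rewrite Fc /GRing.scale /= mulr1 => h2.
have -> : F (s0 + dlt) - F s0 - dot (c *: q) (y - x) =
  (F (s0 + dlt) - F s0 - dlt * c) + c * (dlt - a) by rewrite dotZl -/a; ring.
apply: (le_trans (ler_normD _ _)); rewrite normrM.
have t0 := enorm_ge0 (y - x); set t := enorm (y - x) in t0 h1 a1 hdl *.
have h3 : e2 * `|dlt| <= e / 2 * t.
  have := ler_wpM2l (ltW e20) hdl.
  have -> : e2 * (Q * t) = e / 2 * t by rewrite /e2; field; rewrite gt_eqF.
  by [].
have h4 : `|c| * `|dlt - a| <= e / 2 * t.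
  apply: (@le_trans _ _ ((`|c| + 1) * (e1 * t))).
    by rewrite ler_pM // lerDl.
  have -> // : (`|c| + 1) * (e1 * t) = e / 2 * t by rewrite /e1; field; rewrite gt_eqF.
have := le_trans h2 h3; lra.
Qed.

End TestFunctions.

(** * Back to the original equation *)

Section PowerInequality.
Context {R : realType}.

(** Each of [a] and [b] is a share [t] of the sum, and [t <= t ^ g] for [t <= 1]. *)
Lemma powR_subadd (a b g : R) : 0 <= a -> 0 <= b -> 0 < g -> g <= 1 ->
  (a + b) `^ g <= a `^ g + b `^ g.
Proof.
move=> a0 b0 g0 g1; have [s0|sn] := eqVneq (a + b) 0.
  by rewrite s0 powR0 ?gt_eqF // addr_ge0 ?powR_ge0.
have sp : 0 < a + b by rewrite lt_def sn addr_ge0.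
have share (t : R) : 0 <= t -> t <= a + b -> t / (a + b) * (a + b) `^ g <= t `^ g.
  move=> t0 ts; have -> : t `^ g = (t / (a + b)) `^ g * (a + b) `^ g.
    by rewrite -powRM ?divfK // ?divr_ge0 // ltW.
  rewrite ler_wpM2r ?powR_ge0 //.
  have [->|tn] := eqVneq t 0; first by rewrite mul0r powR_ge0.
  have tp : 0 < t by rewrite lt_def tn.
  by apply: ger1_powR => //; rewrite divr_gt0 //= ler_pdivrMr // mul1r.
have h1 : a / (a + b) * (a + b) `^ g <= a `^ g by apply: share; rewrite ?lerDl.
have h2 : b / (a + b) * (a + b) `^ g <= b `^ g by apply: share; rewrite ?lerDr.
by apply: le_trans (lerD h1 h2); rewrite -mulrDl -mulrDl divff // mul1r.
Qed.

Lemma powR_dist (a b g : R) : 0 <= a -> 0 <= b -> 0 < g -> g <= 1 ->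
  `|a `^ g - b `^ g| <= `|a - b| `^ g.
Proof.
move=> + + g0 g1; wlog ab : a b / b <= a => [H a0 b0|a0 b0].
  by case/orP: (le_total a b) => h; [rewrite distrC (distrC a)|]; exact: H.
have h1 : b `^ g <= a `^ g by apply: ge0_ler_powR; rewrite ?nnegrE // ltW.
rewrite !ger0_norm ?subr_ge0 //.
have d0 : 0 <= a - b by rewrite subr_ge0.
by have := powR_subadd b0 d0 g0 g1; rewrite addrC subrK; lra.
Qed.

(** The primitive of [s ^ (3/2)], which turns [w ^ 3 |Dw| ^ 2] into [|Du| ^ 2]. *)
Definition prim (s : R) : R := 2 / 5 * s `^ (5 / 2).

Lemma is_derive_prim (s : R) : 0 < s -> is_derive s 1 prim (s `^ (3 / 2)).
Proof.
move=> s0; have si : s \in `]0, +oo[%R by rewrite in_itv /= s0.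
have d1 : derivable ((@powR R) ^~ (5 / 2)) s 1 by exact: (@derivable_powR R 1 (5 / 2) s si).
have e1 : 'D_1 ((@powR R) ^~ (5 / 2)) s = 5 / 2 * s `^ (3 / 2).
  rewrite -derive1E powR_derive1 //; congr (_ * _ `^ _); lra.
have := is_deriveM (is_derive_cst (2 / 5 : R) s 1) (derivableP d1).
rewrite e1 scaler0 addr0 => h; apply: is_derive_eq h _.
by rewrite /GRing.scale /=; field.
Qed.

Lemma le_prim (s t : R) : 0 <= s -> s <= t -> prim s <= prim t.
Proof.
move=> s0 st; rewrite /prim ler_wpM2l //.
by apply: ge0_ler_powR; rewrite ?nnegrE // (le_trans s0).
Qed.

Lemma prim_inverse (u : R) : 0 <= u -> prim ((5 / 2 * u) `^ (2 / 5)) = u.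
Proof.
move=> u0; rewrite /prim -powRrM.
have -> : 2 / 5 * (5 / 2) = 1 :> R by field.
by rewrite powRr1 ?mulr_ge0 //; field.
Qed.

End PowerInequality.

Section ViscositySolution.
Context {R : realType} {n : nat}.
Local Notation E := 'rV[R]_n.
Implicit Types (x y z p q : E) (f u v w : E -> R).
Hypothesis n_gt0 : (0 < n)%N.
Variables (r : R) (f : E -> R).
Hypothesis r_gt0 : 0 < r.
Hypothesis f_cont : {within cball 0 r, continuous f}.
Hypothesis f_ge0 : forall x, cball 0 r x -> 0 <= f x.

Let h x := Num.sqrt (f x).

Lemma sqrt_within : {within cball 0 r, continuous h}.
Proof. by move=> x; apply: continuous_comp; [exact: f_cont|exact: sqrt_continuous]. Qed.

Let h_ge0 x : cball 0 r x -> 0 <= h x.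
Proof. by move=> _; exact: sqrtr_ge0. Qed.

Let U := eikonal_sol r h.

(** The inverse of [prim], applied to the solution of the eikonal equation. *)
Definition visc_sol : E -> R := fun x => (5 / 2 * U x) `^ (2 / 5).

Lemma visc_sol_ge0 x : 0 <= visc_sol x.
Proof. exact: powR_ge0. Qed.

Lemma prim_visc_sol x : cball 0 r x -> prim (visc_sol x) = U x.
Proof. by move=> hx; apply/prim_inverse/(eikonal_sol_ge0 n_gt0 r_gt0 sqrt_within). Qed.

Lemma eball_cball x : eball r x -> cball 0 r x.
Proof. by rewrite /eball /cball /= subr0; exact: ltW. Qed.

Lemma visc_sol_boundary x : enorm x = r -> visc_sol x = 0.
Proof.
move=> xr; rewrite /visc_sol /U (eikonal_sol_boundary n_gt0 r_gt0 sqrt_within h_ge0 xr).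
by rewrite mulr0 powR0 // gt_eqF // divr_gt0.
Qed.

Lemma visc_sol_hoelder bt : 0 < bt -> bt <= 2 / 5 -> exists2 K, 0 < K &
  forall x y, cball 0 r x -> cball 0 r y ->
    `|visc_sol x - visc_sol y| <= K * enorm (x - y) `^ bt.
Proof.
move=> bt0 bt2; have [M M0 hM] := eikonal_sol_lipschitz n_gt0 r_gt0 sqrt_within h_ge0.
pose K := (5 / 2 * M) `^ (2 / 5) * (2 * r) `^ (2 / 5 - bt).
have K0 : 0 <= K by rewrite mulr_ge0 ?powR_ge0.
exists (K + 1); first by rewrite ltr_wpDl.
move=> x y hx hy; set t := enorm (x - y); have t0 : 0 <= t := enorm_ge0 _.
have ux := eikonal_sol_ge0 n_gt0 r_gt0 sqrt_within h_ge0 hx.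
have uy := eikonal_sol_ge0 n_gt0 r_gt0 sqrt_within h_ge0 hy.
have c0 : 0 <= 5 / 2 :> R by [].
have g0 : 0 < 2 / 5 :> R by [].
have g1 : 2 / 5 <= 1 :> R by lra.
apply: (le_trans (powR_dist (mulr_ge0 c0 ux) (mulr_ge0 c0 uy) g0 g1)).
rewrite -mulrBr normrM (ger0_norm c0).
apply: (@le_trans _ _ (K * t `^ bt)); last by rewrite ler_wpM2r ?powR_ge0 // lerDl.
apply: (@le_trans _ _ ((5 / 2 * M * t) `^ (2 / 5))).
  apply: ge0_ler_powR; rewrite ?nnegrE ?mulr_ge0 //.
  by rewrite -mulrA ler_wpM2l //; exact: hM.
rewrite powRM ?mulr_ge0 // /K -[leRHS]mulrA ler_wpM2l ?powR_ge0 //.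
have [->|tn] := eqVneq t 0; first by rewrite powR0 ?mulr_ge0 ?powR_ge0 // gt_eqF.
have -> : 2 / 5 = (2 / 5 - bt) + bt :> R by rewrite subrK.
rewrite powRD ?tn ?implybT // addrK ler_wpM2r ?powR_ge0 //.
apply: ge0_ler_powR; rewrite ?nnegrE ?subr_ge0 ?mulr_ge0 ?(ltW r_gt0) //.
have := enorm_distD 0 x y; move: hx hy; rewrite /cball /= !subr0 sub0r enormN -/t; lra.
Qed.

Lemma visc_sol_within : {within cball 0 r, continuous visc_sol}.
Proof.
have b0 : 0 < 2 / 5 :> R by [].
have [K K0 hK] := visc_sol_hoelder b0 (lexx _).
apply/within_continuousE => x hx e e0.
have [d d0 hd] := small_powR b0 (ltW K0) (divr_gt0 e0 (ltr0n R 2)).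
exists d => // y hy yd; apply: (le_lt_trans (hK y x hy hx)).
by apply: (le_lt_trans (hd _ (enorm_ge0 _) yd)); lra.
Qed.

Lemma smooth_C1 (phi : E -> R) : smooth (eball r) phi -> Ck 1 (eball r) phi.
Proof. exact. Qed.

(** [s ^ 3 |q| ^ 2] is the square of the slope [s ^ (3/2) q] that the chain rule gives
    to [prim w]. *)
Lemma operator_factor x s q : cball 0 r x -> 0 <= s ->
  operatorG f x s q = enorm (s `^ (3 / 2) *: q) ^+ 2 - h x ^+ 2.
Proof.
move=> hx s0; rewrite /operatorG enormZ exprMn real_normK ?num_real //.
rewrite /h sqr_sqrtr ?f_ge0 //; congr (_ * _ - _).
rewrite -[RHS]powR_mulrn ?powR_ge0 // -powRrM.
have -> : 3 / 2 * 2 = 3%:R :> R by field.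
by rewrite powR_mulrn.
Qed.

Lemma visc_sol_zero x : eball r x -> visc_sol x = 0 -> U x = 0.
Proof. by move=> /eball_cball hx w0; rewrite -(prim_visc_sol hx) w0 /prim powR0 ?mulr0 // gt_eqF. Qed.

Lemma near_enorm x (P : E -> Prop) : (\forall y \near x, P y) ->
  exists2 d, 0 < d & forall y, enorm (y - x) < d -> P y.
Proof. by move/nbhs_enormP. Qed.

Lemma visc_subsolution : viscosity_subsolution (operatorG f) (eball r) visc_sol.
Proof.
move=> phi x sphi xr /near_enorm[d0 d00 hmax].
have hx := eball_cball xr; have w0 := visc_sol_ge0 x.
have [s0|sn] := eqVneq (visc_sol x) 0.
  by rewrite /operatorG s0 expr0n mul0r sub0r oppr_le0 f_ge0.
have sp : 0 < visc_sol x by rewrite lt_def sn.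
rewrite operator_factor // subr_le0 lerXn2r ?nnegrE ?enorm_ge0 ?h_ge0 //.
apply: (eikonal_superdifferential n_gt0 r_gt0 sqrt_within h_ge0 xr) => e e0.
have [d d1 hd] := chain_expansion (smooth_C1 sphi) xr sp (is_derive_prim sp) e0.
have [t t0 ht] := ball_room xr.
exists (Num.min (Num.min d d0) t); first by rewrite !lt_min d1 d00.
move=> y; rewrite !lt_min => /andP[/andP[yd yd0] yt].
have hy : cball 0 r y by apply: eball_cball; exact: ht (ltW yt).
have [p0 hp] := hd y yd; have hm := hmax y yd0.
rewrite -/U -(prim_visc_sol hy) -(prim_visc_sol hx).
apply: (@le_trans _ _ (prim (visc_sol x + (phi y - phi x)))).
  by apply: le_prim; [exact: visc_sol_ge0|move: hm; rewrite /=; lra].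
by move: hp; rewrite ler_norml => /andP[_]; lra.
Qed.

(** Where the solution vanishes it is minimal, so that the zero slope is admissible
    and forces [f] to vanish. *)
Lemma visc_supersolution : viscosity_supersolution (operatorG f) (eball r) visc_sol.
Proof.
move=> phi x sphi xr /near_enorm[d0 d00 hmin].
have hx := eball_cball xr; have w0 := visc_sol_ge0 x.
rewrite operator_factor // subr_ge0 lerXn2r ?nnegrE ?enorm_ge0 ?h_ge0 //.
apply: (eikonal_subdifferential n_gt0 r_gt0 sqrt_within h_ge0 xr) => e e0.
have [t t0 ht] := ball_room xr.
have [s0|sn] := eqVneq (visc_sol x) 0.
  exists t => // y yt; have hy : cball 0 r y by apply: eball_cball; exact: ht (ltW yt).
  rewrite -/U (visc_sol_zero xr s0) s0 powR0 ?gt_eqF ?divr_gt0 // scale0r dot0l addr0 sub0r.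
  apply: (@le_trans _ _ 0); first by rewrite oppr_le0 mulr_ge0 ?enorm_ge0 // ltW.
  exact: (eikonal_sol_ge0 n_gt0 r_gt0 sqrt_within h_ge0 hy).
have sp : 0 < visc_sol x by rewrite lt_def sn.
have [d d1 hd] := chain_expansion (smooth_C1 sphi) xr sp (is_derive_prim sp) e0.
exists (Num.min (Num.min d d0) t); first by rewrite !lt_min d1 d00.
move=> y; rewrite !lt_min => /andP[/andP[yd yd0] yt].
have hy : cball 0 r y by apply: eball_cball; exact: ht (ltW yt).
have [p0 hp] := hd y yd; have hm := hmin y yd0.
rewrite -/U -(prim_visc_sol hy) -(prim_visc_sol hx).
apply: (@le_trans _ _ (prim (visc_sol x + (phi y - phi x)))).
  by move: hp; rewrite ler_norml => /andP[]; lra.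
by apply: le_prim => //; move: hm; rewrite /=; lra.
Qed.

End ViscositySolution.

Theorem theorem1p2 (R : realType) (n : nat) (n_gt0 : (0 < n)%N)
    (alpha : R) (alpha_gt0 : 0 < alpha) (alpha_lt1 : alpha < 1)
    (r : R) (r_gt0 : 0 < r) (f g : 'rV[R]_n -> R)
    (f_ge0 : forall x, ceball r x -> 0 <= f x)
    (f_hoelder : Ckhoelder 0 alpha (eball r) f)
    (f_cont : {within ceball r, continuous f})
    (g_cont : {within ceball r, continuous g})
    (f_bigO : exists C : R, forall x, ceball r x ->
       0 <= f x <= C * ((r ^+ 2 - enorm x ^+ 2) ^+ 3 * enorm x ^+ 2)) :
  exists (beta : R) (v : 'rV[R]_n -> R),
    [/\ 0 < beta <= alpha,
        viscosity_solution_bvp r f g v,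
        Ckhoelder 2 beta (eball r) v
      & {within ceball r, continuous v}].
Proof.
have f_c := f_cont; have f_p := f_ge0; rewrite ceballE in f_c f_p.
pose beta := Num.min alpha (2 / 5).
have b0 : 0 < beta by rewrite lt_min alpha_gt0 divr_gt0.
have ba : beta <= alpha by rewrite ge_min lexx.
have b2 : beta <= 2 / 5 by rewrite ge_min lexx orbT.
have b1 : beta < 1 by exact: le_lt_trans alpha_lt1.
have [K K0 hK] := visc_sol_hoelder n_gt0 r_gt0 f_c b0 b2.
have w_cont : {within ceball r, continuous (visc_sol r f)}.
  by rewrite ceballE; exact: visc_sol_within.
rewrite -ceballE in hK.
have [v [cv sv lv bv]] := poisson_hoelder n_gt0 r_gt0 b0 b1 K0 w_cont g_cont hK.
exists beta, v; split => //; first by rewrite b0 ba.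
exists (visc_sol r f); split; split => //.
- split; first exact (visc_subsolution n_gt0 r_gt0 f_c f_p).
  exact (visc_supersolution n_gt0 r_gt0 f_c f_p).
- by move=> x; exact: visc_sol_boundary.
- by case: sv.
Qed.
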